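(* Let $|\gamma|<1$ and assume that $\gamma\neq0$ or $\mu$ is not normalized Lebesgue measure. Let $\Phi_\gamma^*:L^2(\mu)\to\mathcal K_{\theta_\gamma}$ be the unitary operator with $\Phi_\gamma^*U_\gamma=\mathcal M_{\theta_\gamma}\Phi_\gamma^*$, $\Phi_\gamma^*b=c^\gamma$, $\Phi_\gamma^*b_1=c_1^\gamma$. Then for all $f\in L^2(\mu)$, $$(1-|\gamma|^2)^{1/2}\Phi_\gamma^*f=\begin{pmatrix}0\\ \big(\overline\gamma-(\overline\gamma-1)T_+\mathbf 1\big)\Delta_\gamma\end{pmatrix}f+\begin{pmatrix}(1+\overline\gamma\theta_\gamma)/T_+\mathbf 1\\ (\overline\gamma-1)\Delta_\gamma\end{pmatrix}T_+f$$ a.e. on $\mathbb T$, where in the first term $f$ stands for $f_{\mathrm a}=d(f\mu)_{\mathrm a}/d\mu_{\mathrm a}$ (well defined Lebesgue-a.e. where $\Delta_\gamma\ne0$) and the product is $0$ where $\Delta_\gamma=0$.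
   Context: $\mathbb T=\{|z|=1\}$, $\mathbb D$ the unit disc, Lebesgue measure on $\mathbb T$ normalized. Let $\mu$ be a Borel probability measure on $\mathbb T$, $\mu_{\mathrm a}$ its absolutely continuous part, $U=M_\xi$ on $L^2(\mu)$, $b=\mathbf 1$, $b_1(\xi)=\overline\xi$, and for $|\gamma|<1$, $U_\gamma=U+(\gamma-1)(\,\cdot\,,b_1)_{L^2(\mu)}b$. For $\lambda\in\mathbb D$, $R_2\mu(\lambda)=\int_{\mathbb T}\frac{1+\overline\xi\lambda}{1-\overline\xi\lambda}d\mu(\xi)$, $\theta_\gamma(\lambda)=\frac{(1-\gamma)R_2\mu(\lambda)-(1+\gamma)}{(1-\overline\gamma)R_2\mu(\lambda)+(1+\overline\gamma)}$; $\theta_\gamma$ also denotes its boundary values and $\Delta_\gamma=(1-|\theta_\gamma|^2)^{1/2}$ on $\mathbb T$. Model space $\mathcal K_\theta=(H^2\oplus\operatorname{clos}\Delta L^2)\ominus\{(\theta h,\Delta h):h\in H^2\}$ (with $\theta=\theta_\gamma,\Delta=\Delta_\gamma$), model operator $\mathcal M_\theta=P_{\mathcal K_\theta}M_z|_{\mathcal K_\theta}$. Defect vectors: $c^\gamma(z)=(1-|\theta_\gamma(0)|^2)^{-1/2}\big(1-\overline{\theta_\gamma(0)}\theta_\gamma(z),\ -\overline{\theta_\gamma(0)}\Delta_\gamma(z)\big)^T$, $c_1^\gamma(z)=(1-|\theta_\gamma(0)|^2)^{-1/2}\big(z^{-1}(\theta_\gamma(z)-\theta_\gamma(0)),\ z^{-1}\Delta_\gamma(z)\big)^T$.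 For $r\in[0,\infty)\setminus\{1\}$, $T_rf(z)=\int_{\mathbb T}\frac{f(\xi)d\mu(\xi)}{1-r\overline\xi z}$, and $T_+f(z)=\lim_{r\to1^-}T_rf(z)$, which exists for Lebesgue-a.e. $z\in\mathbb T$. *)

(* Defs.v *)
(* mathcomp-analysis (measure, Lebesgue integral, limits)
   + real_closed's complex numbers R[i] over a realType R. *)
From HB Require Import structures.
From mathcomp Require Import all_boot all_order all_algebra.
From mathcomp Require Import all_classical all_reals all_analysis.
From mathcomp Require Import complex.
Set Implicit Arguments. Unset Strict Implicit. Unset Printing Implicit Defensive.
Import Order.TTheory GRing.Theory Num.Theory.
Import numFieldNormedType.Exports.
Local Open Scope classical_set_scope.
Local Open Scope ring_scope.
Local Open Scope complex_scope.

(* The unit circle T is parametrised by t in [0,1) via t |-> exp(2 pi i t).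
   Borel measures on T are Borel measures on R concentrated on [0,1);
   normalised Lebesgue measure on T is Lebesgue measure on [0,1). *)

Section Model.
Variable R : realType.

Definition I01 : set R := `[0%R, 1%R[.

Definition leb : {measure set (measurableTypeR R) -> \bar R} := @lebesgue_measure R.

(* the point of T with parameter t *)
Definition xi (t : R) : R[i] := (cos (2 * pi * t)) +i* (sin (2 * pi * t)).

(* integral of a complex valued function over T (real and imaginary parts) *)
Definition cint (mu : {measure set (measurableTypeR R) -> \bar R}) (f : R -> R[i]) : R[i] :=
  (Rintegral mu I01 (fun t => complex.Re (f t)))%:C
  + 'i * (Rintegral mu I01 (fun t => complex.Im (f t)))%:C.

(* the L^2(mu) inner product *)
Definition ip (mu : {measure set (measurableTypeR R) -> \bar R}) (f g : R -> R[i]) : R[i] :=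
  cint mu (fun t => f t * (g t)^*).

(* membership in L^2(mu): measurable with square integrable modulus *)
Definition L2 (mu : {measure set (measurableTypeR R) -> \bar R}) (f : R -> R[i]) : Prop :=
  measurable_fun I01 (fun t => complex.Re (f t)) /\
  measurable_fun I01 (fun t => complex.Im (f t)) /\
  (\int[mu]_(t in I01) (complex.Re (`|f t| ^+ 2))%:E < +oo)%E.

(* squared L^2(mu) norm *)
Definition nrm2 (mu : {measure set (measurableTypeR R) -> \bar R}) (f : R -> R[i]) : R :=
  Rintegral mu I01 (fun t => complex.Re (`|f t| ^+ 2)).

(* radial limit  lim_{r -> 1^-} F r  of a complex valued function *)
Definition radlim (F : R -> R[i]) : R[i] :=
  (lim ((fun r => complex.Re (F r)) x @[x --> (1:R)^'-]))%:C
  + 'i * (lim ((fun r => complex.Im (F r)) x @[x --> (1:R)^'-]))%:C.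

(* Herglotz integral R_2 mu (lambda), lambda in the disc *)
Definition R2 (mu : {measure set (measurableTypeR R) -> \bar R}) (l : R[i]) : R[i] :=
  cint mu (fun t => (1 + (xi t)^* * l) / (1 - (xi t)^* * l)).

(* theta_gamma in the disc *)
Definition theta (mu : {measure set (measurableTypeR R) -> \bar R}) (g : R[i]) (l : R[i]) : R[i] :=
  ((1 - g) * R2 mu l - (1 + g)) / ((1 - g^*) * R2 mu l + (1 + g^*)).

(* boundary values of theta_gamma (radial limits) *)
Definition thetab (mu : {measure set (measurableTypeR R) -> \bar R}) (g : R[i]) (t : R) : R[i] :=
  radlim (fun r => theta mu g (r%:C * xi t)).

(* Delta_gamma = (1 - |theta_gamma|^2)^(1/2) on T *)
Definition Delta (mu : {measure set (measurableTypeR R) -> \bar R}) (g : R[i]) (t : R) : R[i] :=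
  (Num.sqrt (1 - complex.Re (`|thetab mu g t| ^+ 2)))%:C.

(* T_r f (z) *)
Definition Tr (mu : {measure set (measurableTypeR R) -> \bar R}) (r : R) (f : R -> R[i]) (z : R[i]) : R[i] :=
  cint mu (fun s => f s / (1 - r%:C * (xi s)^* * z)).

(* T_+ f on T *)
Definition Tplus (mu : {measure set (measurableTypeR R) -> \bar R}) (f : R -> R[i]) (t : R) : R[i] :=
  radlim (fun r => Tr mu r f (xi t)).

(* Hardy space H^2 (as a subspace of L^2 of Lebesgue measure on T):
   square integrable functions with vanishing negative Fourier coefficients *)
Definition H2 (h : R -> R[i]) : Prop :=
  L2 leb h /\ forall k : nat, (0 < k)%N -> cint leb (fun t => h t * (xi t) ^+ k) = 0.

(* closure in L^2(T) of Delta L^2(T) *)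
Definition closDL2 (D : R -> R[i]) (h : R -> R[i]) : Prop :=
  L2 leb h /\ forall e : R, 0 < e ->
    exists u, L2 leb u /\ nrm2 leb (fun t => h t - D t * u t) < e.

(* inner product in H^2 (+) clos Delta L^2 *)
Definition ip2 (F G : (R -> R[i]) * (R -> R[i])) : R[i] :=
  ip leb F.1 G.1 + ip leb F.2 G.2.

(* model space K_theta *)
Definition Kth (th D : R -> R[i]) (F : (R -> R[i]) * (R -> R[i])) : Prop :=
  H2 F.1 /\ closDL2 D F.2 /\
  forall h, H2 h -> ip2 F (fun t => th t * h t, fun t => D t * h t) = 0.

(* equality Lebesgue-a.e. on T of pairs of functions *)
Definition ae2 (F G : (R -> R[i]) * (R -> R[i])) : Prop :=
  {ae leb, forall t, I01 t -> F.1 t = G.1 t /\ F.2 t = G.2 t}.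

(* b = 1 and b_1 = conj xi *)
Definition bb : R -> R[i] := fun _ => 1.
Definition b1 : R -> R[i] := fun t => (xi t)^*.

(* the rank-one perturbation U_gamma of U = M_xi on L^2(mu) *)
Definition Ug (mu : {measure set (measurableTypeR R) -> \bar R}) (g : R[i]) (f : R -> R[i]) : R -> R[i] :=
  fun t => xi t * f t + (g - 1) * ip mu f b1 * bb t.

(* defect vectors c^gamma and c_1^gamma *)
Definition cg (mu : {measure set (measurableTypeR R) -> \bar R}) (g : R[i]) : (R -> R[i]) * (R -> R[i]) :=
  let th0 := theta mu g 0 in
  let k := (Num.sqrt (1 - complex.Re (`|th0| ^+ 2)))^-1 in
  (fun t => k%:C * (1 - th0^* * thetab mu g t),
   fun t => k%:C * (- th0^* * Delta mu g t)).

Definition c1g (mu : {measure set (measurableTypeR R) -> \bar R}) (g : R[i]) : (R -> R[i]) * (R -> R[i]) :=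
  let th0 := theta mu g 0 in
  let k := (Num.sqrt (1 - complex.Re (`|th0| ^+ 2)))^-1 in
  (fun t => k%:C * ((xi t)^-1 * (thetab mu g t - th0)),
   fun t => k%:C * ((xi t)^-1 * Delta mu g t)).

(* Phi is a unitary operator from L^2(mu) onto K_theta_gamma with
   Phi U_gamma = M_theta_gamma Phi, Phi b = c^gamma, Phi b_1 = c_1^gamma.
   M_theta = P_K M_z |_K is written out: Phi (U_gamma f) lies in K and
   z Phi f - Phi (U_gamma f) is orthogonal to K. *)
Definition is_Phi (mu : {measure set (measurableTypeR R) -> \bar R}) (g : R[i])
    (Phi : (R -> R[i]) -> (R -> R[i]) * (R -> R[i])) : Prop :=
  let th := thetab mu g in
  let D := Delta mu g in
  (* linear *)
  (forall (a : R[i]) f h, L2 mu f -> L2 mu h ->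
     ae2 (Phi (fun t => a * f t + h t))
         (fun t => a * (Phi f).1 t + (Phi h).1 t,
          fun t => a * (Phi f).2 t + (Phi h).2 t)) /\
  (* into K_theta *)
  (forall f, L2 mu f -> Kth th D (Phi f)) /\
  (* isometric *)
  (forall f h, L2 mu f -> L2 mu h -> ip2 (Phi f) (Phi h) = ip mu f h) /\
  (* onto K_theta *)
  (forall G, Kth th D G -> exists f, L2 mu f /\ ae2 (Phi f) G) /\
  (* intertwining: Phi U_gamma = M_theta Phi *)
  (forall f, L2 mu f ->
     forall G, Kth th D G ->
       ip2 (fun t => xi t * (Phi f).1 t - (Phi (Ug mu g f)).1 t,
            fun t => xi t * (Phi f).2 t - (Phi (Ug mu g f)).2 t) G = 0) /\
  ae2 (Phi bb) (cg mu g) /\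
  ae2 (Phi b1) (c1g mu g).

End Model.

(* Main.v *)
Require Import Defs.
From HB Require Import structures.
From mathcomp Require Import all_boot all_order all_algebra.
From mathcomp Require Import all_classical all_reals all_analysis.
From mathcomp Require Import complex ring lra measurable_realfun.
Set Implicit Arguments. Unset Strict Implicit. Unset Printing Implicit Defensive.
Import Order.TTheory GRing.Theory Num.Theory.
Import numFieldNormedType.Exports.
Local Open Scope classical_set_scope.
Local Open Scope ring_scope.
Local Open Scope complex_scope.

(* Write s = (1 - |gamma|^2)^(1/2) and (v, w) = s (Phi b - z Phi b_1). The intertwining relation
   gives s Phi(xi f) = z s Phi f + (f, b_1) (v, w), while the Cauchy integral T satisfies
   T(xi f)(l) = l T f(l) + (f, b_1). Hence in the disc, where the first component is analytic,
   s (Phi f)_1 - v T f is multiplied by l when f is multiplied by xi; applied to xi^-n f this forces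
   s (Phi f)_1 = v T f in the disc. By Fatou's theorem the factors s (Phi f)_1 and v have radial limits
   almost everywhere, so T_+ f = s (Phi f)_1 / v where v <> 0, and v <> 0 almost everywhere
   since v = (1 - gamma)(1 - q) with an analytic q bounded by 1 and |q(0)| < 1. For the second
   component, the class of f satisfying the formula is a vector space containing 1, stable under
   multiplication by xi and its conjugate and under dominated pointwise limits, hence all of
   L^2(mu). The boundary values of theta enter only through the prescribed vectors Phi b and
   Phi b_1. *)

(** * Square-integrable complex functions on the circle *)

(** Two obstacles shape the proof. Inside the disc, a function on the circle is seen only through
    its Cauchy integral [Cau]; vanishing statements come from a one-step recursion under
    multiplication by [xi], with a bound uniform along the recursion. For [H2] data the Cauchy
    integral is also a Poisson integral, so radial limits reduce to an approximate-identity estimate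
    at Lebesgue points. For the second component the difficulty is that [mu] may have a singular
    part: [mu]-null and Lebesgue-null sets are unrelated, so convergence in [L^2(mu)] says nothing
    about [f] Lebesgue-a.e. Members of [L^2(mu)] are therefore kept as functions on the circle,
    approximations converge at every point under a common dominating function, and the isometry of
    [Phi] controls the images in Lebesgue norm. *)

Section ComplexIntegrals.
Variable R : realType.
Implicit Types (z w : R[i]) (f h k : R -> R[i]) (u : R -> R).

(* The notation [z^*] elaborates to [Num.conj] or to [conjc] depending on the scope in which it
   is parsed; [cj] is the common normal form of the two. *)
Definition cj z : R[i] := complex.Re z -i* complex.Im z.

Lemma conjCE z : Num.conj z = cj z. Proof. by case: z. Qed.
Lemma conjcE z : z^* = cj z. Proof. by case: z. Qed.
Lemma cjD z w : cj (z + w) = cj z + cj w. Proof. by rewrite -!conjcE rmorphD. Qed.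
Lemma cjB z w : cj (z - w) = cj z - cj w. Proof. by rewrite -!conjcE rmorphB. Qed.
Lemma cjN z : cj (- z) = - cj z. Proof. by rewrite -!conjcE rmorphN. Qed.
Lemma cjM z w : cj (z * w) = cj z * cj w. Proof. by rewrite -!conjcE rmorphM. Qed.
Lemma cjV z : cj z^-1 = (cj z)^-1. Proof. by rewrite -!conjcE conjc_inv. Qed.
Lemma cj1 : cj 1 = 1. Proof. by rewrite -conjcE conjc1. Qed.
Lemma cjC (a : R) : cj a%:C = a%:C. Proof. by rewrite -conjcE conjc_real. Qed.
Lemma cjK z : cj (cj z) = z. Proof. by rewrite -!conjcE conjcK. Qed.
Lemma cj_eq0 z : (cj z == 0) = (z == 0). Proof. by rewrite -conjcE conjc_eq0. Qed.

(** The norm of [R[i]] takes values in [R[i]]; the squared modulus as a real polynomial keeps all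
    estimates in [R], within reach of [ring] and [nra]. *)
Definition csq z : R := complex.Re z ^+ 2 + complex.Im z ^+ 2.

Lemma Re_sqr_norm z : complex.Re (`|z| ^+ 2) = csq z.
Proof. by rewrite -add_Re2_Im2. Qed.

Lemma csq_ge0 z : 0 <= csq z. Proof. by rewrite addr_ge0 ?sqr_ge0. Qed.

Lemma csqM z w : csq (z * w) = csq z * csq w.
Proof. by case: z w => [a b] [c d]; rewrite /csq /=; ring. Qed.

Lemma csqX z n : csq (z ^+ n) = csq z ^+ n.
Proof.
elim: n => [|n IH]; last by rewrite !exprS csqM IH.
by rewrite !expr0 /csq /= expr0n expr1n addr0.
Qed.

Lemma csq1 : csq 1 = 1. Proof. by rewrite -(expr0 (1 : R[i])) csqX. Qed.

Lemma csqJ z : csq (cj z) = csq z.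
Proof. by case: z => a b; rewrite /csq /= sqrrN. Qed.

Lemma csqD_le z w : csq (z + w) <= 2 * csq z + 2 * csq w.
Proof.
case: z w => [a b] [c d]; rewrite /csq /=.
have h1 := sqr_ge0 (a - c); have h2 := sqr_ge0 (b - d); nra.
Qed.

Lemma csqN z : csq (- z) = csq z.
Proof. by case: z => a b; rewrite /csq /= !sqrrN. Qed.

Lemma csq_eq0 z : (csq z == 0) = (z == 0).
Proof.
by case: z => a b; rewrite /csq /= paddr_eq0 ?sqr_ge0// !sqrf_eq0 eq_complex.
Qed.

Lemma csq_gt0 z : z != 0 -> 0 < csq z.
Proof. by move=> z0; rewrite lt0r csq_eq0 z0 csq_ge0. Qed.

Lemma csqV z : csq z^-1 = (csq z)^-1.
Proof.
have [->|z0] := eqVneq z 0.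
  have c0 : csq 0 = 0 by apply/eqP; rewrite csq_eq0.
  by rewrite invr0 c0 invr0.
have c0 := csq_gt0 z0; apply: (mulIf (lt0r_neq0 c0)).
by rewrite mulVf ?lt0r_neq0// -csqM mulVf// csq1.
Qed.

Lemma csqC (a : R) : csq a%:C = a ^+ 2.
Proof. by rewrite /csq /= expr0n addr0. Qed.

Lemma mul_conj z : z * (cj z) = (csq z)%:C.
Proof. by case: z => a b; rewrite /csq /cj /=; simpc; congr Complex; ring. Qed.

Lemma ReM z w : complex.Re (z * w) = complex.Re z * complex.Re w - complex.Im z * complex.Im w.
Proof. by case: z w => [a b] [c d]. Qed.

Lemma ImM z w : complex.Im (z * w) = complex.Re z * complex.Im w + complex.Im z * complex.Re w.
Proof. by case: z w => [a b] [c d] /=; rewrite addrC. Qed.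

Lemma ReD z w : complex.Re (z + w) = complex.Re z + complex.Re w.
Proof. by case: z w => [a b] [c d]. Qed.

Lemma ImD z w : complex.Im (z + w) = complex.Im z + complex.Im w.
Proof. by case: z w => [a b] [c d]. Qed.

Lemma ReJ z : complex.Re (cj z) = complex.Re z. Proof. by case: z. Qed.
Lemma ImJ z : complex.Im (cj z) = - complex.Im z. Proof. by case: z. Qed.

Lemma ReV z : complex.Re z^-1 = complex.Re z / csq z.
Proof. by case: z. Qed.
Lemma ImV z : complex.Im z^-1 = - complex.Im z / csq z.
Proof. by case: z => a b; rewrite /= mulNr. Qed.

Lemma csq_xi t : csq (@xi R t) = 1.
Proof. by rewrite /csq /= cos2Dsin2. Qed.

Lemma xi_neq0 t : @xi R t != 0.
Proof. by rewrite -csq_eq0 csq_xi oner_eq0. Qed.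

Lemma mul_xi_conj t : @xi R t * cj (xi t) = 1.
Proof. by rewrite mul_conj csq_xi. Qed.

Definition cmeas f := measurable_fun (@I01 R) (fun t => complex.Re (f t)) /\
  measurable_fun (@I01 R) (fun t => complex.Im (f t)).

Lemma measurable_I01 : measurable (@I01 R : set (measurableTypeR R)).
Proof. exact: measurable_itv. Qed.
Hint Resolve measurable_I01 : core.

Lemma cmeas_cst z : cmeas (fun=> z).
Proof. by split; exact: measurable_cst. Qed.

Lemma cmeasD f h : cmeas f -> cmeas h -> cmeas (fun t => f t + h t).
Proof.
move=> [f1 f2] [h1 h2]; split.
  by under eq_fun do rewrite ReD; exact: measurable_funD.
by under eq_fun do rewrite ImD; exact: measurable_funD.
Qed.

Lemma cmeasM f h : cmeas f -> cmeas h -> cmeas (fun t => f t * h t).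
Proof.
move=> [f1 f2] [h1 h2]; split.
  under eq_fun do rewrite ReM.
  by apply: measurable_funB; exact: measurable_funM.
under eq_fun do rewrite ImM.
by apply: measurable_funD; exact: measurable_funM.
Qed.

Lemma cmeasJ f : cmeas f -> cmeas (fun t => (cj (f t))).
Proof.
move=> [f1 f2]; split; first by under eq_fun do rewrite ReJ.
by under eq_fun do rewrite ImJ; exact: measurable_funN.
Qed.

Lemma cmeasX f n : cmeas f -> cmeas (fun t => f t ^+ n).
Proof.
move=> mf; elim: n => [|n IH]; first by under eq_fun do rewrite expr0; exact: cmeas_cst.
by under eq_fun do rewrite exprS; exact: cmeasM.
Qed.

Lemma cmeas_csq f : cmeas f -> measurable_fun (@I01 R) (fun t => csq (f t)).
Proof. by move=> [f1 f2]; apply: measurable_funD; exact: measurable_funX. Qed.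

Lemma continuous_cos2pi : continuous (fun t : R => cos (2 * pi * t) : R).
Proof.
move=> t; apply: (@continuous_comp _ _ _ (fun t => 2 * pi * t) cos); last exact: continuous_cos.
exact: mulrl_continuous.
Qed.

Lemma continuous_sin2pi : continuous (fun t : R => sin (2 * pi * t) : R).
Proof.
move=> t; apply: (@continuous_comp _ _ _ (fun t => 2 * pi * t) sin); last exact: continuous_sin.
exact: mulrl_continuous.
Qed.

Lemma cmeas_xi : cmeas (@xi R).
Proof.
split => /=; apply: (measurable_funS measurableT) => //; apply: continuous_measurable_fun.
  exact: continuous_cos2pi.
exact: continuous_sin2pi.
Qed.

Section measure.
Variables (m : {measure set (measurableTypeR R) -> \bar R}).
Hypothesis m1 : (m (@I01 R) <= 1)%E.
Local Notation D := (@I01 R).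
Local Notation itg u := (m.-integrable (@I01 R) (EFin \o u)).

Lemma itg_le u (w : R -> R) : measurable_fun D u ->
  (forall t, D t -> `|u t| <= w t) -> itg w -> itg u.
Proof.
move=> mu uw iw; apply: (le_integrable _ _ _ iw) => //.
  exact/measurable_EFinP.
by move=> t Dt /=; rewrite lee_fin (le_trans (uw t Dt))// ler_norm.
Qed.

Lemma itg_cst (a : R) : itg (fun=> a).
Proof.
apply/integrableP; split; first exact/measurable_EFinP.
rewrite integral_cst//= lte_mul_pinfty ?lee_fin//.
by rewrite (le_lt_trans m1)// ltry.
Qed.

Lemma itgD u (w : R -> R) : itg u -> itg w -> itg (fun t => u t + w t).
Proof. by move=> *; exact: (@integrableD _ _ _ m D measurable_I01 (EFin \o u) (EFin \o w)). Qed.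

Lemma itgZ a u : itg u -> itg (fun t => a * u t).
Proof. by move=> iu; have := integrableZl measurable_I01 a iu. Qed.

Lemma itg_meas u : itg u -> measurable_fun D u.
Proof. by case/integrableP => /measurable_EFinP. Qed.

Lemma aeS (P Q : R -> Prop) : (forall t, P t -> Q t) ->
  {ae m, forall t, P t} -> {ae m, forall t, Q t}.
Proof.
move=> PQ; have F := @ae_filter_ringOfSetsType _ (measurableTypeR R) R m.
exact: (@filterS _ _ F P Q).
Qed.

Lemma aeS2 (P1 P2 Q : R -> Prop) : (forall t, P1 t -> P2 t -> Q t) ->
  {ae m, forall t, P1 t} -> {ae m, forall t, P2 t} -> {ae m, forall t, Q t}.
Proof.
move=> PQ; have F := @ae_filter_ringOfSetsType _ (measurableTypeR R) R m.
exact: (@filterS2 _ _ F P1 P2 Q).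
Qed.

Definition itb f := itg (fun t => complex.Re (f t)) /\ itg (fun t => complex.Im (f t)).

Lemma L2P f : L2 m f <-> cmeas f /\ itg (fun t => csq (f t)).
Proof.
have E : (\int[m]_(t in D) `|(csq (f t))%:E| = \int[m]_(t in D) (complex.Re (`|f t| ^+ 2))%:E)%E.
  by apply: eq_integral => t _; rewrite gee0_abs ?lee_fin ?csq_ge0// Re_sqr_norm.
split => [[mr [mi ib]]|[[mr mi] /integrableP[_ ib]]]; last first.
  by split => //; split => //; rewrite -E.
split => //; apply/integrableP; split; first by apply/measurable_EFinP; apply: cmeas_csq; split.
by rewrite E.
Qed.

Lemma nrm2E f : nrm2 m f = \int[m]_(t in D) csq (f t).
Proof. by apply: eq_Rintegral => t _; rewrite Re_sqr_norm. Qed.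

Lemma abs_Re_le z w : `|complex.Re (z * cj w)| <= csq z + csq w.
Proof.
case: z w => [a b] [c d]; rewrite /csq /=.
have h1 := sqr_ge0 (a - c); have h2 := sqr_ge0 (b - d).
have h3 := sqr_ge0 (a + c); have h4 := sqr_ge0 (b + d).
rewrite ler_norml; apply/andP; split; nra.
Qed.

Lemma abs_Im_le z w : `|complex.Im (z * cj w)| <= csq z + csq w.
Proof.
case: z w => [a b] [c d]; rewrite /csq /=.
have h1 := sqr_ge0 (a - d); have h2 := sqr_ge0 (b - c).
have h3 := sqr_ge0 (a + d); have h4 := sqr_ge0 (b + c).
rewrite ler_norml; apply/andP; split; nra.
Qed.

Lemma L2_itbM f h : L2 m f -> L2 m h -> itb (fun t => f t * cj (h t)).
Proof.
move=> /L2P[mf f2] /L2P[mh h2]; have [mr mi] := cmeasM mf (cmeasJ mh).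
split; apply: (itg_le _ _ (itgD f2 h2)) => // t _; rewrite ?abs_Re_le ?abs_Im_le //.
Qed.

Lemma L2_bdd f (K : R) : cmeas f -> (forall t, D t -> csq (f t) <= K) -> L2 m f.
Proof.
move=> mf fK; apply/L2P; split => //; apply: (@itg_le _ (fun=> K)).
- exact: cmeas_csq.
- by move=> t Dt; rewrite ger0_norm ?csq_ge0// fK.
- exact: itg_cst.
Qed.

Lemma L2_itb f : L2 m f -> itb f.
Proof.
move=> f2; have h1 : L2 m (fun=> 1 : R[i]).
  by apply: (@L2_bdd _ (csq 1)) => //; exact: cmeas_cst.
have := L2_itbM f2 h1; congr (itb _).
by apply/funext => t; rewrite -[RHS]mulr1 -[in RHS]cj1.
Qed.

Lemma L2_lin a f h : L2 m f -> L2 m h -> L2 m (fun t => a * f t + h t).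
Proof.
move=> /L2P[mf f2] /L2P[mh h2].
have mm : cmeas (fun t => a * f t + h t).
  by apply: cmeasD => //; apply: cmeasM => //; exact: cmeas_cst.
apply/L2P; split => //.
apply: (@itg_le _ (fun t => 2 * csq a * csq (f t) + 2 * csq (h t))).
- exact: cmeas_csq.
- move=> t _; rewrite ger0_norm ?csq_ge0//.
  by rewrite (le_trans (csqD_le _ _))// csqM mulrA.
- by apply: itgD; exact: itgZ.
Qed.

Lemma L2_bddM k f (K : R) : cmeas k -> (forall t, D t -> csq (k t) <= K) ->
  L2 m f -> L2 m (fun t => k t * f t).
Proof.
move=> mk kK /L2P[mf f2]; have mm := cmeasM mk mf.
apply/L2P; split => //; apply: (@itg_le _ (fun t => K * csq (f t))).
- exact: cmeas_csq.
- by move=> t Dt; rewrite ger0_norm ?csq_ge0// csqM ler_wpM2r ?csq_ge0// kK.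
- exact: itgZ.
Qed.

Lemma L2_xi f : L2 m f -> L2 m (fun t => xi t * f t).
Proof.
by apply: (@L2_bddM _ _ 1) => [|t _]; [exact: cmeas_xi|rewrite csq_xi].
Qed.

Lemma cintE f : cint m f = (\int[m]_(t in D) complex.Re (f t)) +i* (\int[m]_(t in D) complex.Im (f t)).
Proof. by rewrite /cint; simpc. Qed.

Lemma Re_cint f : complex.Re (cint m f) = \int[m]_(t in D) complex.Re (f t).
Proof. by rewrite cintE. Qed.

Lemma Im_cint f : complex.Im (cint m f) = \int[m]_(t in D) complex.Im (f t).
Proof. by rewrite cintE. Qed.

Lemma eq_cint f h : (forall t, D t -> f t = h t) -> cint m f = cint m h.
Proof.
move=> fh; rewrite !cintE; congr Complex; apply: eq_Rintegral => t; rewrite inE => Dt; by rewrite fh.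
Qed.

Lemma cint_lin a f h : itb f -> itb h ->
  cint m (fun t => a * f t + h t) = a * cint m f + cint m h.
Proof.
move=> [f1 f2] [h1 h2]; apply/eqP; rewrite eq_complex; apply/andP; split; apply/eqP.
  rewrite Re_cint ReD ReM !Re_cint Im_cint.
  under eq_Rintegral do rewrite ReD ReM -mulNr -addrA.
  rewrite RintegralD//; [|exact: itgZ|by apply: itgD => //; exact: itgZ].
  rewrite RintegralD//; [|exact: itgZ].
  by rewrite !RintegralZl// mulNr addrA.
rewrite Im_cint ImD ImM !Re_cint !Im_cint.
under eq_Rintegral do rewrite ImD ImM -addrA.
rewrite RintegralD//; [|exact: itgZ|by apply: itgD => //; exact: itgZ].
rewrite RintegralD//; [|exact: itgZ].
by rewrite !RintegralZl// addrA.
Qed.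

(** Nonnegativity of a variance: expanding the integral of [(u - c)^2], with [c] the integral of
    [u], produces [- 2 c^2 + c^2 m(D)], which is at most [- c^2] because the mass is at most one. *)
Lemma sqr_Rintegral_le u : itg u -> itg (fun t => u t ^+ 2) ->
  (\int[m]_(t in D) u t) ^+ 2 <= \int[m]_(t in D) (u t ^+ 2).
Proof.
move=> iu iu2; set c := \int[m]_(t in D) u t.
have : 0 <= \int[m]_(t in D) ((u t - c) ^+ 2).
  by apply: Rintegral_ge0 => t _; exact: sqr_ge0.
rewrite (@eq_Rintegral _ _ _ m D (fun t => u t ^+ 2 + (- (2 * c) * u t + c ^+ 2))); last first.
  by move=> t _ /=; ring.
have i0 : itg (fun t => - (2 * c) * u t) by exact: itgZ.
have ic : itg (fun=> c ^+ 2) by exact: itg_cst.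
have i1 : itg (fun t => - (2 * c) * u t + c ^+ 2) by exact: itgD.
rewrite RintegralD// RintegralD//.
rewrite RintegralZl// Rintegral_cst// -/c.
have : fine (m D) <= 1.
  by rewrite -lee_fin fineK// ge0_fin_numE// (le_lt_trans m1)// ltry.
have := sqr_ge0 c; nra.
Qed.

Lemma csq_cint_le f : L2 m f -> csq (cint m f) <= nrm2 m f.
Proof.
move=> f2; have [f1r f1i] := L2_itb f2; have /L2P[[mr mi] ff] := f2.
have ir : itg (fun t => complex.Re (f t) ^+ 2).
  apply: itg_le ff => [|t _]; first exact: measurable_funX.
  by rewrite ger0_norm ?sqr_ge0// lerDl sqr_ge0.
have ii : itg (fun t => complex.Im (f t) ^+ 2).
  apply: itg_le ff => [|t _]; first exact: measurable_funX.
  by rewrite ger0_norm ?sqr_ge0// lerDr sqr_ge0.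
rewrite /csq Re_cint Im_cint nrm2E RintegralD//.
by apply: lerD; exact: sqr_Rintegral_le.
Qed.

Lemma nrm2_ge0 f : 0 <= nrm2 m f.
Proof. by rewrite nrm2E; apply: Rintegral_ge0 => t _; exact: csq_ge0. Qed.

Lemma nrm2_le f h (K : R) : 0 <= K -> cmeas f -> L2 m h ->
  (forall t, D t -> csq (f t) <= K * csq (h t)) -> nrm2 m f <= K * nrm2 m h.
Proof.
move=> K0 mf /L2P[mh h2] fh; rewrite !nrm2E -RintegralZl//.
have ik := itgZ K h2.
apply: le_Rintegral => //; apply: itg_le ik => [|t Dt]; first exact: cmeas_csq.
by rewrite ger0_norm ?csq_ge0// fh.
Qed.

Lemma ipE f h : ip m f h = cint m (fun t => f t * cj (h t)).
Proof. by apply: eq_cint => t _; rewrite conjCE. Qed.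

Lemma ip_nrm2 f : ip m f f = (nrm2 m f)%:C.
Proof.
rewrite ipE cintE nrm2E; congr Complex.
  by apply: eq_Rintegral => t _; rewrite mul_conj.
transitivity (\int[m]_(t in D) (0 : R)); last by rewrite Rintegral_cst// mul0r.
by apply: eq_Rintegral => t _; rewrite mul_conj.
Qed.

Lemma ip_linl a f h k : L2 m f -> L2 m h -> L2 m k ->
  ip m (fun t => a * f t + h t) k = a * ip m f k + ip m h k.
Proof.
move=> f2 h2 k2; rewrite !ipE -cint_lin; [|exact: L2_itbM..].
by apply: eq_cint => t _; ring.
Qed.

Lemma ipC f h : L2 m f -> L2 m h -> ip m h f = (cj (ip m f h)).
Proof.
move=> f2 h2; rewrite !ipE !cintE; have [i1 i2] := L2_itbM f2 h2.
congr Complex; first by apply: eq_Rintegral => t _; case: (f t) (h t) => [a b] [c d] /=; ring.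
rewrite -mulN1r -RintegralZl//.
by apply: eq_Rintegral => t _; case: (f t) (h t) => [a b] [c d] /=; ring.
Qed.

Lemma nrm2_eq0 f : L2 m f -> nrm2 m f = 0 -> {ae m, forall t, D t -> f t = 0}.
Proof.
move=> /L2P[mf f2] f0.
have i0 : (\int[m]_(t in D) `|(csq (f t))%:E| = 0)%E.
  under eq_integral do rewrite gee0_abs ?lee_fin ?csq_ge0//.
  by rewrite -[LHS]fineK ?integrable_fin_num// -[fine _]/(Rintegral m D (fun t => csq (f t))) -nrm2E f0.
have /measurable_EFinP mc := cmeas_csq mf.
have := (ae_eq_integral_abs m measurable_I01 mc).1 i0.
by apply: aeS => t /[apply] /eqP; rewrite eqe csq_eq0 => /eqP.
Qed.

Lemma ae_eq_cint f h : cmeas f -> cmeas h ->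
  {ae m, forall t, D t -> f t = h t} -> cint m f = cint m h.
Proof.
move=> [f1 f2] [h1 h2] fh; rewrite !cintE; congr Complex; congr fine;
  apply: ae_eq_integral => //; try exact/measurable_EFinP;
  by apply: aeS fh => t fh Dt; rewrite fh.
Qed.

End measure.
End ComplexIntegrals.

(** * The Cauchy integral in the disc *)

Section CauchyIntegral.
Variable R : realType.
Implicit Types (z w l a : R[i]) (f h k F : R -> R[i]) (u : R -> R).
Hint Resolve measurable_I01 : core.
Local Notation D := (@I01 R).

(** Writing the inverse as [exp (- ln u)] reduces the claim to compositions of measurable
    functions. *)
Lemma measurable_funV_gt0 u : measurable_fun D u -> (forall t, D t -> 0 < u t) ->
  measurable_fun D (fun t => (u t)^-1).
Proof.
move=> mu u0; apply: (eq_measurable_fun (fun t => expR (- ln (u t)))).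
  by move=> t; rewrite inE => /u0 ut; rewrite expRN lnK.
have ml : measurable_fun D (fun t => ln (u t)) . exact (measurableT_comp (@measurable_ln R) mu).
have mn : measurable_fun D (fun t => - ln (u t)) := measurable_funN ml.
exact (measurableT_comp (@measurable_expR R) mn).
Qed.

Definition ker l t : R[i] := (1 - cj (xi t) * l)^-1.

(** The real part [a] of [cj (xi t) * l] is at most [r = |l| < 1], and [(1 - a)^2 - (1 - r)^2 = (r -
    a)(2 - r - a)] is nonnegative. *)
Lemma csq_ker_ge l t : csq l < 1 -> (1 - Num.sqrt (csq l)) ^+ 2 <= csq (1 - cj (xi t) * l).
Proof.
move=> l1; set r := Num.sqrt _.
have r0 : 0 <= r by exact: sqrtr_ge0.
have rr : r ^+ 2 = csq l by rewrite sqr_sqrtr// csq_ge0.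
have r1 : r < 1 by rewrite -(@ltr_pXn2r _ 2)// ?nnegrE// expr1n rr.
have : csq (cj (xi t) * l) = r ^+ 2 by rewrite csqM csqJ csq_xi mul1r.
case: (cj (xi t) * l) => a b; rewrite /csq /= => H.
have b0 := sqr_ge0 b.
have ar : a <= r by rewrite leNgt; apply/negP => ra; nra.
have : 0 <= (r - a) * (2 - r - a) by apply: mulr_ge0; lra.
nra.
Qed.

Definition ker_bound l : R := ((1 - Num.sqrt (csq l)) ^+ 2)^-1.

Lemma csq_sqrt_lt1 l : csq l < 1 -> 0 < (1 - Num.sqrt (csq l)) ^+ 2.
Proof.
move=> l1; rewrite exprn_gt0// subr_gt0 -(@ltr_pXn2r _ 2)// ?nnegrE ?sqrtr_ge0//.
by rewrite expr1n sqr_sqrtr// csq_ge0.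
Qed.

Lemma ker_bound_ge0 l : 0 <= ker_bound l. Proof. by rewrite invr_ge0 sqr_ge0. Qed.

Lemma csq_ker_le l t : csq l < 1 -> csq (ker l t) <= ker_bound l.
Proof.
move=> l1; have h := csq_sqrt_lt1 l1; have h2 := csq_ker_ge t l1.
by rewrite csqV lef_pV2 ?posrE// (lt_le_trans h).
Qed.

Lemma ker_den_neq0 l t : csq l < 1 -> 1 - (cj (@xi R t)) * l != 0.
Proof.
by move=> l1; rewrite -csq_eq0 gt_eqF// (lt_le_trans (csq_sqrt_lt1 l1))// csq_ker_ge.
Qed.

Lemma cmeas_ker l : csq l < 1 -> cmeas (ker l).
Proof.
move=> l1; have md : cmeas (fun t => 1 - (cj (@xi R t)) * l).
  rewrite (_ : (fun t => _) = fun t => 1 + (-1) * (cj (xi t) * l)); last first.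
    by apply/funext => t; rewrite mulN1r.
  apply: cmeasD; first exact: cmeas_cst.
  apply: cmeasM; first exact: cmeas_cst.
  by apply: cmeasM; [exact/cmeasJ/cmeas_xi|exact: cmeas_cst].
have mc : measurable_fun D (fun t => (csq (1 - (cj (@xi R t)) * l))^-1).
  apply: measurable_funV_gt0; first exact: cmeas_csq.
  by move=> t _; apply: csq_gt0; exact: ker_den_neq0.
case: md => m1 m2; split.
  by under eq_fun do rewrite ReV; exact: measurable_funM.
by under eq_fun do rewrite ImV; apply: measurable_funM => //; exact: measurable_funN.
Qed.

Section measure.
Variable m : {measure set (measurableTypeR R) -> \bar R}.
Hypothesis m1 : (m D <= 1)%E.

Definition Cau F l : R[i] := cint m (fun t => F t / (1 - cj (xi t) * l)).

Lemma L2_ker F l : csq l < 1 -> L2 m F -> L2 m (fun t => F t / (1 - cj (xi t) * l)).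
Proof.
move=> l1 F2; rewrite (_ : (fun t => _) = (fun t => ker l t * F t)); last first.
  by apply/funext => t; rewrite mulrC.
apply: (@L2_bddM _ _ _ _ (ker_bound l)) => //; first exact: cmeas_ker.
by move=> t _; exact: csq_ker_le.
Qed.

Lemma Cau_lin a f h l : csq l < 1 -> L2 m f -> L2 m h ->
  Cau (fun t => a * f t + h t) l = a * Cau f l + Cau h l.
Proof.
move=> l1 f2 h2; rewrite /Cau -cint_lin//; [|exact/L2_itb/L2_ker..].
by apply: eq_cint => t _; rewrite mulrDl mulrA.
Qed.

(** Since [xi * cj xi = 1], one has [xi / (1 - cj xi * l) = xi + l / (1 - cj xi * l)]. This identity
    drives the recursions of [Cau_sPhi1] and [H2_mul_Cau]. *)
Lemma Cau_xi f l : csq l < 1 -> L2 m f ->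
  Cau (fun t => xi t * f t) l = l * Cau f l + cint m (fun t => xi t * f t).
Proof.
move=> l1 f2; rewrite /Cau -cint_lin//; [|exact/L2_itb/L2_ker|exact/L2_itb/L2_xi].
apply: eq_cint => t _; have h := ker_den_neq0 t l1; have := mul_xi_conj t.
move: (f t) (xi t) (cj (xi t)) h => x y yc h E.
apply: (mulIf h); rewrite mulrDl -!mulrA mulVf// mulr1.
transitivity (l * x + x * y - x * l * (y * yc)); first by rewrite E; ring.
by ring.
Qed.

Lemma csq_Cau_le f l : csq l < 1 -> L2 m f -> csq (Cau f l) <= ker_bound l * nrm2 m f.
Proof.
move=> l1 f2; have k2 := L2_ker l1 f2; apply: (le_trans (csq_cint_le _ _)) => //.
have /(L2P)[mk _] := k2.
apply: nrm2_le => //; first exact: ker_bound_ge0.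
by move=> t _; rewrite csqM mulrC ler_wpM2r ?csq_ge0// csq_ker_le.
Qed.

Lemma ae_eq_Cau f h l : csq l < 1 -> L2 m f -> L2 m h ->
  {ae m, forall t, D t -> f t = h t} -> Cau f l = Cau h l.
Proof.
move=> l1 f2 h2 fh; have /L2P[mf _] := L2_ker l1 f2; have /L2P[mh _] := L2_ker l1 h2.
by apply: ae_eq_cint => //; apply: aeS fh => t fh Dt; rewrite fh.
Qed.

End measure.

Lemma Tr_Cau (m : {measure set (measurableTypeR R) -> \bar R}) r f t :
  Tr m r f (xi t) = Cau m f (r%:C * xi t).
Proof. by apply: eq_cint => s _; rewrite conjCE; congr (_ / (1 - _)); ring. Qed.

Lemma csq_rxi (r t : R) : csq (r%:C * xi t) = r ^+ 2.
Proof. by rewrite csqM csq_xi mulr1 csqC. Qed.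

(* The substitute for convergence of Neumann series: a bounded family with [d n = l d (n+1)],
   [|l| < 1], vanishes. *)
Lemma geometric_eq0 (d : nat -> R[i]) l (K : R) : csq l < 1 ->
  (forall n, d n = l * d n.+1) -> (forall n, csq (d n) <= K) -> d 0%N = 0.
Proof.
move=> l1 dE dK; have d0 n : d 0%N = l ^+ n * d n.
  by elim: n => [|n ->]; rewrite ?expr0 ?mul1r// dE mulrA exprSr.
apply/eqP; rewrite -csq_eq0 eq_le csq_ge0 andbT.
have h n : csq (d 0%N) <= csq l ^+ n * K.
  by rewrite (d0 n) csqM csqX ler_wpM2l// exprn_ge0// csq_ge0.
have c : (fun n => csq l ^+ n * K) @ \oo --> (0 * K : R).
  by apply: cvgMr_tmp; apply: cvg_expr; rewrite ger0_norm ?csq_ge0.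
rewrite mul0r in c; rewrite -(cvg_lim _ c)//.
by apply: limr_ge; [apply/cvg_ex; exists 0|near=> n; exact: h].
Unshelve. all: end_near. Qed.

Lemma leb_I01E : leb R D = 1%E.
Proof.
have E : leb R D = lebesgue_measure ([set` `[0%R, 1%R[] : set R) by [].
by rewrite E lebesgue_measure_itv /= lte_fin ltr01 oppr0 adde0.
Qed.

Lemma leb_I01 : (leb R D <= 1)%E.
Proof. by rewrite leb_I01E. Qed.
Hint Resolve leb_I01 : core.

Lemma fine_leb_I01 : fine (leb R D) = 1.
Proof. by rewrite leb_I01E. Qed.

Definition poisson l t : R := (1 - csq l) / csq (1 - cj (xi t) * l).

(** Formally [cj (ker l)] is the sum of [(cj l)^n xi^n], so only vanishing coefficients of [F]
    occur. The identity [cj (ker l) = 1 + cj l * xi * cj (ker l)] turns this into a recursion for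
    [geometric_eq0]. *)
Lemma H2_conj_ker F l : H2 F -> csq l < 1 ->
  cint (leb R) (fun t => F t * (xi t * (cj (ker l t)))) = 0.
Proof.
move=> [F2 Fk] l1; set d := fun n => cint (leb R) (fun t => (cj (ker l t)) * (xi t ^+ n.+1 * F t)).
have mx n : L2 (leb R) (fun t => xi t ^+ n * F t).
  apply: (@L2_bddM _ _ _ _ 1) => //; first exact/cmeasX/cmeas_xi.
  by move=> t _; rewrite csqX csq_xi expr1n.
have dL n : L2 (leb R) (fun t => (cj (ker l t)) * (xi t ^+ n * F t)).
  apply: (@L2_bddM _ _ _ _ (ker_bound l)) => //; first exact/cmeasJ/cmeas_ker.
  by move=> t _; rewrite csqJ csq_ker_le.
have c1 : csq (cj l) < 1 by rewrite csqJ.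
rewrite (_ : cint _ _ = d 0%N); last by apply: eq_cint => t _; rewrite expr1; ring.
apply: (@geometric_eq0 d (cj l) (ker_bound l * nrm2 (leb R) F)) => // n; last first.
  apply: (le_trans (csq_cint_le _ _)) => //.
  apply: nrm2_le => //; first exact: ker_bound_ge0.
    by have /L2P[] := dL n.+1.
  by move=> t _; rewrite !csqM csqX csq_xi expr1n mul1r csqJ ler_wpM2r ?csq_ge0 ?csq_ker_le.
have z : cint (leb R) (fun t => xi t ^+ n.+1 * F t) = 0.
  by rewrite -(Fk n.+1)//; apply: eq_cint => t _; rewrite mulrC.
rewrite -[RHS]addr0 -z -cint_lin; [|exact: L2_itb..].
apply: eq_cint => t _; rewrite [xi t ^+ n.+2]exprS /ker.
have E : cj (1 - cj (xi t) * l)^-1 = (1 - xi t * cj l)^-1.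
  by rewrite cjV; congr (_^-1); rewrite cjB cjM cjK cj1.
have h : 1 - xi t * cj l != 0.
  rewrite -(cjK (xi t)) -cjM -cj1 -cjB cj_eq0.
  exact: ker_den_neq0.
rewrite E; move: (F t) (xi t) (xi t ^+ n.+1) (cj l) h => x y yn lc h.
apply: (mulfI h); rewrite !mulrDr [LHS]mulrA mulfV// mul1r.
have -> : (1 - y * lc) * (lc * ((1 - y * lc)^-1 * (y * yn * x))) =
  (1 - y * lc) * (1 - y * lc)^-1 * (lc * (y * yn * x)) by ring.
by rewrite mulfV//; ring.
Qed.

(** Nonnegative and negative powers of [cj xi] in the Poisson kernel; the second summand is what
    [H2_conj_ker] annihilates. *)
Lemma poisson_ker l t : csq l < 1 ->
  (poisson l t)%:C = ker l t + cj l * (xi t * (cj (ker l t))).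
Proof.
move=> l1; have h := ker_den_neq0 t l1; rewrite /poisson /ker.
have hc := h; rewrite -cj_eq0 in hc.
rewrite cjV rmorphM /= fmorphV /= rmorphB /= rmorph1 -!mul_conj.
move: h hc; rewrite cjB cjM cj1 cjK; have := mul_xi_conj t.
move: (xi t) (cj (xi t)) (cj l) => x xc lc E h hc.
have -> : l * lc = l * lc * (x * xc) by rewrite E mulr1.
field.
by rewrite hc h.
Qed.

(** The second summand of [poisson_ker] integrates to zero against [H2]. The remaining kernel is
    real and positive, so the radial limit can be studied for real functions. *)
Lemma Cau_poisson F l : H2 F -> csq l < 1 ->
  Cau (leb R) F l = (\int[leb R]_(t in D) (complex.Re (F t) * poisson l t))
    +i* (\int[leb R]_(t in D) (complex.Im (F t) * poisson l t)).
Proof.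
move=> HF l1; have F2 := HF.1.
transitivity (cint (leb R) (fun t => F t * (poisson l t)%:C)); last first.
  rewrite cintE; congr Complex; apply: eq_Rintegral => t _.
    by rewrite ReM /= mulr0 subr0.
  by rewrite ImM /= mulr0 add0r.
transitivity (cj l * cint (leb R) (fun t => F t * (xi t * (cj (ker l t)))) + Cau (leb R) F l).
  by rewrite H2_conj_ker// mulr0 add0r.
rewrite -cint_lin; [|apply: L2_itb => //|apply: L2_itb => //; exact: L2_ker]; last first.
  rewrite (_ : (fun t => _) = (fun t => (xi t * (cj (ker l t))) * F t)); last first.
    by apply/funext => t; rewrite mulrC.
  apply: (@L2_bddM _ _ _ _ (ker_bound l)) => //.
    by apply: cmeasM; [exact: cmeas_xi|exact/cmeasJ/cmeas_ker].
  by move=> t _; rewrite csqM csq_xi mul1r csqJ csq_ker_le.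
by apply: eq_cint => t _; rewrite poisson_ker// /ker; ring.
Qed.

End CauchyIntegral.

(** * Fourier orthogonality and Cauchy integrals of constants *)

Section Constants.
Variable R : realType.
Implicit Types (z w l a : R[i]) (f h k F : R -> R[i]) (u : R -> R).
Hint Resolve measurable_I01 leb_I01 : core.
Local Notation D := (@I01 R).

Lemma Rintegral_leb_FTC (u v : R -> R) : (forall t : R, is_derive t 1 v (u t)) ->
  (forall t, `|u t| <= 1) -> continuous u ->
  \int[leb R]_(t in D) u t = v 1 - v 0.
Proof.
move=> dv u1 cu.
have iu : (leb R).-integrable D (EFin \o u).
  apply: (@itg_le _ _ _ (fun=> 1)) => //; last exact: itg_cst.
  by apply: (measurable_funS measurableT) => //; exact: continuous_measurable_fun.
rewrite (_ : \int[leb R]_(t in D) u t = \int[lebesgue_measure]_(t in `[0, 1[) u t)//.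
rewrite Rintegral_itv_bndo_bndc// /Rintegral (@continuous_FTC2 _ _ v)//.
- by apply: continuous_subspaceT => t; exact: cu.
- split => [t _||]; first exact: (@ex_derive _ _ _ _ _ _ _ (dv t)).
    by apply: cvg_at_right_filter; apply: differentiable_continuous; apply/derivable1_diffP;
      exact: (@ex_derive _ _ _ _ _ _ _ (dv 0)).
  by apply: cvg_at_left_filter; apply: differentiable_continuous; apply/derivable1_diffP;
      exact: (@ex_derive _ _ _ _ _ _ _ (dv 1)).
- by move=> t _; rewrite derive1E; exact: (@derive_val _ _ _ _ _ _ _ (dv t)).
Qed.

Lemma xiX (t : R) n : xi t ^+ n = cos (2 * pi * (n%:R * t)) +i* sin (2 * pi * (n%:R * t)).
Proof.
elim: n => [|n IH].
  by rewrite expr0 mul0r mulr0 cos0 sin0.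
have -> : 2 * pi * (n.+1%:R * t) = 2 * pi * t + 2 * pi * (n%:R * t) by rewrite -natr1; ring.
by rewrite exprS IH /xi cosD sinD; simpc; congr Complex; ring.
Qed.

Lemma sin_period_nat n : sin (2 * pi * n%:R) = 0 :> R.
Proof.
have -> : 2 * pi * n%:R = 0 + (pi *+ 2) *+ n :> R.
  by rewrite add0r -[(pi *+ 2) *+ n]mulr_natr -[pi *+ 2]mulr_natl.
by rewrite periodicn ?sin0//; exact: sinD2pi.
Qed.

Lemma cos_period_nat n : cos (2 * pi * n%:R) = 1 :> R.
Proof.
have -> : 2 * pi * n%:R = 0 + (pi *+ 2) *+ n :> R.
  by rewrite add0r -[(pi *+ 2) *+ n]mulr_natr -[pi *+ 2]mulr_natl.
by rewrite periodicn ?cos0//; exact: cosD2pi.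
Qed.

(** The primitives [sin (om t) / om] and [- cos (om t) / om] take equal values at 0 and 1, [om]
    being an integer multiple of [2 pi]. *)
Lemma H2_1 : H2 (fun=> 1 : R[i]).
Proof.
split; first by apply: (@L2_bdd _ _ _ _ (csq 1)) => //; exact: cmeas_cst.
move=> k k0; rewrite cintE; set om : R := 2 * pi * k%:R.
have om0 : om != 0 by rewrite !mulf_neq0 ?gt_eqF ?pi_gt0 ?ltr0n.
have omE t : 2 * pi * (k%:R * t) = om * t by rewrite mulrA.
have c1 : continuous (fun t : R => om * t : R) by exact: mulrl_continuous.
have dom (t : R) : is_derive t 1 (fun t : R => om * t : R) om.
  by apply: is_derive_eq; rewrite ?scaler0 ?add0r ?addr0 /GRing.scale /= ?mulr1.
congr Complex.
- transitivity (\int[leb R]_(t in D) cos (om * t)).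
    by apply: eq_Rintegral => t _; rewrite mul1r xiX /= omE.
  have dv (t : R) : is_derive t 1 (fun t => om^-1 * sin (om * t)) (cos (om * t)).
    have ds := is_derive1_comp (is_derive_sin (om * t)) (dom t).
    by apply: is_derive_eq; rewrite /GRing.scale /=; field.
  rewrite (Rintegral_leb_FTC dv).
  + by rewrite mulr1 mulr0 sin0 mulr0 sin_period_nat mulr0 subr0.
  + by move=> t; exact: cos_max.
  + by move=> t; apply: continuous_comp; [exact: c1|exact: continuous_cos].
- transitivity (\int[leb R]_(t in D) sin (om * t)).
    by apply: eq_Rintegral => t _; rewrite mul1r xiX /= omE.
  have dv (t : R) : is_derive t 1 (fun t => - (om^-1) * cos (om * t)) (sin (om * t)).
    have ds := is_derive1_comp (is_derive_cos (om * t)) (dom t).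
    by apply: is_derive_eq; rewrite /GRing.scale /=; field.
  rewrite (Rintegral_leb_FTC dv).
  + by rewrite mulr1 mulr0 cos0 mulr1 cos_period_nat; ring.
  + by move=> t; exact: sin_max.
  + by move=> t; apply: continuous_comp; [exact: c1|exact: continuous_sin].
Qed.

(** From [ker l = 1 + l * ker l * cj xi]: the last term has mean zero, by conjugating [H2_conj_ker]
    for the constant 1. *)
Lemma Cau_cst l a : csq l < 1 -> Cau (leb R) (fun=> a) l = a.
Proof.
move=> l1; have [L1 k1] := H2_1.
have L0 : L2 (leb R) (fun=> 0 : R[i]).
  by apply: (@L2_bdd _ _ _ _ (csq 0)) => //; exact: cmeas_cst.
have Lc : L2 (leb R) (fun t => xi t * cj (ker l t)).
  apply: (@L2_bdd _ _ _ _ (ker_bound l)) => //.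
    by apply: cmeasM; [exact: cmeas_xi|exact/cmeasJ/cmeas_ker].
  by move=> t _; rewrite csqM csq_xi mul1r csqJ csq_ker_le.
have Lk : L2 (leb R) (fun t => ker l t * cj (xi t)).
  apply: (@L2_bdd _ _ _ _ (ker_bound l)) => //.
    by apply: cmeasM; [exact: cmeas_ker|exact/cmeasJ/cmeas_xi].
  by move=> t _; rewrite csqM csqJ csq_xi mulr1 csq_ker_le.
have z : cint (leb R) (fun t => ker l t * cj (xi t)) = 0.
  transitivity (ip (leb R) (fun=> 1) (fun t => xi t * cj (ker l t))).
    by rewrite ipE; apply: eq_cint => t _; rewrite cjM cjK mul1r mulrC.
  rewrite (ipC Lc L1) ipE; apply/eqP; rewrite cj_eq0; apply/eqP.
  rewrite -[RHS](H2_conj_ker H2_1 l1); apply: eq_cint => t _.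
  by rewrite cj1 mulr1 mul1r.
have c1 : cint (leb R) (fun=> 1 : R[i]) = 1.
  by rewrite cintE !Rintegral_cst// fine_leb_I01 !mulr1.
transitivity (a * (l * cint (leb R) (fun t => ker l t * cj (xi t)) + cint (leb R) (fun=> 1 : R[i]))
  + cint (leb R) (fun=> 0 : R[i])); last first.
  have -> : cint (leb R) (fun=> 0 : R[i]) = 0 by rewrite cintE !Rintegral_cst// mul0r.
  by rewrite z c1 mulr0 add0r mulr1 addr0.
rewrite -cint_lin; [|exact: L2_itb..].
rewrite -cint_lin; [|apply: L2_itb => //; apply: L2_lin => //|exact: L2_itb].
apply: eq_cint => t _; have h := ker_den_neq0 t l1; rewrite /ker addr0.
by field.
Qed.

End Constants.

(** * Fatou's theorem *)

Section Fatou.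
Variable R : realType.
Implicit Types (z w l a : R[i]) (f h k F : R -> R[i]) (u : R -> R).
Hint Resolve measurable_I01 leb_I01 : core.
Local Notation D := (@I01 R).
Local Notation itg u := ((leb R).-integrable (@I01 R) (EFin \o u)).
Local Notation P r t s := (poisson (r%:C * xi t) s).

Lemma itg_bddM u (w : R -> R) K : itg u -> measurable_fun D w ->
  (forall t, D t -> `|w t| <= K) -> itg (fun t => w t * u t).
Proof.
move=> iu mw wK; have mu := itg_meas iu.
apply: (@itg_le _ _ _ (fun t => K * `|u t|)).
- exact: measurable_funM.
- by move=> t Dt; rewrite normrM ler_wpM2r// wK.
- by apply: itgZ => //; exact: (integrable_norm iu).
Qed.

(** This form separates two lower bounds: [(1 - r)^2] bounds the Poisson kernel everywhere, the
    cosine term bounds it away from [t]. *)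
Lemma csq_den r (t s : R) :
  csq (1 - cj (xi s) * (r%:C * xi t)) = (1 - r) ^+ 2 + 2 * r * (1 - cos (2 * pi * (s - t))).
Proof.
rewrite (mulrBr (2 * pi) s t) cosB /xi /csq /cj /=.
have := cos2Dsin2 (2 * pi * s); have := cos2Dsin2 (2 * pi * t).
move: (cos _) (sin _) (cos _) (sin _) => c d a b h1 h2.
transitivity (1 - 2 * r * (a * c + b * d) + r ^+ 2 * ((a ^+ 2 + b ^+ 2) * (c ^+ 2 + d ^+ 2))); first by ring.
by rewrite h1 h2; ring.
Qed.

Lemma poisson_ge0 r (t s : R) : 0 <= r < 1 -> 0 <= P r t s.
Proof.
move=> /andP[r0 r1]; rewrite /poisson csq_rxi divr_ge0 ?csq_ge0//.
by rewrite subr_ge0 expr_le1// ltW.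
Qed.

Lemma poisson_le r (t s c : R) : 0 <= r < 1 -> 0 < c ->
  c <= csq (1 - cj (xi s) * (r%:C * xi t)) -> P r t s <= 2 * (1 - r) / c.
Proof.
move=> /andP[r0 r1] c0 h; rewrite /poisson csq_rxi.
apply: ler_pM.
- by rewrite subr_ge0 expr_le1// ltW.
- by rewrite invr_ge0 csq_ge0.
- nra.
- by rewrite lef_pV2 ?posrE// (lt_le_trans c0).
Qed.

Lemma poisson_le_max r (t s : R) : 0 <= r < 1 -> P r t s <= 2 / (1 - r).
Proof.
move=> /andP[r0 r1]; have d0 : 0 < 1 - r by rewrite subr_gt0.
have -> : 2 / (1 - r) = 2 * (1 - r) / (1 - r) ^+ 2 by field; rewrite gt_eqF.
apply: poisson_le; rewrite ?r0 ?exprn_gt0// csq_den lerDl.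
by rewrite !mulr_ge0// subr_ge0 cos_le1.
Qed.

Lemma pi_lt4 : (pi : R) < 4.
Proof. by have := pihalf_lt2 R; rewrite ltr_pdivrMr// -natrM. Qed.

(** Mean value theorem on [[0, x]], cosine being decreasing on [[0, 1]]. The constant [cos 1] is
    crude; its positivity is what counts. *)
Lemma sin_ge_lin (x : R) : 0 <= x <= 1 -> cos 1 * x <= sin x.
Proof.
move=> /andP[]; rewrite le_eqVlt => /orP[/eqP<- _|x0 x1]; first by rewrite mulr0 sin0.
have dsin (y : R) : y \in `]0, x[ -> is_derive y 1 sin (cos y) by move=> _; exact: is_derive_sin.
have [|c] := MVT x0 dsin; first by apply: continuous_subspaceT; exact: continuous_sin.
rewrite in_itv /= => /andP[c0 cx]; rewrite sin0 !subr0 => ->.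
have pi1 : (1 : R) <= pi by have := pi_ge2 R; lra.
apply: ler_wpM2r; first exact: ltW.
rewrite leNgt ltr_cos ?in_itv /= -?leNgt ?(ltW c0) ?ler01//=.
- lra.
- lra.
Qed.

(** The right side is twice the square of [sin (pi y)]. The bound 1/4 and [pi < 4] put [pi |y|] into
    [[0, 1]], where [sin_ge_lin] applies. *)
Lemma one_sub_cos_ge (y : R) : `|y| <= 1 / 4 -> cos 1 ^+ 2 * y ^+ 2 <= 1 - cos (2 * pi * y).
Proof.
move=> y4; have pg := pi_gt0 R; have p4 := pi_lt4; have p2 := pi_ge2 R.
have -> : 2 * pi * y = (pi * y) *+ 2 by rewrite -[(pi * y) *+ 2]mulr_natl mulrA.
rewrite cos_mulr2n.
have c2 := cos2Dsin2 (pi * y).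
have y0 := normr_ge0 y.
have := @sin_ge_lin (`|pi * y|); rewrite normrM (gtr0_norm pg) => sg.
have {}sg : cos 1 * (pi * `|y|) <= sin (pi * `|y|) by apply: sg; nra.
have s2 : sin (pi * `|y|) ^+ 2 = sin (pi * y) ^+ 2.
  by rewrite !sin2cos2; congr (1 - _ ^+ 2); rewrite -[RHS]cos_norm normrM (gtr0_norm pg).
have c1 := @cos1_gt0 R.
have h0 : 0 <= cos 1 * (pi * `|y|) by rewrite !mulr_ge0// ltW.
have h1 : (cos 1 * (pi * `|y|)) ^+ 2 <= sin (pi * y) ^+ 2.
  by rewrite -s2 ler_pXn2r// nnegrE// (le_trans h0 sg).
have h2 : cos 1 ^+ 2 * y ^+ 2 <= (cos 1 * (pi * `|y|)) ^+ 2.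
  by rewrite !exprMn real_normK ?num_real// ler_wpM2l ?sqr_ge0// ler_peMl ?sqr_ge0// exprn_ege1//; lra.
rewrite -[(cos _ ^+ 2) *+ 2]mulr_natl; have := sqr_ge0 (sin (pi * y)); lra.
Qed.

(** A parameter near 1 is near 0 on the circle, hence the two-sided hypothesis; the reflection
    [y -> 1 - y] leads back to [[0, 1/2]], where the cosine decreases. *)
Lemma cos_far (eta y : R) : 0 < eta -> eta <= y <= 1 - eta -> cos (2 * pi * y) <= cos (2 * pi * eta).
Proof.
move=> e0 /andP[ey ye]; have pg := pi_gt0 R.
have mono (v : R) : eta <= v -> v <= 1 / 2 -> cos (2 * pi * v) <= cos (2 * pi * eta).
  move=> ev v2; rewrite leNgt ltr_cos ?in_itv /= -?leNgt.
  - by rewrite ler_pM2l// mulr_gt0.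
  - apply/andP; split; nra.
  - apply/andP; split; nra.
have [y2|/ltW y2] := leP y (1 / 2); first exact: mono.
have -> : cos (2 * pi * y) = cos (2 * pi * (1 - y)).
  rewrite mulrBr mulr1 cosB.
  have -> : 2 * pi = pi *+ 2 :> R by rewrite mulr_natl.
  by rewrite cos2pi sin2pi mul1r mul0r addr0.
apply: mono; lra.
Qed.

Lemma cos_eta_lt1 (eta : R) : 0 < eta <= 1 / 2 -> cos (2 * pi * eta) < 1.
Proof.
move=> /andP[e0 e2]; have pg := pi_gt0 R; rewrite -[X in _ < X]cos0 ltr_cos ?in_itv /=.
- by rewrite !mulr_gt0.
- apply/andP; split; nra.
- apply/andP; split; nra.
Qed.

Lemma meas_poisson r t : 0 <= r < 1 -> measurable_fun D (fun s => P r t s).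
Proof.
move=> /andP[r0 r1]; have l1 : csq (r%:C * xi t) < 1.
  by rewrite csq_rxi expr_lt1.
apply: measurable_funM; first exact: measurable_cst.
under eq_fun do rewrite -csqV.
by apply: cmeas_csq; exact: cmeas_ker.
Qed.

Section point.
Variables (u : R -> R) (t : R).
Hypotheses (iu : itg u) (t0 : 0 < t) (t1 : t < 1).
Let g s := `|u s - u t|.
Let b rho s : R := \1_(`]t - rho, t + rho[) s.
Let A rho := \int[leb R]_(s in D) (b rho s * g s).
Let I r rho := \int[leb R]_(s in D) (P r t s * (b rho s * g s)).

Let ig : itg g.
Proof.
have ic : itg (fun=> - u t) by exact: itg_cst.
exact: (integrable_norm (itgD iu ic)).
Qed.

Let ibg rho : itg (fun s => b rho s * g s).
Proof.
apply: (@itg_bddM _ _ 1) => // [|s _].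
  by apply: measurable_indic; exact: measurable_itv.
by rewrite /b indicE; case: (_ \in _); rewrite ?normr0 ?normr1.
Qed.

Let iPg r (v : R -> R) : 0 <= r < 1 -> itg v -> itg (fun s => P r t s * v s).
Proof.
move=> r01 iv; apply: (@itg_bddM _ _ (2 / (1 - r))) => //; first exact: meas_poisson.
by move=> s _; rewrite ger0_norm ?poisson_ge0// poisson_le_max.
Qed.

Let b_out rho s : 0 < rho -> b rho s = 0 -> rho <= `|s - t|.
Proof.
move=> r0; rewrite /b indicE; case: (boolP (_ \in _)) => [_ /eqP|]; first by rewrite oner_eq0.
by rewrite notin_setE /= in_itv /= leNgt => h _; apply/negP; rewrite ltr_norml => h'; apply: h; lra.
Qed.

Let b_in rho s : b rho s = 1 -> `|s - t| < rho.
Proof.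
rewrite /b indicE; case: (boolP (_ \in _)) => [|_ /eqP]; last by rewrite eq_sym oner_eq0.
rewrite inE /= in_itv /= => h _; rewrite ltr_norml; lra.
Qed.

Let b01 rho s : b rho s = 0 \/ b rho s = 1.
Proof. by rewrite /b indicE; case: (_ \in _); [right|left]. Qed.

Let b_ge0 rho s : 0 <= b rho s.
Proof. by rewrite /b indicE ler0n. Qed.

(** On the annulus [rho / 2 <= |s - t| < rho] the kernel's denominator is at least
    [cos 1 ^ 2 * (rho / 2) ^ 2], by [one_sub_cos_ge] and [2 r >= 1]. The leading 4 comes from the
    halved radius. *)
Let I_step r rho : 1 / 2 <= r < 1 -> 0 < rho <= 1 / 4 ->
  I r rho <= I r (rho / 2) + 4 * (2 * (1 - r) / (cos 1 ^+ 2 * rho ^+ 2)) * A rho.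
Proof.
move=> /andP[r2 r1] /andP[p0 p4]; have r01 : 0 <= r < 1 by apply/andP; split => //; lra.
have c1 := @cos1_gt0 R; set K := 4 * _.
have K0 : 0 <= K.
  rewrite /K; apply: mulr_ge0 => //; apply: divr_ge0; last by rewrite mulr_ge0 ?sqr_ge0.
  by rewrite mulr_ge0// subr_ge0 ltW.
rewrite /I /A -RintegralZl// -RintegralD//; [|exact: iPg|exact: itgZ].
apply: le_Rintegral => //; [exact: iPg|apply: itgD; [exact: iPg|exact: itgZ]|].
move=> s _ /=; have g0 : 0 <= g s by exact: normr_ge0.
have P0 := poisson_ge0 t s r01.
have [->|bi] := b01 rho s.
  by rewrite !mul0r !mulr0 addr0 mulr_ge0// mulr_ge0.
rewrite bi !mul1r; have [b2|b2] := b01 (rho / 2) s; last by rewrite b2 mul1r lerDl mulr_ge0.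
rewrite b2 mul0r mulr0 add0r ler_wpM2r//.
have h1 : rho / 2 <= `|s - t| by apply: b_out => //; rewrite divr_gt0.
have h2 := b_in bi.
have h3 : cos 1 ^+ 2 * (s - t) ^+ 2 <= 1 - cos (2 * pi * (s - t)) by apply: one_sub_cos_ge; lra.
have h4 : (rho / 2) ^+ 2 <= (s - t) ^+ 2.
  by rewrite -[leRHS]real_normK ?num_real// ler_pXn2r ?nnegrE// divr_ge0// ltW.
have c2 : 0 < cos 1 ^+ 2 :> R by rewrite exprn_gt0.
have -> : K = 2 * (1 - r) / (cos 1 ^+ 2 * (rho / 2) ^+ 2).
  by rewrite /K; field; rewrite !gt_eqF.
apply: poisson_le => //; first by rewrite mulr_gt0 ?exprn_gt0 ?divr_gt0.
rewrite csq_den.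
have h5 : cos 1 ^+ 2 * (rho / 2) ^+ 2 <= 1 - cos (2 * pi * (s - t)).
  by rewrite (le_trans _ h3)// ler_pM2l.
have h6 := cos_le1 (2 * pi * (s - t)).
have := sqr_ge0 (1 - r); nra.
Qed.

Let I_small r rho : 0 <= r < 1 -> I r rho <= 2 / (1 - r) * A rho.
Proof.
move=> r01; rewrite /I /A -RintegralZl//.
apply: le_Rintegral => //; [exact: iPg|exact: itgZ|move=> s _].
by rewrite ler_wpM2r ?poisson_le_max// mulr_ge0 ?normr_ge0.
Qed.

(** The conditions [eta <= t] and [eta <= 1 - t] give [|s - t| <= 1 - eta] on [D], so a point
    outside the interval is also far from [t] on the circle, and the kernel is [O(1 - r)] there. *)
Let far r eta : 1 / 2 <= r < 1 -> 0 < eta -> eta <= t -> eta <= 1 - t ->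
  \int[leb R]_(s in D) (P r t s * g s) <= I r eta +
    2 * (1 - r) / (1 - cos (2 * pi * eta)) * \int[leb R]_(s in D) g s.
Proof.
move=> /andP[r2 r1] e0 et e1t; have r01 : 0 <= r < 1 by apply/andP; split => //; lra.
have k1 : cos (2 * pi * eta) < 1 by apply: cos_eta_lt1; lra.
have k0 : 0 < 1 - cos (2 * pi * eta) by rewrite subr_gt0.
set K := _ / (1 - _).
have K0 : 0 <= K by rewrite divr_ge0 ?(ltW k0)// mulr_ge0// subr_ge0 ltW.
rewrite /I -RintegralZl// -RintegralD//; [|exact: iPg|exact: itgZ].
apply: le_Rintegral => //; [exact: iPg|apply: itgD; [exact: iPg|exact: itgZ]|].
move=> s; rewrite /I01 /= in_itv /= => /andP[s0 s1]; have g0 : 0 <= g s by exact: normr_ge0.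
have [b2|->] := b01 eta s; last by rewrite mul1r lerDl mulr_ge0.
rewrite b2 mul0r mulr0 add0r ler_wpM2r//.
have h1 := b_out e0 b2.
have h2 : `|s - t| <= 1 - eta by rewrite ler_norml; lra.
apply: poisson_le => //; rewrite csq_den.
have E : cos (2 * pi * (s - t)) = cos (2 * pi * `|s - t|).
  by rewrite -cos_norm !normrM (gtr0_norm (pi_gt0 R)) ger0_norm.
have h3 : cos (2 * pi * (s - t)) <= cos (2 * pi * eta).
  by rewrite E; apply: cos_far => //; rewrite h1 h2.
have := sqr_ge0 (1 - r); nra.
Qed.

(* Halving the radius repeatedly, from [eta] down to a radius comparable with [1 - r], each
   dyadic annulus contributes a geometrically decaying multiple of [e]. *)
Lemma poisson_lebesgue_point :
  (forall e, 0 < e -> exists2 eta, 0 < eta & forall rho, 0 < rho <= eta ->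
     \int[leb R]_(s in D) (\1_(`]t - rho, t + rho[) s * `|u s - u t|) <= e * rho) ->
  forall e, 0 < e -> exists2 d, 0 < d & forall r, 1 - d < r < 1 ->
    \int[leb R]_(s in D) (P r t s * `|u s - u t|) <= e.
Proof.
move=> HA e e0; have c1 := @cos1_gt0 R; have c2 : 0 < cos 1 ^+ 2 :> R by rewrite exprn_gt0.
(* One [ep] pays for the far part, two for the innermost interval, [16 / cos 1 ^ 2] for the
   annuli. *)
set C : R := 3 + 16 / cos 1 ^+ 2.
have C0 : 0 < C by rewrite addr_gt0// divr_gt0.
have ep0 : 0 < e / C by rewrite divr_gt0.
have [eta0 eta00 HA'] := HA _ ep0; set ep := e / C in ep0 HA'.
set eta := Num.min (Num.min eta0 (1 / 4)) (Num.min t (1 - t)).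
have etag : 0 < eta by rewrite !lt_min eta00 t0 subr_gt0 t1 !andbT divr_gt0.
have [e1 e2 e3 e4] : [/\ eta <= eta0, eta <= 1 / 4, eta <= t & eta <= 1 - t].
  by split; rewrite /eta !ge_min lexx ?orbT.
clearbody eta.
have k1 : cos (2 * pi * eta) < 1 by apply: cos_eta_lt1; lra.
set G := \int[leb R]_(s in D) g s.
have G0 : 0 <= G by apply: Rintegral_ge0 => s _; exact: normr_ge0.
set k := 1 - cos (2 * pi * eta).
have k0 : 0 < k by rewrite subr_gt0.
have G1 : 0 < 2 * G + 1 by lra.
exists (Num.min (Num.min eta (1 / 2)) (ep * k / (2 * G + 1))).
  by rewrite !lt_min etag divr_gt0//= divr_gt0// mulr_gt0.
move=> r /andP[]; rewrite ltrBlDr -ltrBlDl lt_min => /andP[]; rewrite lt_min => /andP[d1 d2] d3 r1.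
have r2 : 1 / 2 <= r < 1 by lra.
have d0 : 0 < 1 - r by rewrite subr_gt0.
apply: (le_trans (far r2 etag e3 e4)); rewrite -/G -/k.
have T2 : 2 * (1 - r) / k * G <= ep.
  rewrite mulrAC ler_pdivrMr//; move: d3; rewrite ltr_pdivlMr// => d3; nra.
(* The annulus at radius [eta / 2 ^ k] costs a fixed multiple of [2 ^ k]; the sum over [k < n] is
   absorbed by [2 ^ n]. *)
have step n : I r eta <= I r (eta / 2 ^+ n) + 8 * (1 - r) * ep / (cos 1 ^+ 2 * eta) * 2 ^+ n.
  elim: n => [|n IH].
    rewrite expr0 divr1 mulr1 lerDl; apply: divr_ge0; last by rewrite mulr_ge0 ?sqr_ge0// ltW.
    by apply: mulr_ge0; [rewrite mulr_ge0// ltW|exact: ltW].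
  apply: (le_trans IH).
  have q0 : 0 < (2 : R) ^+ n by rewrite exprn_gt0.
  have q1 : 1 <= (2 : R) ^+ n by rewrite exprn_ege1// ler1n.
  have p0 : 0 < eta / 2 ^+ n by rewrite divr_gt0.
  have pe : eta / 2 ^+ n <= eta by rewrite ler_pdivrMr// ler_peMr// ltW.
  have p14 : 0 < eta / 2 ^+ n <= 1 / 4 by rewrite p0 (le_trans pe).
  have := I_step r2 p14.
  have -> : eta / 2 ^+ n / 2 = eta / 2 ^+ n.+1 by rewrite exprSr invfM mulrA.
  set K := 4 * _ => st.
  have K0 : 0 <= K.
    rewrite /K; apply: mulr_ge0 => //; apply: divr_ge0; last by rewrite mulr_ge0 ?sqr_ge0.
    by rewrite mulr_ge0// subr_ge0 ltW.
  have Ar : A (eta / 2 ^+ n) <= ep * (eta / 2 ^+ n).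
    by apply: HA'; rewrite p0 (le_trans pe).
  have KA : K * A (eta / 2 ^+ n) <= K * (ep * (eta / 2 ^+ n)) by rewrite ler_wpM2l.
  have KE : K * (ep * (eta / 2 ^+ n)) = 8 * (1 - r) * ep / (cos 1 ^+ 2 * eta) * 2 ^+ n.
    by rewrite /K; field; rewrite !gt_eqF.
  have -> : 8 * (1 - r) * ep / (cos 1 ^+ 2 * eta) * 2 ^+ n.+1 =
      2 * (8 * (1 - r) * ep / (cos 1 ^+ 2 * eta) * 2 ^+ n) by rewrite (exprS 2 n); ring.
  lra.
(* The least [n] with [eta / 2 ^ n <= 1 - r]. That inequality controls the innermost interval
   through [I_small]; minimality bounds the accumulated annuli. The case [n = 0] is excluded by
   [1 - r < eta]. *)
have [n n1 n2] : exists2 n, eta <= 2 ^+ n * (1 - r) & 2 ^+ n * (1 - r) <= 2 * eta.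
  have ex : exists n, eta <= 2 ^+ n * (1 - r).
    exists (Num.trunc (eta / (1 - r))).+1; rewrite -ler_pdivrMr//.
    apply: (@le_trans _ _ (Num.trunc (eta / (1 - r))).+1%:R).
      by rewrite ltW// truncnS_gt.
    by rewrite -natrX ler_nat ltnW// ltn_expl.
  case: (ex_minnP ex) => -[|n] h1 h2; first by move: h1; rewrite expr0 mul1r; lra.
  exists n.+1 => //; rewrite exprS -mulrA ler_pM2l//.
  by have [//|/ltW/h2] := leP (2 ^+ n * (1 - r)) eta; rewrite ltnn.
have q0 : 0 < (2 : R) ^+ n by rewrite exprn_gt0.
have q1 : 1 <= (2 : R) ^+ n by rewrite exprn_ege1// ler1n.
have p0 : 0 < eta / 2 ^+ n by rewrite divr_gt0.
have pe : eta / 2 ^+ n <= eta by rewrite ler_pdivrMr// ler_peMr// ltW.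
have r01 : 0 <= r < 1 by lra.
have T3 : I r (eta / 2 ^+ n) <= 2 * ep.
  apply: (le_trans (I_small _ r01)).
  apply: (@le_trans _ _ (2 / (1 - r) * (ep * (eta / 2 ^+ n)))).
    by rewrite ler_wpM2l ?divr_ge0 ?(ltW d0)//; apply: HA'; rewrite p0 (le_trans pe).
  have -> : 2 / (1 - r) * (ep * (eta / 2 ^+ n)) = 2 * ep * (eta / (2 ^+ n * (1 - r))).
    by field; rewrite !gt_eqF.
  have x1 : eta / (2 ^+ n * (1 - r)) <= 1 by rewrite ler_pdivrMr ?mulr_gt0// mul1r.
  by apply: ler_piMr => //; rewrite mulr_ge0// ltW.
have T4 : 8 * (1 - r) * ep / (cos 1 ^+ 2 * eta) * 2 ^+ n <= 16 / cos 1 ^+ 2 * ep.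
  have -> : 8 * (1 - r) * ep / (cos 1 ^+ 2 * eta) * 2 ^+ n = 8 / cos 1 ^+ 2 * ep * ((2 ^+ n * (1 - r)) / eta).
    by field; rewrite !gt_eqF.
  have -> : 16 / cos 1 ^+ 2 * ep = 8 / cos 1 ^+ 2 * ep * 2 by field; rewrite gt_eqF.
  apply: ler_wpM2l; last by rewrite ler_pdivrMr.
  by rewrite mulr_ge0// ltW// divr_gt0.
have E : e = ep * C by rewrite /ep divfK// gt_eqF.
have := step n; rewrite E /C; lra.
Qed.

End point.
End Fatou.

(** * Radial limits of Poisson and Cauchy integrals *)

Section FatouTheorem.
Variable R : realType.
Implicit Types (z w l a : R[i]) (f h k F : R -> R[i]) (u : R -> R).
Hint Resolve measurable_I01 leb_I01 : core.
Local Notation D := (@I01 R).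
Local Notation itg u := ((leb R).-integrable (@I01 R) (EFin \o u)).
Local Notation P r t s := (poisson (r%:C * xi t) s).

Lemma itg_poisson u r t : itg u -> 0 <= r < 1 -> itg (fun s => u s * P r t s).
Proof.
move=> iu r01; rewrite (_ : (fun s => _) = (fun s => P r t s * u s)); last first.
  by apply/funext => s; rewrite mulrC.
apply: (@itg_bddM _ _ _ (2 / (1 - r))) => //; first exact: meas_poisson.
by move=> s _; rewrite ger0_norm ?poisson_ge0// poisson_le_max.
Qed.

Lemma int_poisson r t : 0 <= r < 1 -> \int[leb R]_(s in D) P r t s = 1.
Proof.
move=> /andP[r0 r1]; have l1 : csq (r%:C * xi t) < 1 by rewrite csq_rxi expr_lt1.
have := Cau_poisson (H2_1 R) l1; rewrite Cau_cst// => /(congr1 (@complex.Re R)) /= ->.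
by apply: eq_Rintegral => s _; rewrite mul1r.
Qed.

(** Lebesgue points concern averages over intervals of the line, so [u] is extended by zero off [D].
    An interval of radius [rho] has length [2 rho], whence the threshold [e / 2] for the average. *)
Lemma lebesgue_pt_I01 u t : itg u -> 0 < t < 1 -> lebesgue_pt (u \_ D) t ->
  forall e, 0 < e -> exists2 eta, 0 < eta & forall rho, 0 < rho <= eta ->
     \int[leb R]_(s in D) (\1_(`]t - rho, t + rho[) s * `|u s - u t|) <= e * rho.
Proof.
move=> iu /andP[t0 t1] lp e e0.
have Dt : D t by rewrite /I01 /= in_itv /= (ltW t0).
have /fine_cvgP[fin cv] := lp.
have e20 : 0 < e / 2 by rewrite divr_gt0.
have H : \forall r \near 0^'+, davg (u \_ D) t r \is a fin_num /\ `|fine (davg (u \_ D) t r)| < e / 2.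
  near=> r; split; first by near: r.
  rewrite -normrN -[- _]add0r; near: r.
  by move/cvgrPdist_lt : cv => /(_ _ e20).
have [eta /= eta0 He] := H.
exists (eta / 2); first by rewrite divr_gt0.
move=> rho /andP[rho0 rhoe].
have [|f1 f2] := He rho _ rho0.
  by rewrite /ball_ /= sub0r normrN gtr0_norm// (le_lt_trans rhoe)// ltr_pdivrMr// ltr_pMr// ltr1n.
have mB : measurable (`]t - rho, t + rho[ : set (measurableTypeR R)) by exact: measurable_itv.
have mu : measurable_fun D u := itg_meas iu.
have mv : measurable_fun (setT : set (measurableTypeR R)) (fun s => `|(u \_ D) s - (u \_ D) t|).
  apply: measurableT_comp => //; apply: measurable_funB; last exact: measurable_cst.
  exact ((measurable_restrictT u (@measurable_I01 R)).1 mu).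
have avgE : davg (u \_ D) t rho = ((rho *+ 2)^-1%:E *
    \int[lebesgue_measure]_(s in ball t rho) (`|(u \_ D) s - (u \_ D) t|)%:E)%E.
  by rewrite /davg /iavg lebesgue_measure_ball ?(ltW rho0)// inver gt_eqF ?mulrn_wgt0.
have ge : (\int[leb R]_(s in D) (\1_(`]t - rho, t + rho[) s * `|u s - u t|)%:E <=
    \int[lebesgue_measure]_(s in ball t rho) (`|(u \_ D) s - (u \_ D) t|)%:E)%E.
  rewrite integral_mkcond [leRHS]integral_mkcond ball_itv.
  apply: ge0_le_integral => //.
  - move=> s _; rewrite patchE; case: ifP => //.
  - apply: (measurable_restrictT _ (@measurable_I01 R)).1; apply/measurable_EFinP.
    apply: measurable_funM; first exact: measurable_indic.
    apply: measurableT_comp => //; apply: measurable_funB => //; exact: measurable_cst.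
  - apply: (measurable_restrictT _ mB).1; apply/measurable_EFinP.
    exact: measurable_funS mv.
  - move=> s _; rewrite !patchE indicE (mem_set Dt); case: ifP => sD.
      by case: ifP => _; rewrite ?mul1r ?mul0r.
    by case: ifP => _; rewrite /point /= ?lee_fin.
have : (\int[leb R]_(s in D) (\1_(`]t - rho, t + rho[) s * `|u s - u t|)%:E <= (e * rho)%:E)%E.
  apply: (le_trans ge).
  have Jd : (\int[lebesgue_measure]_(s in ball t rho) (`|(u \_ D) s - (u \_ D) t|)%:E =
      ((rho *+ 2)%:E * davg (u \_ D) t rho))%E.
    by rewrite avgE muleA -EFinM divff ?mul1e// gt_eqF// mulrn_wgt0.
  rewrite Jd -(fineK f1) -EFinM lee_fin.
  move: f2; rewrite ltr_norml => /andP[_ f2].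
  rewrite -mulr_natl; nra.
rewrite -lee_fin; apply: le_trans; rewrite /Rintegral fineK//.
have ic : itg (fun=> - u t) by exact: itg_cst.
have ii : itg (fun s => \1_(`]t - rho, t + rho[) s * `|u s - u t|).
  apply: (@itg_bddM _ (fun s => `|u s - u t|) _ 1) => //.
  - exact: (integrable_norm (itgD iu ic)).
  - by move=> s _; rewrite indicE; case: (_ \in _); rewrite ?normr0 ?normr1.
exact (integrable_fin_num (@measurable_I01 R) ii).
Unshelve. all: end_near. Qed.

Lemma fatou_real u : itg u -> {ae (leb R), forall t, D t ->
  (fun r => \int[leb R]_(s in D) (u s * P r t s)) r @[r --> (1 : R)^'-] --> u t}.
Proof.
move=> iu.
have li : locally_integrable setT (u \_ D).
  apply: open_integrable_locally; first exact: openT.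
  by have := (integrable_mkcond _ (@measurable_I01 R)).1 iu; rewrite restrict_EFin.
have ld := lebesgue_differentiation li.
(* The parameter 0 is discarded as a null set: [poisson_lebesgue_point] asks for room on both sides
   of [t]. *)
have z : {ae (leb R), forall t : R, t != 0}.
  exists [set 0 : R]; split => //; first exact: lebesgue_measure_set1.
  by move=> t /= /negP; rewrite negbK => /eqP.
apply: aeS2 ld z => t lp tn0 Dt.
have /andP[t0 t1] : 0 < t < 1.
  by move: Dt; rewrite /I01 /= in_itv /= lt0r tn0.
have t01 : 0 < t < 1 by rewrite t0 t1.
have HA := lebesgue_pt_I01 iu t01 lp.
apply/cvgrPdist_le => e e0.
have [d d0 Hd] := poisson_lebesgue_point iu t0 t1 HA e0.
near=> r.
have r1 : r < 1 by near: r; exact: nbhs_left_lt.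
have r0 : 0 <= r by rewrite ltW//; near: r; apply: nbhs_left_gt.
have rd : 1 - d < r by near: r; apply: nbhs_left_gt; rewrite ltrBlDr ltrDl.
have r01 : 0 <= r < 1 by rewrite r0.
have ic : itg (fun=> - u t) by exact: itg_cst.
have iP : itg (fun s => P r t s).
  have := itg_poisson t (itg_cst (@leb_I01 R) 1) r01.
  by congr (_.-integrable _ (EFin \o _)); apply/funext => s; rewrite mul1r.
have -> : u t - \int[leb R]_(s in D) (u s * P r t s) = - \int[leb R]_(s in D) ((u s + - u t) * P r t s).
  transitivity (- (\int[leb R]_(s in D) (u s * P r t s) + (- u t) * \int[leb R]_(s in D) P r t s)).
    by rewrite int_poisson// mulr1 opprD opprK addrC.
  rewrite -RintegralZl// -RintegralD//; [|exact: itg_poisson|exact: itgZ].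
  by congr (- _); apply: eq_Rintegral => s _; rewrite mulrDl.
have iD : itg (fun s => (u s + - u t) * P r t s) by apply: itg_poisson => //; exact: itgD.
rewrite normrN (le_trans (le_normr_Rintegral _ iD))//.
have H := Hd r; rewrite rd r1 in H; apply: le_trans (H isT).
rewrite le_eqVlt; apply/orP; left; apply/eqP; apply: eq_Rintegral => s _.
by rewrite normrM mulrC [X in X * _]ger0_norm// poisson_ge0.
Unshelve. all: end_near. Qed.

Definition cvgc (T : Type) (FF : set_system T) (G : T -> R[i]) l :=
  ((fun x => complex.Re (G x)) @ FF --> complex.Re l) /\
  ((fun x => complex.Im (G x)) @ FF --> complex.Im l).

Lemma fatou_H2 F : H2 F -> {ae (leb R), forall t, D t ->
  cvgc (1 : R)^'- (fun r => Cau (leb R) F (r%:C * xi t)) (F t)}.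
Proof.
move=> HF; have [i1 i2] := L2_itb (@leb_I01 R) HF.1.
apply: aeS2 (fatou_real i1) (fatou_real i2) => t c1 c2 Dt.
have near01 : \forall r \near (1 : R)^'-, csq (r%:C * xi t) < 1.
  near=> r; have r1 : r < 1 by near: r; exact: nbhs_left_lt.
  have r0 : 0 <= r by rewrite ltW//; near: r; apply: nbhs_left_gt.
  by rewrite csq_rxi expr_lt1.
split; [apply: cvg_trans (c1 Dt)|apply: cvg_trans (c2 Dt)]; apply: near_eq_cvg;
  by near=> r; rewrite Cau_poisson//; near: r.
Unshelve. all: end_near. Qed.

End FatouTheorem.

(** * The intertwining relation *)

Section InnerProducts.
Variable R : realType.
Variable m : {measure set (measurableTypeR R) -> \bar R}.
Implicit Types (f h k : R -> R[i]) (a : R[i]).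

Lemma ip_linr a f h k : L2 m f -> L2 m h -> L2 m k ->
  ip m k (fun t => a * f t + h t) = cj a * ip m k f + ip m k h.
Proof.
move=> f2 h2 k2; have l2 := L2_lin a f2 h2.
by rewrite (ipC l2 k2) ip_linl// cjD cjM -(ipC f2 k2) -(ipC h2 k2).
Qed.

Lemma L2Z a f : L2 m f -> L2 m (fun t => a * f t).
Proof.
move=> f2; apply: (@L2_bddM _ _ _ _ (csq a)) => //; exact: cmeas_cst.
Qed.

Lemma ip_xi f h : ip m (fun t => xi t * f t) (fun t => xi t * h t) = ip m f h.
Proof.
rewrite !ipE; apply: eq_cint => t _; rewrite cjM mulrACA mul_xi_conj mul1r//.
Qed.

Lemma ip_b1 f : ip m f (@b1 R) = cint m (fun t => xi t * f t).
Proof. by rewrite ipE; apply: eq_cint => t _; rewrite /b1 conjcE cjK mulrC. Qed.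

Lemma nrm2Z a f : L2 m f -> nrm2 m (fun t => a * f t) = csq a * nrm2 m f.
Proof.
move=> /L2P[mf f2]; rewrite !nrm2E -RintegralZl//; last exact: measurable_I01.
by apply: eq_Rintegral => t _; rewrite csqM.
Qed.

Lemma nrm2_unimodular (k f : R -> R[i]) : (forall t, csq (k t) = 1) ->
  nrm2 m (fun t => k t * f t) = nrm2 m f.
Proof. by move=> k1; rewrite !nrm2E; apply: eq_Rintegral => t _; rewrite csqM k1 mul1r. Qed.

End InnerProducts.

Lemma aeS3 (R : realType) (m : {measure set (measurableTypeR R) -> \bar R}) (P1 P2 P3 Q : R -> Prop) :
  (forall t, P1 t -> P2 t -> P3 t -> Q t) ->
  {ae m, forall t, P1 t} -> {ae m, forall t, P2 t} -> {ae m, forall t, P3 t} -> {ae m, forall t, Q t}.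
Proof.
move=> PQ h1 h2 h3; have h12 : {ae m, forall t, P1 t /\ P2 t} by exact: aeS2 h1 h2.
by apply: aeS2 h12 h3 => t [? ?]; exact: PQ.
Qed.

Section IP2.
Variable R : realType.
Implicit Types (F G H : (R -> R[i]) * (R -> R[i])) (a : R[i]).
Definition L2p F := L2 (leb R) F.1 /\ L2 (leb R) F.2.

Definition plin a F G : (R -> R[i]) * (R -> R[i]) :=
  (fun t => a * F.1 t + G.1 t, fun t => a * F.2 t + G.2 t).
Definition pxi F : (R -> R[i]) * (R -> R[i]) := (fun t => xi t * F.1 t, fun t => xi t * F.2 t).

Lemma L2p_lin a F G : L2p F -> L2p G -> L2p (plin a F G).
Proof. by move=> [? ?] [? ?]; split; exact: L2_lin. Qed.

Lemma L2p_xi F : L2p F -> L2p (pxi F).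
Proof. by move=> [? ?]; split; exact: L2_xi. Qed.

Lemma ip2_linl a F G H : L2p F -> L2p G -> L2p H ->
  ip2 (plin a F G) H = a * ip2 F H + ip2 G H.
Proof. by move=> [? ?] [? ?] [? ?]; rewrite /ip2 !ip_linl//; ring. Qed.

Lemma ip2_linr a F G H : L2p F -> L2p G -> L2p H ->
  ip2 H (plin a F G) = cj a * ip2 H F + ip2 H G.
Proof. by move=> [? ?] [? ?] [? ?]; rewrite /ip2 !ip_linr//; ring. Qed.

Lemma ip2C F G : L2p F -> L2p G -> ip2 G F = cj (ip2 F G).
Proof. by move=> [? ?] [? ?]; rewrite /ip2 cjD -!ipC. Qed.

Lemma ip2_xi F G : ip2 (pxi F) (pxi G) = ip2 F G.
Proof. by rewrite /ip2 !ip_xi. Qed.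

Lemma ip2_nrm2 F : ip2 F F = (nrm2 (leb R) F.1 + nrm2 (leb R) F.2)%:C.
Proof. by rewrite /ip2 !ip_nrm2 rmorphD. Qed.

Lemma ip2_eq0 F : L2p F -> ip2 F F = 0 ->
  {ae (leb R), forall t, I01 t -> F.1 t = 0 /\ F.2 t = 0}.
Proof.
move=> [F1 F2]; rewrite ip2_nrm2 => /complexI/eqP.
rewrite paddr_eq0 ?nrm2_ge0// => /andP[/eqP n1 /eqP n2].
by apply: aeS2 (nrm2_eq0 F1 n1) (nrm2_eq0 F2 n2) => t h1 h2 Dt; rewrite h1// h2.
Qed.

End IP2.

Section Intertwining.
Variables (R : realType) (mu : {measure set (measurableTypeR R) -> \bar R}).
Hypothesis mu1 : mu (@I01 R) = 1%E.
Variables (g : R[i]) (Phi : (R -> R[i]) -> (R -> R[i]) * (R -> R[i])).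
Hypotheses (g1 : csq g < 1) (HPhi : is_Phi mu g Phi).
Implicit Types (f h k : R -> R[i]) (a l : R[i]).
Local Notation D := (@I01 R).
Local Notation tau := (thetab mu g).
Local Notation Del := (Delta mu g).
Hint Resolve measurable_I01 leb_I01 : core.

Definition sg : R := Num.sqrt (1 - csq g).

Lemma sg2 : sg ^+ 2 = 1 - csq g.
Proof. by rewrite sqr_sqrtr// subr_ge0 ltW. Qed.

Lemma sg_gt0 : 0 < sg. Proof. by rewrite sqrtr_gt0 subr_gt0. Qed.

Let mu_le1 : (mu D <= 1)%E. Proof. by rewrite mu1. Qed.
Hint Resolve mu_le1 : core.

Lemma cint_mu_cst a : cint mu (fun=> a) = a.
Proof. by rewrite cintE !Rintegral_cst// mu1 !mulr1; case: a. Qed.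

(** [R2 mu 0] is the total mass 1. Consequently the normalising factor of [cg] and [c1g] is the
    inverse of [sg]. *)
Lemma theta0 : theta mu g 0 = - g.
Proof.
have -> : theta mu g 0 = ((1 - g) * 1 - (1 + g)) / ((1 - cj g) * 1 + (1 + cj g)).
  rewrite /theta !conjCE; suff -> : R2 mu 0 = 1 by [].
  rewrite -[RHS](cint_mu_cst 1); apply: eq_cint => t _.
  by rewrite mulr0 addr0 subr0 divr1.
have -> : (1 - g) * 1 - (1 + g) = - g * 2 by ring.
have -> : (1 - cj g) * 1 + (1 + cj g) = 2 by ring.
by rewrite mulfK// pnatr_eq0.
Qed.

Let Plin a f h : L2 mu f -> L2 mu h ->
  ae2 (Phi (fun t => a * f t + h t)) (plin a (Phi f) (Phi h)).
Proof. by case: HPhi => H _; exact: H. Qed.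

Let PK f : L2 mu f -> Kth tau Del (Phi f).
Proof. by case: HPhi => _ [H _]; exact: H. Qed.

Let Piso f h : L2 mu f -> L2 mu h -> ip2 (Phi f) (Phi h) = ip mu f h.
Proof. by case: HPhi => _ [_ [H _]]; exact: H. Qed.

Lemma Phi_H2 f : L2 mu f -> H2 (Phi f).1.
Proof. by move=> /PK[]. Qed.

Lemma Phi_L2p f : L2 mu f -> L2p (Phi f).
Proof. by move=> /PK[[? _] [[? _] _]]. Qed.

Lemma Phi_nrm2 f : L2 mu f ->
  nrm2 (leb R) (Phi f).1 + nrm2 (leb R) (Phi f).2 = nrm2 mu f.
Proof.
by move=> f2; apply: complexI; rewrite -ip2_nrm2 Piso// ip_nrm2.
Qed.

Lemma L2_bb : L2 mu (@bb R).
Proof. by apply: (@L2_bdd _ _ _ _ (csq 1)) => //; exact: cmeas_cst. Qed.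

Lemma b1E : @b1 R = (fun t => cj (xi t)).
Proof. by apply/funext => t; rewrite /b1 conjcE. Qed.

Lemma L2_b1 : L2 mu (@b1 R).
Proof.
rewrite b1E; apply: (@L2_bdd _ _ _ _ 1) => [//||t _]; first exact/cmeasJ/cmeas_xi.
by rewrite csqJ csq_xi.
Qed.

Lemma xi_b1 : (fun t => xi t * @b1 R t) = @bb R.
Proof. by apply/funext => t; rewrite b1E mul_xi_conj. Qed.

(* On the orthogonal complement of [b1] the perturbation is invisible, and
   [|xi Phi f - Phi (xi f)|^2] expands to [0] by isometry and intertwining. *)
Lemma Phi_xi_orth f : L2 mu f -> ip mu f (@b1 R) = 0 ->
  ae2 (Phi (fun t => xi t * f t)) (pxi (Phi f)).
Proof.
move=> f2 f0; have xf2 := L2_xi f2.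
have UE : Ug mu g f = (fun t => xi t * f t).
  by apply/funext => t; rewrite /Ug f0 mulr0 mul0r addr0.
set F := Phi f; set G := Phi _.
have F2 := Phi_L2p f2 : L2p F; have G2 := Phi_L2p xf2 : L2p G; have xF2 := L2p_xi F2.
set X := plin (-1) G (pxi F); have X2 : L2p X by exact: L2p_lin.
have XG : ip2 X G = 0.
  case: HPhi => _ [_ [_ [_ [/(_ f f2 G (PK xf2)) H _]]]]; rewrite UE in H.
  suff -> : X = (fun t => xi t * F.1 t - G.1 t, fun t => xi t * F.2 t - G.2 t) by exact: H.
  rewrite /X /plin /pxi; congr pair; apply/funext => t.
    by change (-1 * G.1 t + xi t * F.1 t = xi t * F.1 t - G.1 t); ring.
  by change (-1 * G.2 t + xi t * F.2 t = xi t * F.2 t - G.2 t); ring.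
have GG : ip2 G G = ip mu f f by rewrite Piso// ip_xi.
have xFG : ip2 (pxi F) G = ip mu f f.
  by move: XG; rewrite /X ip2_linl// mulN1r => /eqP; rewrite addrC subr_eq0 => /eqP->.
have XX : ip2 X X = 0.
  rewrite {2}/X ip2_linr// XG mulr0 add0r /X ip2_linl// ip2_xi Piso//.
  rewrite (ip2C xF2 G2) xFG ip_nrm2 cjC mulN1r addNr//.
apply: aeS (ip2_eq0 X2 XX) => t h Dt; have [e1 e2] := h Dt.
split; apply/eqP; rewrite -subr_eq0 -oppr_eq0; apply/eqP.
  by rewrite -[RHS]e1; change (- (G.1 t - xi t * F.1 t) = -1 * G.1 t + xi t * F.1 t); ring.
by rewrite -[RHS]e2; change (- (G.2 t - xi t * F.2 t) = -1 * G.2 t + xi t * F.2 t); ring.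
Qed.

Definition sPhi1 f t : R[i] := sg%:C * (Phi f).1 t.
Definition sPhi2 f t : R[i] := sg%:C * (Phi f).2 t.
Definition defect1 t : R[i] := sPhi1 (@bb R) t - xi t * sPhi1 (@b1 R) t.
Definition defect2 t : R[i] := sPhi2 (@bb R) t - xi t * sPhi2 (@b1 R) t.

(** [b1] is a unit vector with [xi * b1 = b]. Subtracting the projection onto [b1] leaves a function
    covered by [Phi_xi_orth]; the projection contributes [(f, b1)] times the defect pair. *)
Lemma Phi_xi f : L2 mu f -> {ae (leb R), forall t, D t ->
  sPhi1 (fun t => xi t * f t) t = xi t * sPhi1 f t + cint mu (fun t => xi t * f t) * defect1 t /\
  sPhi2 (fun t => xi t * f t) t = xi t * sPhi2 f t + cint mu (fun t => xi t * f t) * defect2 t}.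
Proof.
move=> f2; rewrite -ip_b1; set al := ip mu f _.
have b2 := L2_b1; have bb2 := L2_bb; have xf2 := L2_xi f2.
set f0 := fun t => (- al) * @b1 R t + f t.
have f02 : L2 mu f0 by exact: L2_lin.
have b11 : ip mu (@b1 R) (@b1 R) = 1.
  by rewrite ip_b1 xi_b1 (cint_mu_cst 1).
have orth : ip mu f0 (@b1 R) = 0 by rewrite ip_linl// b11 mulr1 addNr.
have xf0 : (fun t => xi t * f0 t) = (fun t => (- al) * @bb R t + xi t * f t).
  apply/funext => t; rewrite -xi_b1 /f0; ring.
have h1 := Phi_xi_orth f02 orth; rewrite xf0 in h1.
have h2 := Plin (- al) b2 f2; have h3 := Plin (- al) bb2 xf2.
apply: aeS3 h1 h2 h3 => t h1 h2 h3 Dt.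
have [a1 a2] := h1 Dt; have [c1 c2] := h2 Dt; have [d1 d2] := h3 Dt.
rewrite /= in a1 a2 c1 c2 d1 d2; rewrite d1 c1 in a1; rewrite d2 c2 in a2.
rewrite /sPhi1 /sPhi2 /defect1 /defect2 /sPhi1 /sPhi2; split.
  have -> : (Phi (fun t => xi t * f t)).1 t =
      xi t * (- al * (Phi (@b1 R)).1 t + (Phi f).1 t) + al * (Phi (@bb R)).1 t.
    by rewrite -a1; ring.
  by ring.
have -> : (Phi (fun t => xi t * f t)).2 t =
    xi t * (- al * (Phi (@b1 R)).2 t + (Phi f).2 t) + al * (Phi (@bb R)).2 t.
  by rewrite -a2; ring.
by ring.
Qed.

End Intertwining.

(** * The representation formula inside the disc *)

Section H2facts.
Variable R : realType.
Implicit Types (F G : R -> R[i]) (a l : R[i]).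
Hint Resolve measurable_I01 leb_I01 : core.
Local Notation D := (@I01 R).

Lemma L2_xiX (m : {measure set (measurableTypeR R) -> \bar R}) F k :
  L2 m F -> L2 m (fun t => F t * xi t ^+ k).
Proof.
move=> F2; rewrite (_ : (fun t => _) = (fun t => xi t ^+ k * F t)); last first.
  by apply/funext => t; rewrite mulrC.
apply: (@L2_bddM _ _ _ _ 1) => //; first exact/cmeasX/cmeas_xi.
by move=> t _; rewrite csqX csq_xi expr1n.
Qed.

Lemma H2_lin a F G : H2 F -> H2 G -> H2 (fun t => a * F t + G t).
Proof.
move=> [F2 Fk] [G2 Gk]; split; first exact: L2_lin.
move=> k k0; rewrite -[RHS](addr0 0) -{1}(mulr0 a) -{1}(Fk k k0) -(Gk k k0).
rewrite -cint_lin; [|by apply: L2_itb => //; exact: L2_xiX..].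
by apply: eq_cint => t _; ring.
Qed.

Lemma H2_0 : H2 (fun=> 0 : R[i]).
Proof.
have -> : (fun=> 0 : R[i]) = (fun t : R => (-1) * 1 + 1) by apply/funext => t; ring.
by apply: H2_lin; exact: H2_1.
Qed.

Lemma H2Z a F : H2 F -> H2 (fun t => a * F t).
Proof.
move=> HF; have := H2_lin a HF H2_0; congr H2.
by apply/funext => t; rewrite addr0.
Qed.

Lemma H2_cst a : H2 (fun=> a).
Proof.
have := H2Z a (H2_1 R); congr H2; by apply/funext => t; rewrite mulr1.
Qed.

Lemma H2_xi F : H2 F -> H2 (fun t => xi t * F t).
Proof.
move=> [F2 Fk]; split; first exact: L2_xi.
move=> k k0; rewrite -[RHS](Fk k.+1)//; apply: eq_cint => t _.
by rewrite exprS; ring.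
Qed.

Lemma cint_Cau0 (m : {measure set (measurableTypeR R) -> \bar R}) F : Cau m F 0 = cint m F.
Proof. by apply: eq_cint => t _; rewrite mulr0 subr0 divr1. Qed.

Lemma csq0 : csq (0 : R[i]) = 0.
Proof. by apply/eqP; rewrite csq_eq0. Qed.

End H2facts.

(** * The defect function in the disc and the factorisation of [Cau (sPhi1 f)] *)

Section DiscFormula.
Variables (R : realType) (mu : {measure set (measurableTypeR R) -> \bar R}).
Hypothesis mu1 : mu (@I01 R) = 1%E.
Variables (g : R[i]) (Phi : (R -> R[i]) -> (R -> R[i]) * (R -> R[i])).
Hypotheses (g1 : csq g < 1) (HPhi : is_Phi mu g Phi).
Implicit Types (f h k : R -> R[i]) (a l : R[i]).
Local Notation D := (@I01 R).
Local Notation tau := (thetab mu g).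
Local Notation Del := (Delta mu g).
Local Notation s := (sg g).
Local Notation q1 := (sPhi1 g Phi).
Local Notation q2 := (sPhi2 g Phi).
Local Notation v := (defect1 g Phi).
Local Notation w := (defect2 g Phi).
Hint Resolve measurable_I01 leb_I01 : core.
Let mu_le1 : (mu D <= 1)%E. Proof. by rewrite mu1. Qed.
Hint Resolve mu_le1 : core.

Lemma sg2C : (s ^+ 2)%:C = 1 - g * cj g.
Proof. by rewrite sg2// mul_conj rmorphB. Qed.

(** By [theta0], the prescribed vectors give [tau + g] for [xi * q1 b1] and [Del] for
    [xi * q2 b1]. *)
Lemma defect_formulas : {ae (leb R), forall t, D t ->
  [/\ q1 (@bb R) t = 1 + cj g * tau t, q2 (@bb R) t = cj g * Del t,
      v t = (1 - g) - (1 - cj g) * tau t & w t = (cj g - 1) * Del t]}.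
Proof.
case: HPhi => _ [_ [_ [_ [_ [h1 h2]]]]].
have s0 : s%:C != 0 :> R[i] by rewrite fmorph_eq0 gt_eqF// sg_gt0.
apply: aeS2 h1 h2 => t h1 h2 Dt.
have [] := h1 Dt; have [] := h2 Dt.
cbv beta iota zeta delta [cg c1g fst snd].
rewrite theta0// Re_sqr_norm csqN -/(sg g) !conjCE cjN !opprK.
rewrite fmorphV /= => c1 c2 d1 d2.
rewrite /defect1 /defect2 /sPhi1 /sPhi2 /fst /snd c1 c2 d1 d2.
have x0 := xi_neq0 t.
by split; field; rewrite ?s0 ?x0.
Qed.

Lemma H2_sPhi1 f : L2 mu f -> H2 (q1 f).
Proof. by move=> f2; apply: H2Z; exact: (Phi_H2 HPhi f2). Qed.

Lemma H2_defect1 : H2 v.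
Proof.
have -> : v = (fun t => (-1) * (xi t * q1 (@b1 R) t) + q1 (@bb R) t).
  by apply/funext => t; rewrite /defect1 mulN1r addrC.
apply: H2_lin; last exact/H2_sPhi1/L2_bb.
by apply: H2_xi; apply: H2_sPhi1; exact: L2_b1.
Qed.

Lemma nrm2_sPhi1_le f : L2 mu f -> nrm2 (leb R) (q1 f) <= nrm2 mu f.
Proof.
move=> f2; rewrite /sPhi1 nrm2Z; last by have [] := Phi_L2p HPhi f2.
rewrite csqC sg2// -(Phi_nrm2 HPhi f2).
have := nrm2_ge0 (leb R) (Phi f).1; have := nrm2_ge0 (leb R) (Phi f).2.
have := csq_ge0 g; nra.
Qed.

(* The difference of the two sides is multiplied by [l] when [f] is replaced by [xi f], and it
   is bounded along the functions [xi^-n f]. *)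
Lemma Cau_sPhi1 f l : L2 mu f -> csq l < 1 ->
  Cau (leb R) (q1 f) l = Cau (leb R) v l * Cau mu f l.
Proof.
move=> f2 l1; apply/eqP; rewrite -subr_eq0; apply/eqP.
pose fn n t := cj (xi t) ^+ n * f t.
have fn2 n : L2 mu (fn n).
  apply: (@L2_bddM _ _ _ _ 1) => //; first exact/cmeasX/cmeasJ/cmeas_xi.
  by move=> t _; rewrite csqX csqJ csq_xi expr1n.
have fnS n : fn n = (fun t => xi t * fn n.+1 t).
  by apply/funext => t; rewrite /fn exprS !mulrA mul_xi_conj mul1r.
pose d n := Cau (leb R) (q1 (fn n)) l - Cau (leb R) v l * Cau mu (fn n) l.
have -> : Cau (leb R) (q1 f) l - Cau (leb R) v l * Cau mu f l = d 0%N.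
  by rewrite /d; have -> : fn 0%N = f by apply/funext => t; rewrite /fn expr0 mul1r.
have Hv := H2_defect1; have [v2 _] := Hv.
pose K := ker_bound l * nrm2 mu f.
apply: (@geometric_eq0 _ d l (2 * K + 2 * (csq (Cau (leb R) v l) * K))) => //.
- move=> n; rewrite /d [in LHS]fnS.
  have F2 := fn2 n.+1; have [P2 Pk] := H2_sPhi1 F2; have [Q2 _] := H2_sPhi1 (L2_xi F2).
  set al := cint mu (fun t => xi t * fn n.+1 t).
  have E : Cau (leb R) (q1 (fun t => xi t * fn n.+1 t)) l =
           Cau (leb R) (fun t => al * v t + xi t * q1 (fn n.+1) t) l.
    apply: ae_eq_Cau => //; first by apply: L2_lin => //; exact: L2_xi.
    by apply: aeS (Phi_xi mu1 HPhi F2) => t /[apply] -[-> _]; rewrite addrC.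
  (* An [H2] function has no coefficient at [xi^-1], so the constant term of [Cau_xi] disappears on
     the Lebesgue side. On the [mu] side it equals [al], which cancels against [al * v]. *)
  have z : cint (leb R) (fun t => xi t * q1 (fn n.+1) t) = 0.
    by rewrite -(Pk 1%N isT); apply: eq_cint => t _; rewrite expr1 mulrC.
  rewrite E Cau_lin//; last exact: L2_xi.
  by rewrite !Cau_xi// z -/al; ring.
- move=> n; rewrite /d; apply: (le_trans (csqD_le _ _)); rewrite csqN csqM.
  have kl := ker_bound_ge0 l.
  have n2 : nrm2 mu (fn n) = nrm2 mu f.
    by apply: nrm2_unimodular => t; rewrite csqX csqJ csq_xi expr1n.
  apply: lerD; rewrite ler_pM2l// /K.
    have [P2 _] := H2_sPhi1 (fn2 n).
    by rewrite (le_trans (csq_Cau_le _ _ _))// ler_wpM2l// -n2 nrm2_sPhi1_le.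
  by rewrite ler_wpM2l ?csq_ge0// -n2 csq_Cau_le.
Qed.

Lemma one_sub_g_neq0 : 1 - g != 0.
Proof.
apply/eqP => /eqP; rewrite subr_eq0 => /eqP E; have := g1; rewrite -E csq1 ltxx //.
Qed.

(** Eliminating [tau] from [defect_formulas] leaves a constant:
    [cj g * v + (1 - cj g) * q1 b = 1 - |g|^2]. Taking Cauchy integrals and using [Cau_sPhi1] for
    [b] gives the product. *)
Lemma Cau_defect1_mul l : csq l < 1 ->
  Cau (leb R) v l * (cj g + (1 - cj g) * Cau mu (@bb R) l) = (s ^+ 2)%:C.
Proof.
move=> l1; have [v2 _] := H2_defect1; have b2 := L2_bb mu1; have [P2 _] := H2_sPhi1 b2.
transitivity (cj g * Cau (leb R) v l + Cau (leb R) (fun t => (1 - cj g) * q1 (@bb R) t) l).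
  have Z2 := L2Z (1 - cj g) P2; have L0 : L2 (leb R) (fun=> 0 : R[i]) := (@H2_0 R).1.
  have E : (fun t => (1 - cj g) * q1 (@bb R) t) = (fun t => (1 - cj g) * q1 (@bb R) t + 0).
    by apply/funext => t; rewrite addr0.
  rewrite E (Cau_lin (@leb_I01 R) (1 - cj g) l1 P2 L0).
  by rewrite Cau_cst// Cau_sPhi1//; ring.
rewrite -Cau_lin//; last exact: L2Z.
rewrite -[RHS](Cau_cst (s ^+ 2)%:C l1); apply: ae_eq_Cau => //.
- by apply: L2_lin => //; exact: L2Z.
- exact: (H2_cst (s ^+ 2)%:C).1.
apply: aeS defect_formulas => t /[apply] -[-> _ -> _].
by rewrite sg2C; ring.
Qed.

Lemma Cau_defect1_neq0 l : csq l < 1 -> Cau (leb R) v l != 0.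
Proof.
move=> l1; apply/eqP => V0; have := Cau_defect1_mul l1; rewrite V0 mul0r => /esym/eqP.
by rewrite fmorph_eq0 sqrf_eq0 gt_eqF// sg_gt0.
Qed.

(** The map [1 / (1 - z)] sends the unit disc into the half-plane [Re > 1/2], and [mu] has mass
    one. *)
Lemma Re_Cau_bb_ge l : csq l < 1 -> 1 / 2 <= complex.Re (Cau mu (@bb R) l).
Proof.
move=> l1; rewrite Re_cint.
have [k1 _] := L2_itb mu_le1 (L2_ker l1 (L2_bb mu1)).
have -> : 1 / 2 = \int[mu]_(t in D) (1 / 2 : R) by rewrite Rintegral_cst// mu1 mulr1.
apply: le_Rintegral => //; first exact: itg_cst.
move=> t _; have -> : bb t / (1 - (xi t)^* * l) = (1 - cj (xi t) * l)^-1.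
  by rewrite /bb mul1r conjCE.
rewrite ReV.
have h : csq (cj (xi t) * l) < 1 by rewrite csqM csqJ csq_xi mul1r.
have n0 : 0 < csq (1 - cj (xi t) * l) by rewrite csq_gt0// ker_den_neq0.
rewrite ler_pdivlMr//; move: h.
case: (cj _ * l) => a b; rewrite /csq /= => h; nra.
Qed.

(** With [T] the Cauchy integral of 1 and [W = cj g + (1 - cj g) T], the difference
    [|W|^2 - |(1 - g) T - 1|^2] equals [(1 - |g|^2)(2 Re T - 1)], nonnegative by [Re_Cau_bb_ge].
    This is [|q| <= 1] for [q = 1 - V / (1 - g)]. *)
Lemma csq_defect1_le l : csq l < 1 -> csq ((1 - g) - Cau (leb R) v l) <= csq (1 - g).
Proof.
move=> l1; have VW := Cau_defect1_mul l1; have T2 := Re_Cau_bb_ge l1.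
move: VW T2; set V := Cau (leb R) v l; set T := Cau mu _ l; set W := cj g + _ => VW T2.
have W0 : 0 < csq W.
  apply: csq_gt0; apply/eqP => W0; move: VW; rewrite W0 mulr0 => /esym/eqP.
  by rewrite fmorph_eq0 sqrf_eq0 gt_eqF// sg_gt0.
have E : (1 - g - V) * W = (1 - cj g) * ((1 - g) * T - 1).
  by rewrite mulrBl VW sg2C /W; ring.
have cE : csq (1 - g - V) * csq W = csq (1 - g) * csq ((1 - g) * T - 1).
  by rewrite -csqM E csqM; congr (_ * _); rewrite -csqJ cjB cj1 cjK.
rewrite -(ler_pM2r W0) cE ler_wpM2l ?csq_ge0//.
move: T2 g1; rewrite /W; case: (g) (T) => [a b] [c d]; rewrite /csq /cj /= => T2 gg.
nra.
Qed.

End DiscFormula.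

(** * Boundary values and the first component *)

Section Radial.
Variable R : realType.
Implicit Types (F G : R -> R[i]) (a l z : R[i]).
Hint Resolve measurable_I01 leb_I01 : core.
Local Notation D := (@I01 R).

Lemma normr_lt_csq z (e : R) : 0 < e -> csq z < e ^+ 2 ->
  `|complex.Re z| < e /\ `|complex.Im z| < e.
Proof.
move=> e0; case: z => a b; rewrite /csq /= => h.
have a0 := sqr_ge0 a; have b0 := sqr_ge0 b; split.
  by rewrite -(@ltr_pXn2r _ 2)// ?nnegrE ?(ltW e0)// real_normK ?num_real//; lra.
by rewrite -(@ltr_pXn2r _ 2)// ?nnegrE ?(ltW e0)// real_normK ?num_real//; lra.
Qed.

Lemma csq_cvg (T : Type) (FF : set_system T) {HF : Filter FF} (zn : T -> R[i]) z :
  (fun n => csq (z - zn n)) @ FF --> (0 : R) ->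
  (fun n => complex.Re (zn n)) @ FF --> complex.Re z /\
  (fun n => complex.Im (zn n)) @ FF --> complex.Im z.
Proof.
move=> /cvgrPdist_lt H; split; apply/cvgrPdist_lt => e e0.
  have := H (e ^+ 2); rewrite exprn_gt0// => /(_ isT); apply: filterS => n.
  rewrite sub0r normrN ger0_norm ?csq_ge0// => /(normr_lt_csq e0)[+ _].
  by case: z (zn n) {H} => [a b] [c d].
have := H (e ^+ 2); rewrite exprn_gt0// => /(_ isT); apply: filterS => n.
rewrite sub0r normrN ger0_norm ?csq_ge0// => /(normr_lt_csq e0)[_].
by case: z (zn n) {H} => [a b] [c d].
Qed.

(** [Cau_xi] iterated on the functions [xi^-n G]: a Taylor expansion whose remainder is again a
    Cauchy integral. *)
Lemma Cau_expand G l N : csq l < 1 -> L2 (leb R) G ->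
  Cau (leb R) G l = \sum_(j < N) l ^+ j * cint (leb R) (fun t => cj (xi t) ^+ j * G t)
    + l ^+ N * Cau (leb R) (fun t => cj (xi t) ^+ N * G t) l.
Proof.
move=> l1 G2; elim: N => [|N ->].
  have -> : (fun t => cj (xi t) ^+ 0 * G t) = G by apply/funext => t; rewrite expr0 mul1r.
  by rewrite big_ord0 add0r expr0 mul1r.
have F2 n : L2 (leb R) (fun t => cj (xi t) ^+ n * G t).
  apply: (@L2_bddM _ _ _ _ 1) => //; first exact/cmeasX/cmeasJ/cmeas_xi.
  by move=> t _; rewrite csqX csqJ csq_xi expr1n.
have E : (fun t => cj (xi t) ^+ N * G t) = (fun t => xi t * (cj (xi t) ^+ N.+1 * G t)).
  by apply/funext => t; rewrite exprS !mulrA mul_xi_conj mul1r.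
rewrite big_ord_recr /= -addrA; congr (_ + _).
rewrite {1}E Cau_xi// -E mulrDr addrC; congr (_ + _).
by rewrite mulrA -exprSr.
Qed.

(** A pointwise limit of trigonometric polynomials: by [Cau_expand] the squared error is at most
    [r^(2 N)] times a bound free of [N], since [xi^-N G] has the norm of [G]. *)
Lemma cmeas_Cau_radial G r : 0 <= r < 1 -> L2 (leb R) G ->
  cmeas (fun t => Cau (leb R) G (r%:C * xi t)).
Proof.
move=> /andP[r0 r1] G2.
have l1 t : csq (r%:C * xi t) < 1 by rewrite csq_rxi expr_lt1.
pose S N t := \sum_(j < N) (r%:C * xi t) ^+ j * cint (leb R) (fun t => cj (xi t) ^+ j * G t).
have mS N : cmeas (S N).
  elim: N => [|N IH]; rewrite /S.
    by under eq_fun do rewrite big_ord0; exact: cmeas_cst.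
  under eq_fun do rewrite big_ord_recr /=.
  apply: cmeasD => //; apply: cmeasM; last exact: cmeas_cst.
  by apply: cmeasX; apply: cmeasM; [exact: cmeas_cst|exact: cmeas_xi].
have cS t : (fun N => csq (Cau (leb R) G (r%:C * xi t) - S N t)) @ \oo --> (0 : R).
  pose K := ker_bound (r%:C * xi t) * nrm2 (leb R) G.
  have bd N : 0 <= csq (Cau (leb R) G (r%:C * xi t) - S N t) <= (r ^+ 2) ^+ N * K.
    rewrite csq_ge0 /= (Cau_expand N (l1 t) G2) /S addrC addKr csqM csqX csq_rxi.
    rewrite ler_wpM2l ?exprn_ge0 ?sqr_ge0//.
    have F2 : L2 (leb R) (fun t => cj (xi t) ^+ N * G t).
      apply: (@L2_bddM _ _ _ _ 1) => //; first exact/cmeasX/cmeasJ/cmeas_xi.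
      by move=> x _; rewrite csqX csqJ csq_xi expr1n.
    rewrite (le_trans (csq_Cau_le _ _ F2))// ler_wpM2l ?ker_bound_ge0// nrm2_unimodular// => x.
    by rewrite csqX csqJ csq_xi expr1n.
  apply: (@squeeze_cvgr _ _ _ _ (fun=> 0) (fun N => (r ^+ 2) ^+ N * K)).
  - by near=> N; exact: bd.
  - exact: cvg_cst.
  - rewrite -[X in _ --> X](mul0r K); apply: cvgMr_tmp; apply: cvg_expr.
    by rewrite ger0_norm ?sqr_ge0// expr_lt1.
split.
  apply: (@measurable_fun_cvg _ _ _ _ (fun N t => complex.Re (S N t))) => [N|t _].
    by have [] := mS N.
  by have [] := csq_cvg (cS t).
apply: (@measurable_fun_cvg _ _ _ _ (fun N t => complex.Im (S N t))) => [N|t _].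
  by have [] := mS N.
by have [] := csq_cvg (cS t).
Unshelve. all: end_near. Qed.

Lemma csq_Cau_radial G r t : 0 <= r < 1 -> L2 (leb R) G ->
  csq (Cau (leb R) G (r%:C * xi t)) <= ker_bound r%:C * nrm2 (leb R) G.
Proof.
move=> /andP[r0 r1] G2; have -> : ker_bound r%:C = ker_bound (r%:C * xi t) by rewrite /ker_bound csq_rxi csqC.
by apply: csq_Cau_le => //; rewrite csq_rxi expr_lt1.
Qed.

(** Let [X n k] integrate [Cau (xi^-n G) (r xi) F xi^k]. [Cau_xi] yields [X n k = r X (n+1) (k+1)]
    plus a multiple of a coefficient of [F] that vanishes for [k > 0]. Hence [X n k = 0] for [k > 0]
    by [geometric_eq0], and [X 0 0] reduces to the product of the means. *)
Lemma H2_mul_Cau F G r : 0 <= r < 1 -> H2 F -> L2 (leb R) G ->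
  H2 (fun t => Cau (leb R) G (r%:C * xi t) * F t) /\
  cint (leb R) (fun t => Cau (leb R) G (r%:C * xi t) * F t) = cint (leb R) G * cint (leb R) F.
Proof.
move=> r01 [F2 Fk] G2; have /andP[r0 r1] := r01.
have l1 t : csq (r%:C * xi t) < 1 by rewrite csq_rxi expr_lt1.
have rl : csq r%:C < 1 by rewrite csqC expr_lt1.
pose Gn n t := cj (xi t) ^+ n * G t.
have Gn2 n : L2 (leb R) (Gn n).
  apply: (@L2_bddM _ _ _ _ 1) => //; first exact/cmeasX/cmeasJ/cmeas_xi.
  by move=> t _; rewrite csqX csqJ csq_xi expr1n.
have Gnn n : nrm2 (leb R) (Gn n) = nrm2 (leb R) G.
  by apply: nrm2_unimodular => t; rewrite csqX csqJ csq_xi expr1n.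
have GnS n : Gn n = (fun t => xi t * Gn n.+1 t).
  by apply/funext => t; rewrite /Gn exprS !mulrA mul_xi_conj mul1r.
pose K := ker_bound r%:C * nrm2 (leb R) G.
have L2X n k : L2 (leb R) (fun t => Cau (leb R) (Gn n) (r%:C * xi t) * (F t * xi t ^+ k)).
  apply: (@L2_bddM _ _ _ _ K) => //; first exact: cmeas_Cau_radial.
    by move=> t _; rewrite /K -(Gnn n) csq_Cau_radial.
  exact: L2_xiX.
pose X n k := cint (leb R) (fun t => Cau (leb R) (Gn n) (r%:C * xi t) * (F t * xi t ^+ k)).
have XS n k : X n k = r%:C * X n.+1 k.+1 + cint (leb R) (Gn n) * cint (leb R) (fun t => F t * xi t ^+ k).
  have i1 : itb (leb R) (fun t => cint (leb R) (Gn n) * (F t * xi t ^+ k)).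
    by apply: L2_itb => //; apply: L2Z; exact: L2_xiX.
  have i2 : itb (leb R) (fun t => F t * xi t ^+ k) by apply: L2_itb => //; exact: L2_xiX.
  transitivity (r%:C * X n.+1 k.+1 + cint (leb R) (fun t => cint (leb R) (Gn n) * (F t * xi t ^+ k))).
    rewrite /X -cint_lin//; last exact: L2_itb.
    apply: eq_cint => t _; rewrite [in LHS]GnS Cau_xi// -GnS exprSr; ring.
  congr (_ + _).
  have i0 : itb (leb R) (fun=> 0 : R[i]) by apply: L2_itb => //; exact: (@H2_0 R).1.
  have := cint_lin (cint (leb R) (Gn n)) i2 i0.
  have -> : cint (leb R) (fun=> 0 : R[i]) = 0 by rewrite cintE !Rintegral_cst// mul0r.
  by rewrite addr0 => <-; apply: eq_cint => t _; rewrite addr0.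
have X0 n k : (0 < k)%N -> X n k = 0.
  move=> k0; pose d j := X (n + j)%N (k + j)%N.
  have -> : X n k = d 0%N by rewrite /d !addn0.
  apply: (@geometric_eq0 _ d r%:C (K * nrm2 (leb R) F)) => //.
    by move=> j; rewrite /d XS Fk ?mulr0 ?addr0 ?addnS// (leq_trans k0)// leq_addr.
  move=> j; rewrite (le_trans (csq_cint_le _ (L2X _ _)))//.
  apply: nrm2_le => //.
  - by rewrite mulr_ge0 ?ker_bound_ge0 ?nrm2_ge0.
  - by have /L2P[] := L2X (n + j)%N (k + j)%N.
  - move=> t _; rewrite !csqM csqX csq_xi expr1n mulr1 ler_wpM2r ?csq_ge0//.
    by rewrite /K -(Gnn (n + j)%N) csq_Cau_radial.
have G0 : Gn 0%N = G by apply/funext => t; rewrite /Gn expr0 mul1r.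
split; first split.
- by have := L2X 0%N 0%N; rewrite G0; congr L2; apply/funext => t; rewrite expr0 mulr1.
- move=> k k0; rewrite -(X0 0%N k k0) /X G0; apply: eq_cint => t _; exact: esym (mulrA _ _ _).
- have := XS 0%N 0%N; rewrite (X0 1%N 1%N isT) mulr0 add0r /X G0 => E.
  transitivity (cint (leb R) (fun t => Cau (leb R) G (r%:C * xi t) * (F t * xi t ^+ 0))).
    by apply: eq_cint => t _; rewrite expr0 mulr1.
  by rewrite E; congr (_ * _); apply: eq_cint => t _; rewrite expr0 mulr1.
Qed.

Lemma cint_Cau_pow G r n : 0 <= r < 1 -> L2 (leb R) G ->
  H2 (fun t => Cau (leb R) G (r%:C * xi t) ^+ n) /\
  cint (leb R) (fun t => Cau (leb R) G (r%:C * xi t) ^+ n) = cint (leb R) G ^+ n.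
Proof.
move=> r01 G2; elim: n => [|n [IH1 IH2]].
  have E : (fun t => Cau (leb R) G (r%:C * xi t) ^+ 0) = (fun=> 1) by apply/funext => t; rewrite expr0.
  split; rewrite E; first exact: H2_1.
  by rewrite expr0 cintE !Rintegral_cst// fine_leb_I01 !mulr1.
have [h1 h2] := H2_mul_Cau r01 IH1 G2.
split; first by move: h1; congr H2; apply/funext => t; rewrite exprS.
by rewrite exprS -IH2 -h2; apply: eq_cint => t _; rewrite exprS.
Qed.

Lemma bounded_cvg (un : nat -> R -> R) (u : R -> R) :
  (forall n, measurable_fun D (un n)) -> measurable_fun D u ->
  {ae (leb R), forall t, D t -> un ^~ t @ \oo --> u t} ->
  {ae (leb R), forall t, D t -> forall n, `|un n t| <= 1} ->
  (fun n => \int[leb R]_(t in D) un n t) @ \oo --> \int[leb R]_(t in D) u t.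
Proof.
move=> mun mu cu bu.
have [] := @dominated_convergence _ _ _ (leb R) D (@measurable_I01 R)
  (fun n t => (un n t)%:E) (fun t => (u t)%:E) (cst 1%E).
- by move=> n; apply/measurable_EFinP; exact: mun.
- exact/measurable_EFinP.
- by apply: aeS cu => t /[apply] h; apply: cvg_EFin => //; near=> n.
- exact: (itg_cst (@leb_I01 R) 1).
- by apply: aeS bu => t h n Dt; rewrite lee_fin h.
move=> iu _ h; apply: fine_cvg; rewrite fineK//.
exact (integrable_fin_num (@measurable_I01 R) iu).
Unshelve. all: end_near. Qed.

End Radial.

(** * Limits of complex functions by real and imaginary parts *)

Section ComplexLimits.
Variable R : realType.
Implicit Types (a l z : R[i]).

Section filter.
Variables (T : Type) (FF : set_system T).
Context {HF : ProperFilter FF}.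
Implicit Types G H : T -> R[i].

Lemma cvgc_cst a : cvgc FF (fun=> a) a.
Proof. by split; exact: cvg_cst. Qed.

Lemma cvgcD G H a l : cvgc FF G a -> cvgc FF H l -> cvgc FF (fun x => G x + H x) (a + l).
Proof.
move=> [g1 g2] [h1 h2]; split.
  by rewrite ReD; under eq_fun do rewrite ReD; exact: cvgD.
by rewrite ImD; under eq_fun do rewrite ImD; exact: cvgD.
Qed.

Lemma cvgcM G H a l : cvgc FF G a -> cvgc FF H l -> cvgc FF (fun x => G x * H x) (a * l).
Proof.
move=> [g1 g2] [h1 h2]; split.
  by rewrite ReM; under eq_fun do rewrite ReM; apply: cvgB; exact: cvgM.
by rewrite ImM; under eq_fun do rewrite ImM; apply: cvgD; exact: cvgM.
Qed.

Lemma cvgcX G a n : cvgc FF G a -> cvgc FF (fun x => G x ^+ n) (a ^+ n).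
Proof.
move=> Ga; elim: n => [|n IH].
  by rewrite expr0; under [X in cvgc _ X]eq_fun do rewrite expr0; exact: cvgc_cst.
by rewrite exprS; under [X in cvgc _ X]eq_fun do rewrite exprS; exact: cvgcM.
Qed.

Lemma cvgc_csq G a : cvgc FF G a -> (fun x => csq (G x)) @ FF --> csq a.
Proof. by move=> [g1 g2]; apply: cvgD; exact: cvgM. Qed.

Lemma cvgcV G a : a != 0 -> cvgc FF G a -> cvgc FF (fun x => (G x)^-1) a^-1.
Proof.
move=> a0 Ga; have c := cvgc_csq Ga.
have cV : (fun x => (csq (G x))^-1) @ FF --> (csq a)^-1 by apply: cvgV; rewrite ?csq_eq0.
case: Ga => g1 g2; split.
  by rewrite ReV; under eq_fun do rewrite ReV; exact: cvgM.
by rewrite ImV; under eq_fun do rewrite ImV; apply: cvgM => //; exact: cvgN.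
Qed.

End filter.

Lemma radlimE (G : R -> R[i]) l : cvgc (1 : R)^'- G l -> radlim G = l.
Proof.
move=> [g1 g2]; rewrite /radlim.
have -> : lim ((fun r => complex.Re (G r)) x @[x --> (1:R)^'-]) = complex.Re l by exact: cvg_lim.
have -> : lim ((fun r => complex.Im (G r)) x @[x --> (1:R)^'-]) = complex.Im l by exact: cvg_lim.
by rewrite [RHS]complexE.
Qed.

Lemma near_radial : \forall r \near (1 : R)^'-, 0 <= r < 1.
Proof.
near=> r; apply/andP; split; last by near: r; exact: nbhs_left_lt.
by rewrite ltW//; near: r; apply: nbhs_left_gt.
Unshelve. all: end_near. Qed.

Lemma csq_rxi_lt1 (r t : R) : 0 <= r < 1 -> csq (r%:C * xi t) < 1.
Proof. by move=> /andP[r0 r1]; rewrite csq_rxi expr_lt1. Qed.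

Lemma cvgc_near (G H : R -> R[i]) l : (forall r, 0 <= r < 1 -> G r = H r) ->
  cvgc (1 : R)^'- G l -> cvgc (1 : R)^'- H l.
Proof.
move=> GH [g1 g2].
have n01 := near_radial.
by split; [apply: cvg_trans g1|apply: cvg_trans g2]; apply: near_eq_cvg;
  near=> r; rewrite GH//; near: r.
Unshelve. all: end_near. Qed.

(** Dominated convergence runs along sequences, so radial limits are sampled at these radii. *)
Definition rseq (j : nat) : R := 1 - (j.+2%:R)^-1.

Lemma rseq01 j : 0 <= rseq j < 1.
Proof.
by rewrite /rseq subr_ge0 invf_le1 ?ler1n ?ltr0n//= ltrBlDr ltrDl invr_gt0.
Qed.

Lemma cvg_rseq : rseq @ \oo --> (1 : R).
Proof.
rewrite -[X in _ --> X]subr0; apply: cvgB; first exact: cvg_cst.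
by have := @cvg_harmonic R; rewrite -cvg_shiftS.
Qed.

Lemma cvgc_rseq (G : R -> R[i]) l : cvgc (1 : R)^'- G l -> cvgc \oo (fun j => G (rseq j)) l.
Proof.
move=> [g1 g2]; have h : (forall n, rseq n < 1) /\ rseq @ \oo --> (1 : R).
  by split; [move=> n; have /andP[] := rseq01 n|exact: cvg_rseq].
split; first by apply: ((cvg_at_leftP _ _ _).1 g1 rseq h).
by apply: ((cvg_at_leftP _ _ _).1 g2 rseq h).
Qed.

Lemma abs_Re_le1 z : csq z <= 1 -> `|complex.Re z| <= 1.
Proof.
case: z => a b; rewrite /csq /= => h; have := sqr_ge0 b => b0.
by rewrite -(@ler_pXn2r _ 2)// ?nnegrE// real_normK ?num_real// expr1n; lra.
Qed.

End ComplexLimits.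

(** * Nonvanishing of the defect on the circle and the first component *)

Section FirstComponent.
Variables (R : realType) (mu : {measure set (measurableTypeR R) -> \bar R}).
Hypothesis mu1 : mu (@I01 R) = 1%E.
Variables (g : R[i]) (Phi : (R -> R[i]) -> (R -> R[i]) * (R -> R[i])).
Hypotheses (g1 : csq g < 1) (HPhi : is_Phi mu g Phi).
Implicit Types (f h k : R -> R[i]) (a l : R[i]).
Local Notation D := (@I01 R).
Local Notation tau := (thetab mu g).
Local Notation Del := (Delta mu g).
Local Notation s := (sg g).
Local Notation q1 := (sPhi1 g Phi).
Local Notation q2 := (sPhi2 g Phi).
Local Notation v := (defect1 g Phi).
Local Notation w := (defect2 g Phi).
Hint Resolve measurable_I01 leb_I01 : core.
Let mu_le1 : (mu D <= 1)%E. Proof. by rewrite mu1. Qed.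
Hint Resolve mu_le1 : core.
(** Makes [c0 * v + 1] equal to [(1 + q) / 2] with [q = 1 - v / (1 - g)]: averaging with 1 leaves 1
    as the only unimodular value. *)
Let c0 : R[i] := - (2 * (1 - g))^-1.

Let g1_neq0 : 1 - g != 0. Proof. exact: one_sub_g_neq0. Qed.

(** With [u = V / (1 - g)], the hypothesis says [|u|^2 <= 2 Re u], while
    [|1 - u / 2|^2 = 1 - Re u + |u|^2 / 4]. *)
Let csq_half (V : R[i]) : csq ((1 - g) - V) <= csq (1 - g) ->
  csq (c0 * V + 1) <= 1 - csq (V / (1 - g)) / 4.
Proof.
move=> h; have gp : 0 < csq (1 - g) by exact: csq_gt0.
set u := V / (1 - g).
have Vu : V = u * (1 - g) by rewrite /u divfK.
have -> : c0 * V + 1 = 1 - u / 2.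
  by rewrite /c0 /u; field.
have {h} : csq (1 - u) <= 1.
  move: h; have -> : 1 - g - V = (1 - u) * (1 - g) by rewrite Vu; ring.
  by rewrite csqM ger_pMl.
have -> : 1 - u / 2 = 1 - (2^-1 : R)%:C * u by rewrite mulrC fmorphV rmorph_nat.
by case: u {Vu} => a b; rewrite /csq /= => h; nra.
Qed.

Let pd t := c0 * v t + 1.

Let Hv : H2 v. Proof. exact: (H2_defect1 mu1 HPhi). Qed.

Let Hpd : H2 pd. Proof. by apply: H2_lin => //; exact: H2_1. Qed.

Let Cau_pd l : csq l < 1 -> Cau (leb R) pd l = c0 * Cau (leb R) v l + 1.
Proof.
move=> l1; rewrite /pd Cau_lin//; [by rewrite Cau_cst|by case: Hv|].
by case: (H2_1 R).
Qed.

Let csq_Cau_pd l : csq l < 1 -> csq (Cau (leb R) pd l) <= 1.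
Proof.
move=> l1; rewrite Cau_pd// (le_trans (csq_half (csq_defect1_le mu1 g1 HPhi l1)))//.
have := csq_ge0 (Cau (leb R) v l / (1 - g)); lra.
Qed.

(** The mean is the value at the centre of the disc, where [Cau v] is nonzero, so [csq_half] gives a
    strict bound. *)
Let csq_cint_pd : csq (cint (leb R) pd) < 1.
Proof.
have l0 : csq (0 : R[i]) < 1 by rewrite csq0.
rewrite -cint_Cau0 Cau_pd// (le_lt_trans (csq_half (csq_defect1_le mu1 g1 HPhi l0)))//.
have : 0 < csq (Cau (leb R) v 0 / (1 - g)).
  by rewrite csq_gt0// mulf_neq0 ?invr_eq0 ?(Cau_defect1_neq0 mu1 g1 HPhi l0).
lra.
Qed.

Let defect1_lim : {ae (leb R), forall t, D t ->
  cvgc (1 : R)^'- (fun r => Cau (leb R) v (r%:C * xi t)) (v t)}.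
Proof. exact: fatou_H2. Qed.

Let csq_pd_ae : {ae (leb R), forall t, D t -> csq (pd t) <= 1 - csq (v t / (1 - g)) / 4}.
Proof.
apply: aeS defect1_lim => t /[apply] c; apply: csq_half.
have cc : (fun r => csq ((1 - g) + (-1) * Cau (leb R) v (r%:C * xi t))) @ (1 : R)^'- -->
    csq ((1 - g) + (-1) * v t).
  by apply: cvgc_csq; apply: cvgcD; [exact: cvgc_cst|apply: cvgcM => //; exact: cvgc_cst].
rewrite -[v t]mul1r -mulNr; apply: (cvgr_to_le cc).
apply: filterS (near_radial R) => r r01; rewrite mulN1r.
by apply: (csq_defect1_le mu1 g1 HPhi); exact: csq_rxi_lt1.
Qed.

(** [cint_Cau_pow] on the circles of radius [rseq j], followed by bounded convergence; Fatou's
    theorem identifies the boundary limit. *)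
Let pd_pow n : \int[leb R]_(t in D) complex.Re (pd t ^+ n) = complex.Re (cint (leb R) pd ^+ n).
Proof.
have rp j := cint_Cau_pow n (rseq01 R j) Hpd.1.
have c : (fun j => \int[leb R]_(t in D) complex.Re (Cau (leb R) pd ((rseq R j)%:C * xi t) ^+ n))
    @ \oo --> \int[leb R]_(t in D) complex.Re (pd t ^+ n).
  apply: bounded_cvg.
  - by move=> j; have [/L2P[[m _] _] _] := (rp j).1.
  - by have /L2P[m _] := Hpd.1; have [] := cmeasX n m.
  - apply: aeS (fatou_H2 Hpd) => t /[apply] c.
    by have [] := cvgcX n (cvgc_rseq c).
  - apply: (@aeS _ _ (fun=> True)) => [t _ _ j|]; last exact: aeW.
    apply: abs_Re_le1; rewrite csqX exprn_ile1 ?csq_ge0// csq_Cau_pd//.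
    by have /andP[r0 r1] := rseq01 R j; rewrite csq_rxi expr_lt1.
rewrite -(cvg_lim _ c)//; rewrite (_ : (fun j => _) = fun=> complex.Re (cint (leb R) pd ^+ n)).
  by rewrite lim_cst.
by apply/funext => j; rewrite -Re_cint (rp j).2.
Qed.

(* The function [p = 1 - v / (2 (1 - g))], with [v = defect1], satisfies [|p| <= 1],
   with [p = 1] exactly where [v = 0]; the means of [p^n] are the powers of a number of modulus [< 1], while
   [p^n] tends to the indicator of [v = 0]. *)
Lemma defect1_neq0_ae : {ae (leb R), forall t, D t -> v t != 0}.
Proof.
have [/L2P[mv _] _] := Hv.
pose A : set (measurableTypeR R) := D `&` (fun t => csq (v t)) @^-1` [set 0].
have mA : measurable A by apply: (cmeas_csq mv); [exact: measurable_I01|exact: measurable_set1].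
have c : (fun n => \int[leb R]_(t in D) complex.Re (pd t ^+ n)) @ \oo --> \int[leb R]_(t in D) (\1_A t : R).
  apply: bounded_cvg.
  - by move=> n; have /L2P[m _] := Hpd.1; have [] := cmeasX n m.
  - exact: measurable_indic.
  - apply: aeS csq_pd_ae => t h Dt; rewrite indicE; have {}h := h Dt.
    have [v0|v0] := eqVneq (v t) 0.
      have -> : t \in A by rewrite inE; split => //; change (csq (v t) = 0); rewrite v0 csq0.
      by rewrite /pd v0 mulr0 add0r; under eq_fun do rewrite expr1n; exact: cvg_cst.
    have -> : t \in A = false.
      by apply/negbTE; rewrite notin_setE => -[_ /= /eqP]; rewrite csq_eq0 (negbTE v0).
    have z : (fun n => csq (0 - pd t ^+ n)) @ \oo --> (0 : R).
      have p1 : csq (pd t) < 1.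
        have : 0 < csq (v t / (1 - g)) by rewrite csq_gt0// mulf_neq0 ?invr_eq0.
        lra.
      under eq_fun do rewrite sub0r csqN csqX.
      by apply: cvg_expr; rewrite ger0_norm ?csq_ge0.
    by have [] := csq_cvg z.
  - apply: aeS csq_pd_ae => t /[apply] h n; apply: abs_Re_le1.
    rewrite csqX exprn_ile1 ?csq_ge0// (le_trans h)//.
    have := csq_ge0 (v t / (1 - g)); lra.
have c' : (fun n => \int[leb R]_(t in D) complex.Re (pd t ^+ n)) @ \oo --> (0 : R).
  under eq_fun do rewrite pd_pow.
  have z : (fun n => csq (0 - cint (leb R) pd ^+ n)) @ \oo --> (0 : R).
    under eq_fun do rewrite sub0r csqN csqX.
    by apply: cvg_expr; rewrite ger0_norm ?csq_ge0.
  by have [] := csq_cvg z.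
have A0 : \int[leb R]_(t in D) (\1_A t : R) = 0 by exact: (cvg_unique _ c c').
have lA : leb R A = 0%E.
  have AD : A `&` D = A by apply/seteqP; split => [t []|t []].
  have fA : leb R A \is a fin_num.
    rewrite ge0_fin_numE// (le_lt_trans _ (ltry 1))// (le_trans _ (@leb_I01 R))//.
    by apply: le_measure; rewrite ?inE// => t [].
  move: A0; rewrite /Rintegral integral_indic// AD => A0.
  by rewrite -(fineK fA) A0.
exists A; split => // t /= /not_implyP[Dt /negP]; rewrite negbK => /eqP v0.
by split => //; change (csq (v t) = 0); rewrite v0 csq0.
Qed.

(** [lim] is total, so existence of the radial limit has to be proved before [Tplus] can be
    evaluated. It is the limit of [Cau (q1 f) / Cau v], whose denominator vanishes neither in the
    disc nor, almost everywhere, in the limit. *)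
Lemma Tplus_cvg f : L2 mu f -> {ae (leb R), forall t, D t -> v t != 0 /\
  cvgc (1 : R)^'- (fun r => Tr mu r f (xi t)) (q1 f t / v t)}.
Proof.
move=> f2; have fl := fatou_H2 (H2_sPhi1 HPhi f2).
apply: aeS3 defect1_neq0_ae defect1_lim fl => t v0 c1 c2 Dt.
split; first exact: v0.
have c3 : cvgc (1 : R)^'- (fun r => Cau (leb R) (q1 f) (r%:C * xi t) / Cau (leb R) v (r%:C * xi t))
    (q1 f t / v t).
  by apply: cvgcM; [exact: c2|apply: cvgcV; [exact: v0|exact: c1]].
apply: (cvgc_near _ c3) => r /andP[r0 r1]; have l1 : csq (r%:C * xi t) < 1 by rewrite csq_rxi expr_lt1.
rewrite Tr_Cau (Cau_sPhi1 mu1 g1 HPhi f2 l1) mulrAC mulfV ?mul1r//.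
exact: (Cau_defect1_neq0 mu1 g1 HPhi l1).
Qed.

Lemma Tplus_ae f : L2 mu f -> {ae (leb R), forall t, D t -> v t != 0 /\ Tplus mu f t = q1 f t / v t}.
Proof.
move=> f2; apply: aeS (Tplus_cvg f2) => t /[apply] -[v0 c]; split => //.
exact: radlimE.
Qed.

(** The bound [Re >= 1/2] survives the radial limit. It gives the division by [Tplus mu b] its
    ordinary meaning. *)
Lemma Tplus_bb_neq0 : {ae (leb R), forall t, D t -> Tplus mu (@bb R) t != 0}.
Proof.
apply: aeS (Tplus_cvg (L2_bb mu1)) => t /[apply] -[_ c].
rewrite /Tplus (radlimE c); have [c1 _] := c; apply/eqP => z; rewrite z in c1.
have : (1 / 2 : R) <= 0.
  apply: (cvgr_to_ge c1).
  apply: filterS (near_radial R) => r r01; rewrite Tr_Cau; apply: (Re_Cau_bb_ge mu1).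
  exact: csq_rxi_lt1.
by rewrite leNgt divr_gt0.
Qed.

Lemma first_component f : L2 mu f -> {ae (leb R), forall t, D t ->
  q1 f t = (1 + cj g * tau t) / Tplus mu (@bb R) t * Tplus mu f t}.
Proof.
move=> f2; have b2 := L2_bb mu1.
have h12 : {ae (leb R), forall t, D t -> v t != 0 /\ q1 (@bb R) t = 1 + cj g * tau t}.
  by apply: aeS2 defect1_neq0_ae (defect_formulas mu1 g1 HPhi) => t h1 h2 Dt; have [->] := h2 Dt; rewrite h1.
have h34 : {ae (leb R), forall t, D t -> Tplus mu (@bb R) t = q1 (@bb R) t / v t /\
    Tplus mu f t = q1 f t / v t}.
  by apply: aeS2 (Tplus_ae b2) (Tplus_ae f2) => t h1 h2 Dt; have [_ ->] := h1 Dt; have [_ ->] := h2 Dt.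
apply: aeS3 h12 h34 Tplus_bb_neq0 => t h1 h2 h3 Dt.
have [v0 E] := h1 Dt; have [E1 E2] := h2 Dt; have n0 := h3 Dt.
rewrite E1 mulf_eq0 negb_or in n0; have /andP[q0 _] := n0.
by rewrite E1 E2 -E; field; rewrite v0.
Qed.

End FirstComponent.

(** * A monotone class theorem and the second component *)

Section StepLimit.
Variable R : realType.

Lemma bernoulli_ge (x : R) n : 0 <= x <= 1 -> 1 - n%:R * x <= (1 - x) ^+ n.
Proof.
move=> /andP[x0 x1]; elim: n => [|n IH]; first by rewrite mul0r subr0 expr0.
rewrite exprS -natr1; have h : 0 <= (1 - x) ^+ n by rewrite exprn_ge0// subr_ge0.
have n0 : 0 <= n%:R :> R by rewrite ler0n.
have : (1 - x) * (1 - n%:R * x) <= (1 - x) * (1 - x) ^+ n by rewrite ler_wpM2l// subr_ge0.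
have := mulr_ge0 n0 (mulr_ge0 x0 x0); nra.
Qed.

(** The product decreases in [n], because [(1 - x)(1 + (n + 1) x) <= 1 + n x]. *)
Lemma bernoulli_le (x : R) n : 0 <= x <= 1 -> (1 - x) ^+ n * (1 + n%:R * x) <= 1.
Proof.
move=> /andP[x0 x1]; elim: n => [|n IH]; first by rewrite mul0r addr0 expr0 mulr1.
have h : 0 <= (1 - x) ^+ n by rewrite exprn_ge0// subr_ge0.
apply: le_trans IH; rewrite exprSr -mulrA ler_wpM2l// -natr1.
have n0 : 0 <= n%:R :> R by rewrite ler0n.
have := mulr_ge0 n0 (mulr_ge0 x0 x0); have := mulr_ge0 x0 x0; nra.
Qed.

(** With [y = sqrt x], [bernoulli_le] bounds [n y^n] by [1 / (1 - y)], and a second factor [y^n]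
    remains. *)
Lemma cvg_natmul_exp (x : R) : 0 <= x < 1 -> (fun n => n%:R * x ^+ n) @ \oo --> (0 : R).
Proof.
move=> /andP[x0 x1]; set y := Num.sqrt x.
have y0 : 0 <= y by exact: sqrtr_ge0.
have xy : x = y ^+ 2 by rewrite sqr_sqrtr.
have y1 : y < 1 by rewrite -(@ltr_pXn2r _ 2)// ?nnegrE// expr1n -xy.
apply: (@squeeze_cvgr _ _ _ _ (fun=> 0) (fun n => y ^+ n * (1 - y)^-1)).
- near=> n; rewrite mulr_ge0 ?exprn_ge0 ?ler0n//=.
  rewrite xy -exprM mulnC exprM -[leRHS]mulrC.
  have := @bernoulli_le (1 - y) n; rewrite subKr subr_ge0 gerBl (ltW y1) y0 => /(_ isT) h.
  have yn := exprn_ge0 n y0.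
  rewrite ler_pdivlMl ?subr_gt0// expr2 !mulrA.
  by rewrite -[leRHS]mul1r ler_wpM2r//; nra.
- exact: cvg_cst.
- rewrite -[X in _ --> X](mul0r (1 - y)^-1); apply: cvgMr_tmp; apply: cvg_expr.
  by rewrite ger0_norm.
Unshelve. all: end_near. Qed.

(* The exponent [n 2^n] makes the limit at the threshold [x = 1/2] equal to [0] as well. *)
Lemma cvg_step (x : R) : 0 <= x <= 1 ->
  (fun n => (1 - x ^+ n) ^+ (n * 2 ^ n)) @ \oo --> ((x < 1 / 2)%R%:R : R).
Proof.
move=> /andP[x0 x1]; have xn n : 0 <= x ^+ n <= 1 by rewrite exprn_ge0// exprn_ile1.
have E n : (n * 2 ^ n)%:R * x ^+ n = n%:R * (2 * x) ^+ n.
  by rewrite natrM natrX exprMn mulrA.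
have [x2|x2] := ltP x (1 / 2).
  apply: (@squeeze_cvgr _ _ _ _ (fun n => 1 - n%:R * (2 * x) ^+ n) (fun=> 1)).
  - near=> n; rewrite -E bernoulli_ge//= exprn_ile1//.
      by rewrite subr_ge0; have /andP[] := xn n.
    by rewrite gerBl; have /andP[] := xn n.
  - rewrite -[X in _ --> X]subr0; apply: cvgB; first exact: cvg_cst.
    by apply: cvg_natmul_exp; lra.
  - exact: cvg_cst.
apply: (@squeeze_cvgr _ _ _ _ (fun=> 0) (fun n => (n.+1%:R)^-1)).
- near=> n; apply/andP; split; first by rewrite exprn_ge0// subr_ge0; have /andP[] := xn n.
  rewrite -[leRHS]mul1r ler_pdivlMr ?ltr0n//.
  apply: le_trans (bernoulli_le (n * 2 ^ n) (xn n)).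
  rewrite E ler_wpM2l//; first by rewrite exprn_ge0// subr_ge0; have /andP[] := xn n.
  by rewrite -natr1 addrC lerD2l ler_peMr ?ler0n// exprn_ege1//; lra.
- exact: cvg_cst.
- exact: cvg_harmonic.
Unshelve. all: end_near. Qed.

(** For [y >= 0], the minimum of [n] and the integer part of [y], written as a sum of indicators so
    that [mult_sum] applies. *)
Definition count_le (y : R) n : R := \sum_(k < n) (k.+1%:R <= y)%R%:R.

Lemma count_le_spec (y : R) n : 0 <= y ->
  [/\ count_le y n <= y, count_le y n <= n%:R & y - 1 <= count_le y n \/ count_le y n = n%:R].
Proof.
move=> y0; elim: n => [|n [h1 h2 h3]]; first by rewrite /count_le big_ord0; split => //; right.
rewrite /count_le big_ord_recr /= -/(count_le y n) -natr1.
have [ny|ny] := lerP (n%:R + 1) y.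
  rewrite (_ : true%:R = 1 :> R)//; split; [lra|lra|].
  by case: h3 => [h3|->]; [left; lra|right].
rewrite addr0; split => //; first lra.
by left; case: h3 => [//|->]; lra.
Qed.

Lemma count_leP (y : R) n : 0 <= y <= n%:R -> `|y - count_le y n| <= 1.
Proof.
move=> /andP[y0 yn]; have [h1 h2 h3] := count_le_spec n y0.
rewrite ler_norml; apply/andP; split; first lra.
by case: h3 => [|->]; lra.
Qed.

End StepLimit.

(** * Arcs of the circle described by signs of sine and cosine *)

Section Arcs.
Variable R : realType.
Implicit Types t x y b : R.

Lemma cos2pi_sub t : cos (2 * pi * (1 - t)) = cos (2 * pi * t).
Proof.
rewrite (mulrBr (2 * pi) 1 t) mulr1 cosB.
have -> : 2 * pi = pi *+ 2 :> R by rewrite mulr_natl.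
by rewrite cos2pi sin2pi mul1r mul0r addr0.
Qed.

Lemma sin2pi_lt0 t : 0 <= t < 1 -> (0 < - sin (2 * pi * t)) = (1 / 2 < t).
Proof.
move=> /andP[t0 t1]; have pg := pi_gt0 R; rewrite oppr_gt0.
have [t2|t2] := ltP (1 / 2) t.
  have -> : 2 * pi * t = (2 * pi * t - pi) + pi by ring.
  rewrite sinDpi oppr_lt0; apply: sin_gt0_pi; apply/andP; split; nra.
apply/negbTE; rewrite -leNgt; apply: sin_ge0_pi; apply/andP; split; nra.
Qed.

Lemma cos2pi_lt x y : 0 <= x <= 1 / 2 -> 0 <= y <= 1 / 2 ->
  (cos (2 * pi * x) < cos (2 * pi * y)) = (y < x).
Proof.
move=> /andP[x0 x1] /andP[y0 y1]; have pg := pi_gt0 R.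
rewrite ltr_cos ?in_itv /=; [|apply/andP; split; nra..].
by rewrite ltr_pM2l// mulr_gt0.
Qed.

End Arcs.

(** * Monotone class theorem in [L^2(m)] *)

Section Density.
Variables (R : realType) (m : {measure set (measurableTypeR R) -> \bar R}).
Hypothesis m1 : (m (@I01 R) <= 1)%E.
Local Notation D := (@I01 R).
Implicit Types (f h : R -> R[i]) (u phi : R -> R).
Hint Resolve measurable_I01 : core.

Variable Cl : (R -> R[i]) -> Prop.
Hypothesis Cl_L2 : forall f, Cl f -> L2 m f.
Hypothesis Cl1 : Cl (fun=> 1).
Hypothesis Cl_lin : forall a f h, Cl f -> Cl h -> Cl (fun t => a * f t + h t).
Hypothesis Cl_xi : forall f, Cl f -> Cl (fun t => xi t * f t).
Hypothesis Cl_cjxi : forall f, Cl f -> Cl (fun t => cj (xi t) * f t).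
(** Convergence is required at every point of [D], so that [Cl] may be defined by a condition almost
    everywhere for a measure unrelated to [m]. *)
Hypothesis Cl_lim : forall (fn : nat -> R -> R[i]) f h, (forall n, Cl (fn n)) -> L2 m f -> L2 m h ->
  (forall t, D t -> cvgc \oo (fun n => fn n t) (f t)) ->
  (forall n t, D t -> csq (fn n t) <= csq (h t)) -> Cl f.

Lemma Cl_0 : Cl (fun=> 0).
Proof.
have -> : (fun=> 0 : R[i]) = (fun t : R => (-1) * 1 + 1) by apply/funext => t; ring.
exact: Cl_lin.
Qed.

Lemma ClZ a f : Cl f -> Cl (fun t => a * f t).
Proof.
move=> Cf; have := Cl_lin a Cf Cl_0; congr Cl; by apply/funext => t; rewrite addr0.
Qed.

(** [Cl] is only assumed to be a vector space; bounded real functions preserving it form an algebra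
    closed under bounded limits, and applying them to 1 gives members of [Cl]. *)
Definition multiplier phi := [/\ measurable_fun D phi,
  exists K, forall t, D t -> `|phi t| <= K & forall f, Cl f -> Cl (fun t => (phi t)%:C * f t)].

Lemma cmeasC phi : measurable_fun D phi -> cmeas (fun t => (phi t)%:C).
Proof. by move=> mp; split => //=; exact: measurable_cst. Qed.

Lemma csqC_le (x K : R) : `|x| <= K -> csq x%:C <= K ^+ 2.
Proof.
by move=> h; rewrite csqC -real_normK ?num_real// ler_pXn2r// nnegrE (le_trans _ h).
Qed.

Lemma mult_lim (pn : nat -> R -> R) phi K : (forall n, multiplier (pn n)) ->
  (forall n t, D t -> `|pn n t| <= K) ->
  (forall t, D t -> (fun n => pn n t) @ \oo --> phi t) -> multiplier phi.
Proof.
move=> mn bn cn.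
have mp : measurable_fun D phi.
  by apply: (@measurable_fun_cvg _ _ _ _ pn) => // n; have [] := mn n.
have bp t : D t -> `|phi t| <= K.
  move=> Dt; rewrite ler_norml; apply/andP; split.
    by apply: (cvgr_to_ge (cn t Dt)); near=> n; have := bn n t Dt; rewrite ler_norml => /andP[].
  by apply: (cvgr_to_le (cn t Dt)); near=> n; have := bn n t Dt; rewrite ler_norml => /andP[].
split => //; first by exists K.
move=> f Cf; have f2 := Cl_L2 Cf.
apply: (@Cl_lim (fun n t => (pn n t)%:C * f t) _ (fun t => K%:C * f t)).
- by move=> n; have [_ _] := mn n; apply.
- apply: (@L2_bddM _ _ _ _ (K ^+ 2)) => //.
  by move=> t Dt; apply: csqC_le; exact: bp.
- exact: L2Z.
- move=> t Dt; apply: cvgcM; last exact: cvgc_cst.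
  by split; [exact: cn|exact: cvg_cst].
- move=> n t Dt; rewrite !csqM ler_wpM2r ?csq_ge0// [leRHS]csqC; apply: csqC_le; exact: bn.
Unshelve. all: end_near. Qed.

(** A constant sequence in [mult_lim], where convergence is asked on [D] only: values off [D] may be
    changed. *)
Lemma mult_ext phi u : multiplier phi -> (forall t, D t -> phi t = u t) -> multiplier u.
Proof.
move=> mp pu; have [_ [K hK] _] := mp.
apply: (@mult_lim (fun=> phi) _ K) => // t Dt.
by rewrite (pu t Dt); exact: cvg_cst.
Qed.

Lemma mult_cst (a : R) : multiplier (fun=> a).
Proof.
split; first exact: measurable_cst.
  by exists (`|a|)%R.
by move=> f Cf; exact: ClZ.
Qed.

Lemma multD phi u : multiplier phi -> multiplier u -> multiplier (fun t => phi t + u t).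
Proof.
move=> [mp [K hK] Cp] [mu [L hL] Cu]; split; first exact: measurable_funD.
  by exists (K + L) => t Dt; rewrite (le_trans (ler_normD _ _))// lerD ?hK ?hL.
move=> f Cf; have := Cl_lin 1 (Cp f Cf) (Cu f Cf); congr Cl; apply/funext => t.
by rewrite mul1r rmorphD mulrDl.
Qed.

Lemma multM phi u : multiplier phi -> multiplier u -> multiplier (fun t => phi t * u t).
Proof.
move=> [mp [K hK] Cp] [mu [L hL] Cu]; split; first exact: measurable_funM.
  by exists (K * L) => t Dt; rewrite normrM ler_pM ?hK ?hL.
move=> f Cf; have := Cp _ (Cu f Cf); congr Cl; apply/funext => t.
by rewrite rmorphM mulrA.
Qed.

Lemma multZ a phi : multiplier phi -> multiplier (fun t => a * phi t).
Proof. by apply: multM; exact: mult_cst. Qed.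

Lemma multX phi n : multiplier phi -> multiplier (fun t => phi t ^+ n).
Proof.
move=> mp; elim: n => [|n IH]; first by under eq_fun do rewrite expr0; exact: mult_cst.
by under eq_fun do rewrite exprS; exact: multM.
Qed.

Lemma mult_1sub phi : multiplier phi -> multiplier (fun t => 1 - phi t).
Proof.
move=> mp; have := multD (mult_cst 1) (multZ (-1) mp); congr multiplier.
by apply/funext => t; rewrite mulN1r.
Qed.

Lemma mult_cos : multiplier (fun t => cos (2 * pi * t)).
Proof.
split; first by have [] := @cmeas_xi R.
  by exists 1 => t _; exact: cos_max.
move=> f Cf; have h1 := Cl_lin 1 (Cl_xi Cf) (Cl_cjxi Cf).
have := ClZ (2%:R)^-1 h1; congr Cl; apply/funext => t.
have -> : (cos (2 * pi * t))%:C = (xi t + cj (xi t)) / 2.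
  rewrite /xi /cj /=; apply: (mulIf (x := 2 : R[i])); first by rewrite pnatr_eq0.
  by rewrite divfK ?pnatr_eq0// mulr_natr mulr2n; simpc; congr Complex; ring.
by ring.
Qed.

Lemma mult_sin : multiplier (fun t => sin (2 * pi * t)).
Proof.
split; first by have [] := @cmeas_xi R.
  by exists 1 => t _; exact: sin_max.
move=> f Cf; have h1 := Cl_lin (-1) (Cl_cjxi Cf) (Cl_xi Cf).
have i0 : ('i : R[i]) != 0 by rewrite eq_complex /= oner_eq0 andbF.
have := ClZ (2%:R * 'i)^-1 h1; congr Cl; apply/funext => t.
have -> : (sin (2 * pi * t))%:C = (xi t - cj (xi t)) / (2 * 'i).
  apply: (mulIf (x := 2 * 'i : R[i])); first by rewrite mulf_neq0 ?pnatr_eq0.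
  rewrite divfK ?mulf_neq0 ?pnatr_eq0// mulrA mulr_natr mulr2n /xi /cj; simpc.
  by congr Complex; ring.
by ring.
Qed.

(** The affine map [x = 1/2 - phi / (2 K)] takes values in [[0, 1]] on [D] and turns [phi > 0] into
    [x < 1/2]; [cvg_step] supplies polynomials in [phi] tending to the indicator. *)
Lemma mult_pos phi : multiplier phi -> multiplier (fun t => (0 < phi t)%R%:R).
Proof.
move=> mp; have [_ [K0 hK0] _] := mp.
pose K := `|K0| + 1; have K_gt0 : 0 < K by rewrite ltr_wpDl.
have hK t : D t -> `|phi t| <= K.
  by move=> Dt; rewrite (le_trans (hK0 t Dt))// /K; have := ler_norm K0; lra.
pose x t := 1 / 2 + (- (2 * K)^-1) * phi t.
have x01 t : D t -> 0 <= x t <= 1.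
  move=> /hK; rewrite ler_norml => /andP[h1 h2].
  have e : (2 * K)^-1 * K = 1 / 2 by field; rewrite gt_eqF.
  have i0 : 0 < (2 * K)^-1 by rewrite invr_gt0 mulr_gt0.
  rewrite /x; apply/andP; split; nra.
have mx : multiplier x by apply: multD; [exact: mult_cst|exact: multZ].
apply: (@mult_lim (fun n t => (1 - x t ^+ n) ^+ (n * 2 ^ n)) _ 1).
- by move=> n; apply: multX; apply: mult_1sub; exact: multX.
- move=> n t /x01 /andP[x0 x1].
  have h0 : 0 <= x t ^+ n <= 1 by rewrite exprn_ge0// exprn_ile1.
  by rewrite ger0_norm ?exprn_ge0 ?exprn_ile1//; lra.
- move=> t Dt; have -> : (0 < phi t) = (x t < 1 / 2).
    by rewrite /x -ltrBrDl subrr mulNr oppr_lt0 pmulr_rgt0// invr_gt0 mulr_gt0.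
  exact: cvg_step (x01 t Dt).
Qed.

Definition multiplier_set (A : set R) := multiplier (\1_A).

Lemma msetC A : multiplier_set A -> multiplier_set (~` A).
Proof.
move=> mA; have := mult_1sub mA; congr multiplier; apply/funext => t.
by rewrite !indicE in_setC; case: (t \in A); rewrite ?subrr ?subr0.
Qed.

Lemma msetI A B : multiplier_set A -> multiplier_set B -> multiplier_set (A `&` B).
Proof.
move=> mA mB; have := multM mA mB; congr multiplier; apply/funext => t.
by rewrite !indicE in_setI -natrM mulnb.
Qed.

Lemma msetU A B : multiplier_set A -> multiplier_set B -> multiplier_set (A `|` B).
Proof.
by move=> mA mB; rewrite -[_ `|` _]setCK setCU; apply/msetC/msetI; exact: msetC.
Qed.

Lemma mset0 : multiplier_set set0.
Proof. by have := mult_cst 0; congr multiplier; rewrite indic0. Qed.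

Lemma mset_bigcup (F : nat -> set R) : (forall n, multiplier_set (F n)) -> multiplier_set (\bigcup_n F n).
Proof.
move=> mF; pose G n := \big[setU/set0]_(i < n) F i.
have mG n : multiplier_set (G n).
  elim: n => [|n IH]; rewrite /G ?big_ord0; first exact: mset0.
  by rewrite big_ord_recr /=; exact: msetU.
apply: (@mult_lim (fun n => \1_(G n)) _ 1) => // [n t _|t _].
  by rewrite indicE; case: (_ \in _); rewrite ?normr0 ?normr1.
apply/cvgrPdist_lt => e e0; have [[N _ FN]|tF] := pselect ((\bigcup_n F n) t).
  near=> n; have -> : \1_(G n) t = 1 :> R.
    rewrite indicE mem_set// /G -bigcup_mkord; exists N => //=.
    by near: n; exact: nbhs_infty_gt.
  by rewrite indicE mem_set ?subrr ?normr0//; exists N.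
near=> n; have -> : \1_(G n) t = 0 :> R.
  rewrite indicE memNset// /G -bigcup_mkord => -[k _ Fk]; apply: tF; by exists k.
by rewrite indicE memNset// subrr normr0.
Unshelve. all: end_near. Qed.

(** The sign of the sine separates the two half-circles, and on each of them the cosine is monotone,
    so comparing cosines compares [t] with [b]. *)
Lemma mult_le_cst b : multiplier (fun t => (t <= b)%R%:R).
Proof.
have DE t : D t -> 0 <= t < 1 by rewrite /I01 /= in_itv.
have ps : multiplier (fun t => (0 < - sin (2 * pi * t))%R%:R).
  apply: mult_pos; have := multZ (-1) mult_sin; congr multiplier.
  by apply/funext => t; rewrite mulN1r.
have [b0|b0] := ltP b 0.
  apply: (mult_ext (mult_cst 0)) => t /DE /andP[t0 _].
  by rewrite leNgt (lt_le_trans b0 t0).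
have [b1|b1] := leP 1 b.
  apply: (mult_ext (mult_cst 1)) => t /DE /andP[_ t1].
  by rewrite (ltW (lt_le_trans t1 b1)).
have [b2|b2] := leP b (1 / 2).
  have pc : multiplier (fun t => (0 < cos (2 * pi * b) - cos (2 * pi * t))%R%:R).
    apply: mult_pos; have := multD (mult_cst (cos (2 * pi * b))) (multZ (-1) mult_cos); congr multiplier.
    by apply/funext => t; rewrite mulN1r.
  apply: (mult_ext (multM (mult_1sub ps) (mult_1sub pc))) => t /DE t01.
  rewrite sin2pi_lt0// subr_gt0; have [t2|t2] := ltP (1 / 2) t.
    by rewrite subrr mul0r leNgt (le_lt_trans b2 t2).
  have /andP[t0 _] := t01.
  rewrite cos2pi_lt ?t0 ?t2 ?b0 ?b2// subr0 mul1r leNgt.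
  by case: (b < t); rewrite ?subrr ?subr0.
have pc : multiplier (fun t => (0 < cos (2 * pi * t) - cos (2 * pi * b))%R%:R).
  apply: mult_pos; have := multD mult_cos (mult_cst (- cos (2 * pi * b))); congr multiplier.
apply: (mult_ext (mult_1sub (multM ps pc))) => t /DE t01.
rewrite sin2pi_lt0// subr_gt0; have [t2|t2] := ltP (1 / 2) t; last first.
  by rewrite mul0r subr0 (ltW (le_lt_trans t2 b2)).
have /andP[t0 t1] := t01.
rewrite -(cos2pi_sub t) -(cos2pi_sub b) cos2pi_lt; [|lra..].
have -> : (1 - t < 1 - b) = (b < t) by rewrite ltrD2l ltrN2.
by rewrite mul1r leNgt; case: (b < t); rewrite ?subrr ?subr0.
Qed.

(** Multiplier sets are stable under complements and countable unions, and the rays []b, +oo[]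
    generate the Borel sets. *)
Lemma mset_measurable (A : set (measurableTypeR R)) : measurable A -> multiplier_set A.
Proof.
move=> mA; have {mA} : (@ocitv R).-sigma.-measurable A by exact: mA.
rewrite RGenOInfty.measurableE; apply: smallest_sub.
  split; [exact: mset0| |exact: mset_bigcup].
  by move=> B mB; rewrite setTD; exact: msetC.
move=> _ [b ->].
have -> : `]b, +oo[%classic = ~` [set t | t <= b] :> set R.
  by apply/seteqP; split => t /=; rewrite in_itv /= andbT ltNge => /negP.
apply: msetC; have := mult_le_cst b; congr multiplier; apply/funext => t.
by rewrite indicE; congr ((_ : bool)%:R); apply/idP/idP; rewrite inE.
Qed.

Lemma mult_sum (F : nat -> R -> R) n : (forall k, multiplier (F k)) ->
  multiplier (fun t => \sum_(k < n) F k t).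
Proof.
move=> mF; elim: n => [|n IH].
  by under eq_fun do rewrite big_ord0; exact: mult_cst.
by under eq_fun do rewrite big_ord_recr /=; exact: multD.
Qed.

(** Uniform approximation by the integer part of [(n + 1) phi] divided by [n + 1], a combination of
    indicators of superlevel sets. *)
Lemma mult_unit phi : measurable_fun D phi -> (forall t, D t -> 0 <= phi t <= 1) -> multiplier phi.
Proof.
move=> mp p01; pose pn n t := n.+1%:R^-1 * count_le (n.+1%:R * phi t) n.+1.
have close n t : D t -> `|phi t - pn n t| <= n.+1%:R^-1.
  move=> Dt; have /andP[p0 p1] := p01 t Dt; have n0 : 0 < n.+1%:R :> R by rewrite ltr0n.
  have -> : phi t - pn n t = n.+1%:R^-1 * (n.+1%:R * phi t - count_le (n.+1%:R * phi t) n.+1).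
    by rewrite /pn mulrBr mulKf ?gt_eqF.
  rewrite normrM gtr0_norm ?invr_gt0// ler_piMr ?invr_ge0 ?(ltW n0)//.
  by apply: count_leP; rewrite mulr_ge0 ?(ltW n0)//= ler_piMr ?(ltW n0).
apply: (@mult_lim pn _ 2).
- move=> n; apply: multZ; rewrite /count_le.
  apply: (@mult_sum (fun k t => (k.+1%:R <= n.+1%:R * phi t)%R%:R)) => k.
  pose A : set (measurableTypeR R) := D `&` (fun t => n.+1%:R * phi t) @^-1` `[k.+1%:R, +oo[%classic.
  have mA : measurable A.
    have mnp : measurable_fun D (fun t => n.+1%:R * phi t).
      by apply: measurable_funM => //; exact: measurable_cst.
    by apply: mnp => //; exact: measurable_itv.
  apply: (mult_ext (mset_measurable mA)) => t Dt; rewrite indicE; congr ((_ : bool)%:R).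
  apply/idP/idP => [|h]; first by rewrite inE => -[_ /=]; rewrite in_itv /= andbT.
  by rewrite inE; split => //=; rewrite in_itv /= h.
- move=> n t Dt; have /andP[p0 p1] := p01 t Dt; have := close n t Dt.
  have i1 : n.+1%:R^-1 <= 1 :> R by rewrite invf_le1 ?ltr0n// ler1n.
  move: i1 p0 p1; move: (n.+1%:R^-1) (pn n t) (phi t) => a b c a1 c0 c1.
  by rewrite !ler_norml => /andP[h1 h2]; apply/andP; split; lra.
- move=> t Dt; apply/cvgrPdist_le => e e0; near=> n.
  rewrite (le_trans (close n t Dt))// ltW//; near: n.
  exact: near_infty_natSinv_lt (PosNum e0).
Unshelve. all: end_near. Qed.

Lemma mult_bounded phi K : measurable_fun D phi -> (forall t, D t -> `|phi t| <= K) -> multiplier phi.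
Proof.
move=> mp hK; pose L := `|K| + 1; have L0 : 0 < L by rewrite ltr_wpDl.
have hL t : D t -> `|phi t| <= L.
  by move=> Dt; rewrite (le_trans (hK t Dt))// /L; have := ler_norm K; lra.
pose u t := (2 * L)^-1 * (phi t + L).
have mu : multiplier u.
  apply: mult_unit.
    apply: measurable_funM; first exact: measurable_cst.
    by apply: measurable_funD => //; exact: measurable_cst.
  move=> t /hL; rewrite ler_norml => /andP[h1 h2]; rewrite /u.
  rewrite mulr_ge0 ?invr_ge0 ?mulr_ge0 ?(ltW L0)//=; last lra.
  by rewrite ler_pdivrMl ?mulr_gt0//; lra.
have := multD (multZ (2 * L) mu) (mult_cst (- L)); congr multiplier; apply/funext => t.
by rewrite /u mulrA mulfV ?gt_eqF ?mulr_gt0// mul1r addrK.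
Qed.

(** The truncation of [u] at height [n] is a multiplier applied to 1, and all truncations are
    dominated by [h]. *)
Lemma Cl_real u h : measurable_fun D u -> L2 m h ->
  (forall t, D t -> u t ^+ 2 <= csq (h t)) -> Cl (fun t => (u t)%:C).
Proof.
move=> mu h2 uh; pose un n t := u t * (`|u t| <= n%:R)%R%:R.
have muC : cmeas (fun t => (u t)%:C) by exact: cmeasC.
have mun n : multiplier (un n).
  apply: (@mult_bounded _ n%:R).
    pose A : set (measurableTypeR R) := D `&` (fun t => `|u t|) @^-1` `]-oo, n%:R]%classic.
    have mA : measurable A.
      have mn : measurable_fun D (fun t => `|u t|) by apply: measurableT_comp.
      by apply: mn => //; exact: measurable_itv.
    have mE : measurable_fun D (fun t => u t * \1_A t).
      by apply: measurable_funM => //; exact: measurable_indic.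
    apply: eq_measurable_fun mE => t; rewrite inE => Dt; rewrite /un indicE; congr (_ * (_ : bool)%:R).
    apply/idP/idP => [|h']; first by rewrite inE => -[_ /=]; rewrite in_itv /=.
    by rewrite inE; split => //=; rewrite in_itv /= h'.
  move=> t _; rewrite /un; case: (leP `|u t| n%:R) => h'; first by rewrite mulr1.
  by rewrite mulr0 normr0 ler0n.
apply: (@Cl_lim (fun n t => (un n t)%:C) _ h) => //.
- move=> n; have [_ _ H] := mun n; have := H _ Cl1; congr Cl; apply/funext => t.
  by rewrite mulr1.
- have /L2P[mh ih] := h2; apply/L2P; split => //.
  apply: itg_le ih; first exact: cmeas_csq.
  by move=> t Dt; rewrite csqC ger0_norm ?sqr_ge0// uh.
- move=> t Dt; split; last exact: cvg_cst.
  apply: cvg_near_cst; near=> n; rewrite /= /un.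
  have -> : `|u t| <= n%:R by rewrite ltW//; near: n; exact: nbhs_infty_gtr.
  by rewrite mulr1.
- move=> n t Dt; rewrite csqC (le_trans _ (uh t Dt))// /un exprMn.
  by case: (`|u t| <= n%:R); rewrite /= ?mulr1n ?mulr0n ?expr1n ?mulr1// expr0n mulr0 sqr_ge0.
Unshelve. all: end_near. Qed.

Theorem L2_monotone_class f : L2 m f -> Cl f.
Proof.
move=> f2; have /L2P[[mr mi] _] := f2.
have Cr : Cl (fun t => (complex.Re (f t))%:C).
  by apply: (Cl_real mr f2) => t _; rewrite lerDl sqr_ge0.
have Ci : Cl (fun t => (complex.Im (f t))%:C).
  by apply: (Cl_real mi f2) => t _; rewrite lerDr sqr_ge0.
have := Cl_lin 'i Ci Cr; congr Cl; apply/funext => t.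
by rewrite [RHS]complexE addrC.
Qed.

End Density.

(** * From vanishing integrals to smallness at infinitely many indices *)

Section FrequentlySmall.
Variable R : realType.
Local Notation D := (@I01 R).
Hint Resolve measurable_I01 leb_I01 : core.

(* Fatou's lemma in disguise: the infimum of a tail has a null integral. *)
Lemma ae_frequently_small (G : nat -> R -> R) :
  (forall n t, 0 <= G n t) -> (forall n, (leb R).-integrable D (EFin \o G n)) ->
  (fun n => \int[leb R]_(t in D) G n t) @ \oo --> (0 : R) ->
  {ae (leb R), forall t, D t -> forall N e, 0 < e -> exists2 n, (N <= n)%N & G n t < e}.
Proof.
move=> G0 iG cG.
have mG n : measurable_fun D (fun t => (G n t)%:E) by apply/measurable_EFinP; exact: itg_meas (iG n).
pose I N t := einfs (fun n => (G n t)%:E) N.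
have mI N : measurable_fun D (I N) := measurable_fun_einfs mG N.
have I0 N t : (0 <= I N t)%E by apply: le_ereal_inf_tmp => _ [n /= _ <-]; rewrite lee_fin.
have II N : (\int[leb R]_(t in D) `|I N t| = 0)%E.
  under eq_integral do rewrite gee0_abs//.
  apply/eqP; rewrite eq_le integral_ge0// andbT.
  apply/lee_addgt0Pr => e e0; rewrite add0e.
  move/cvgrPdist_lt : cG => /(_ e e0) [M _ HM].
  have := HM (maxn M N) (leq_maxl _ _); rewrite sub0r normrN => h.
  apply: (@le_trans _ _ (\int[leb R]_(t in D) (G (maxn M N) t)%:E)%E).
    apply: ge0_le_integral => //; [exact (mI N)|exact (mG _)|].
    move=> t _; apply: ereal_inf_lbound; exists (maxn M N) => //=; exact: leq_maxr.
  rewrite -(fineK (integrable_fin_num (@measurable_I01 R) (iG (maxn M N)))) lee_fin.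
  by rewrite (le_trans (ler_norm _))// ltW.
have aeI : {ae (leb R), forall t, forall N, D t -> I N t = 0%E}.
  by apply: ae_foralln => N; exact: ((ae_eq_integral_abs (leb R) (@measurable_I01 R) (mI N)).1 (II N)).
apply: aeS aeI => t h Dt N e e0; have hI : ereal_inf (sdrop (fun n => (G n t)%:E) N) = 0%E := h N Dt.
have : (ereal_inf (sdrop (fun n => (G n t)%:E) N) < e%:E)%E by rewrite hI lte_fin.
by move=> /ereal_inf_lt[_ [n /= Nn <-]]; rewrite lte_fin => ?; exists n.
Qed.

End FrequentlySmall.

(** * The second component *)

Section SecondComponent.
Variables (R : realType) (mu : {measure set (measurableTypeR R) -> \bar R}).
Hypothesis mu1 : mu (@I01 R) = 1%E.
Variables (g : R[i]) (Phi : (R -> R[i]) -> (R -> R[i]) * (R -> R[i])).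
Hypotheses (g1 : csq g < 1) (HPhi : is_Phi mu g Phi).
Implicit Types (f h k : R -> R[i]) (a l : R[i]).
Local Notation D := (@I01 R).
Local Notation tau := (thetab mu g).
Local Notation Del := (Delta mu g).
Local Notation s := (sg g).
Local Notation q1 := (sPhi1 g Phi).
Local Notation q2 := (sPhi2 g Phi).
Local Notation v := (defect1 g Phi).
Local Notation w := (defect2 g Phi).
Hint Resolve measurable_I01 leb_I01 : core.
Let mu_le1 : (mu D <= 1)%E. Proof. by rewrite mu1. Qed.
Hint Resolve mu_le1 : core.
Let vn0 := defect1_neq0_ae mu1 g1 HPhi.
Let dfm := defect_formulas mu1 g1 HPhi.

(** [Tplus] is replaced by its boundary value [q1 / v]: the formula in [Good] becomes pointwise
    linear in [f] and [q1 f], with coefficients free of [f] and no radial limit of a Cauchy integral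
    of [f]. *)
Let Bf t := (cj g - (cj g - 1) * (q1 (@bb R) t / v t)) * Del t.
Let Cf t := (cj g - 1) * Del t / v t.
Let Good f := L2 mu f /\ {ae (leb R), forall t, D t -> q2 f t = Bf t * f t + Cf t * q1 f t}.

Let q_lin a f h : L2 mu f -> L2 mu h -> {ae (leb R), forall t, D t ->
  q1 (fun t => a * f t + h t) t = a * q1 f t + q1 h t /\
  q2 (fun t => a * f t + h t) t = a * q2 f t + q2 h t}.
Proof.
move=> f2 h2; have [H _] := HPhi.
apply: aeS (H a f h f2 h2) => t /[apply] -[/= e1 e2].
by rewrite /sPhi1 /sPhi2 e1 e2; split; ring.
Qed.

Let Good1 : Good (fun=> 1).
Proof.
split; first exact: L2_bb.
apply: aeS2 vn0 dfm => t v0 h Dt; have [_ E _ _] := h Dt; have {}v0 := v0 Dt.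
rewrite -/(@bb R) E /Bf /Cf; by field.
Qed.

Let Good_lin a f h : Good f -> Good h -> Good (fun t => a * f t + h t).
Proof.
move=> [f2 hf] [h2 hh]; split; first exact: L2_lin.
apply: aeS3 hf hh (q_lin a f2 h2) => t e1 e2 e3 Dt; have [-> ->] := e3 Dt.
by rewrite e1// e2//; ring.
Qed.

(** Almost everywhere [Cf * v = w], so the defect terms that [Phi_xi] adds to [q1] and [q2]
    match. *)
Let Good_xi f : Good f -> Good (fun t => xi t * f t).
Proof.
move=> [f2 hf]; split; first exact: L2_xi.
have vd : {ae (leb R), forall t, D t -> v t != 0 /\ w t = (cj g - 1) * Del t}.
  by apply: aeS2 vn0 dfm => t v0 h Dt; have [_ _ _ ->] := h Dt; rewrite v0.
apply: aeS3 hf (Phi_xi mu1 HPhi f2) vd => t e1 e2 e3 Dt.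
have [-> ->] := e2 Dt; have [v0 ->] := e3 Dt; rewrite e1// /Bf /Cf.
by field.
Qed.

(** [Phi_xi] for [cj xi * f] expresses the formula for [f] as [xi] times the wanted one, and [xi]
    has no zero. *)
Let Good_cjxi f : Good f -> Good (fun t => cj (xi t) * f t).
Proof.
move=> [f2 hf]; pose f' t := cj (xi t) * f t.
have f'2 : L2 mu f'.
  apply: (@L2_bddM _ _ _ _ 1) => //; first exact/cmeasJ/cmeas_xi.
  by move=> t _; rewrite csqJ csq_xi.
have fE : (fun t => xi t * f' t) = f by apply/funext => t; rewrite /f' mulrA mul_xi_conj mul1r.
split => //.
have vd : {ae (leb R), forall t, D t -> v t != 0 /\ w t = (cj g - 1) * Del t}.
  by apply: aeS2 vn0 dfm => t v0 h Dt; have [_ _ _ ->] := h Dt; rewrite v0.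
have := Phi_xi mu1 HPhi f'2; rewrite fE => hx.
apply: aeS3 hf hx vd => t e1 e2 e3 Dt.
have [a1 a2] := e2 Dt; have [v0 wE] := e3 Dt; have := e1 Dt; rewrite a1 a2 wE -/(f' t).
have -> : f t = xi t * f' t by rewrite -fE.
move=> E; apply: (mulfI (xi_neq0 t)).
apply: (addIr (cint mu f * ((cj g - 1) * Del t))); rewrite E /Bf /Cf.
by field.
Qed.

Let nrm2_cvg0 (dn : nat -> R -> R[i]) h : (forall n, L2 mu (dn n)) -> L2 mu h ->
  (forall t, D t -> (fun n => csq (dn n t)) @ \oo --> (0 : R)) ->
  (forall n t, D t -> csq (dn n t) <= 4 * csq (h t)) ->
  (fun n => nrm2 mu (dn n)) @ \oo --> (0 : R).
Proof.
move=> d2 /L2P[mh ih] cd bd.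
have [] := @dominated_convergence _ _ _ mu D (@measurable_I01 R)
  (fun n t => (csq (dn n t))%:E) (cst 0%E) (fun t => (4 * csq (h t))%:E).
- by move=> n; have /L2P[m _] := d2 n; apply/measurable_EFinP; exact: cmeas_csq.
- exact: measurable_cst.
- by apply: (@aeS _ _ (fun=> True)); [move=> t _ Dt; apply: cvg_EFin; [near=> n|exact: cd]|exact: aeW].
- exact: (itgZ 4 ih).
- apply: (@aeS _ _ (fun=> True)); last exact: aeW.
  by move=> t _ n Dt; rewrite gee0_abs ?lee_fin ?csq_ge0// bd.
move=> _ _ H; have : fine (\int[mu]_(t in D) (csq (dn n t))%:E) @[n --> \oo] -->
    fine (\int[mu]_(t in D) (cst 0%E) t).
  by apply: fine_cvg; rewrite fineK// integral0.
rewrite integral0 /=; apply: cvg_trans; apply: near_eq_cvg; near=> n.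
by rewrite nrm2E.
Unshelve. all: end_near. Qed.

(* Dominated convergence in [L^2 (mu)] carries over to the model space by isometry, and pointwise
   convergence makes the first summand of the formula converge Lebesgue-a.e. This also covers
   the singular part of [mu]. *)
Let Good_lim (fn : nat -> R -> R[i]) f h : (forall n, Good (fn n)) -> L2 mu f -> L2 mu h ->
  (forall t, D t -> cvgc \oo (fun n => fn n t) (f t)) ->
  (forall n t, D t -> csq (fn n t) <= csq (h t)) -> Good f.
Proof.
move=> gf f2 h2 cf bf; split=> //.
pose dn n t : R[i] := (-1) * f t + fn n t.
have d2 n : L2 mu (dn n) by apply: L2_lin => //; have [] := gf n.
have bfl t : D t -> csq (f t) <= csq (h t).
  move=> Dt; apply: (cvgr_to_le (cvgc_csq (cf t Dt))).
  by near=> n; exact: bf.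
have cd t : D t -> (fun n => csq (dn n t)) @ \oo --> (0 : R).
  move=> Dt; have -> : (0 : R) = csq ((-1) * f t + f t) by rewrite mulN1r addNr csq0.
  by apply: cvgc_csq; apply: cvgcD; [exact: cvgc_cst|exact: cf].
have bd n t : D t -> csq (dn n t) <= 4 * csq (h t).
  move=> Dt; rewrite (le_trans (csqD_le _ _))// mulN1r csqN.
  have := bf n t Dt; have := bfl t Dt; lra.
have c0 := nrm2_cvg0 d2 h2 cd bd.
pose G n t := csq (q1 (dn n) t) + csq (q2 (dn n) t).
have L2q n : L2 (leb R) (q1 (dn n)) /\ L2 (leb R) (q2 (dn n)).
  by have [? ?] := Phi_L2p HPhi (d2 n); split; exact: L2Z.
have iq n : (leb R).-integrable D (fun t => (csq (q1 (dn n) t))%:E) /\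
            (leb R).-integrable D (fun t => (csq (q2 (dn n) t))%:E).
  by have [/L2P[_ i1] /L2P[_ i2]] := L2q n.
have iG n : (leb R).-integrable D (EFin \o G n) by have [i1 i2] := iq n; exact: itgD.
have GE n : \int[leb R]_(t in D) G n t = s ^+ 2 * nrm2 mu (dn n).
  have [i1 i2] := iq n; have [P1 P2] := Phi_L2p HPhi (d2 n).
  rewrite RintegralD// -!nrm2E nrm2Z// nrm2Z// -mulrDr csqC.
  by rewrite (Phi_nrm2 HPhi (d2 n)).
have G0 n t : 0 <= G n t by rewrite addr_ge0 ?csq_ge0.
have cG : (fun n => \int[leb R]_(t in D) G n t) @ \oo --> (0 : R).
  rewrite (funext GE : (fun n => \int[leb R]_(t in D) G n t) = _) -(mulr0 (s ^+ 2)).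
  exact: cvgMl_tmp.
have h1 := ae_frequently_small G0 iG cG.
have h2' : {ae (leb R), forall t, forall n, D t -> q2 (fn n) t = Bf t * fn n t + Cf t * q1 (fn n) t}.
  by apply: ae_foralln => n; have [] := gf n.
have h3 : {ae (leb R), forall t, forall n, D t -> q1 (dn n) t = (-1) * q1 f t + q1 (fn n) t /\
    q2 (dn n) t = (-1) * q2 f t + q2 (fn n) t}.
  by apply: ae_foralln => n; apply: q_lin => //; have [] := gf n.
apply: aeS3 h1 h2' h3 => t e1 e2 e3 Dt.
apply/eqP; rewrite -subr_eq0; apply/eqP; set Y := _ - _.
(* The formula holds for [fn n], so the error [Y] for [f], which does not depend on [n], is
   expressed through [dn n] and its image alone. *)
have YE n : Y = - q2 (dn n) t + (Bf t * dn n t + Cf t * q1 (dn n) t).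
  have [-> ->] := e3 n Dt; rewrite /Y /dn e2//; ring.
apply/eqP; rewrite -csq_eq0 eq_le csq_ge0 andbT.
apply/ler_addgt0Pr => e e0; rewrite add0r.
(* The weights come from applying [csqD_le] twice to [YE]. *)
pose M := 2 + 4 * csq (Bf t) + 4 * csq (Cf t).
have M0 : 0 < M by have := csq_ge0 (Bf t); have := csq_ge0 (Cf t); rewrite /M; lra.
have eM : 0 < e / M by rewrite divr_gt0.
have [N _ HN] : \forall n \near \oo, csq (dn n t) < e / M.
  move/cvgrPdist_lt : (cd t Dt) => /(_ _ eM); apply: filterS => n.
  by rewrite sub0r normrN ger0_norm ?csq_ge0.
(* [csq (dn n t)] is small for all large [n], the images at least for infinitely many [n]; one
   common index suffices because [Y] is independent of [n]. *)
have [n Nn Gn] := e1 Dt N _ eM; have dN := HN n Nn.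
have a1 := csqD_le (- q2 (dn n) t) (Bf t * dn n t + Cf t * q1 (dn n) t).
have a2 := csqD_le (Bf t * dn n t) (Cf t * q1 (dn n) t).
rewrite -YE csqN in a1; rewrite (csqM (Bf t) (dn n t)) (csqM (Cf t) (q1 (dn n) t)) in a2.
have p1 := csq_ge0 (q1 (dn n) t); have p2 := csq_ge0 (q2 (dn n) t).
have p3 := csq_ge0 (Bf t); have p4 := csq_ge0 (Cf t).
have b1 : csq (q1 (dn n) t) <= e / M by move: Gn; rewrite /G; lra.
have b2 : csq (q2 (dn n) t) <= e / M by move: Gn; rewrite /G; lra.
have b3 : csq (Bf t) * csq (dn n t) <= csq (Bf t) * (e / M) by rewrite ler_wpM2l// ltW.
have b4 : csq (Cf t) * csq (q1 (dn n) t) <= csq (Cf t) * (e / M) by rewrite ler_wpM2l.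
have a3 := le_trans a2 (lerD (ler_wpM2l (ler0n _ 2) b3) (ler_wpM2l (ler0n _ 2) b4)).
have eE : e = M * (e / M) by rewrite mulrC divfK// gt_eqF.
rewrite eE; apply: (le_trans a1).
apply: (le_trans (lerD (ler_wpM2l (ler0n _ 2) b2) (ler_wpM2l (ler0n _ 2) a3))).
rewrite le_eqVlt; apply/orP; left; apply/eqP; rewrite /M; ring.
Unshelve. all: end_near. Qed.

Lemma second_component f : L2 mu f -> {ae (leb R), forall t, D t ->
  q2 f t = (cj g - (cj g - 1) * Tplus mu (@bb R) t) * Del t * f t
    + (cj g - 1) * Del t * Tplus mu f t}.
Proof.
move=> f2.
have [_ Gf] : Good f.
  by apply: (@L2_monotone_class _ mu Good) => // h [].
apply: aeS3 Gf (Tplus_ae mu1 g1 HPhi (L2_bb mu1)) (Tplus_ae mu1 g1 HPhi f2) => t e1 e2 e3 Dt.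
have [_ ->] := e2 Dt; have [v0 ->] := e3 Dt; rewrite e1// /Bf /Cf; ring.
Qed.

End SecondComponent.

Theorem theorem4p2 (R : realType) (mu : probability (measurableTypeR R) R)
  (mu_T : mu (~` @I01 R) = 0%E)
  (g : R[i]) (g_lt1 : `|g| < 1)
  (nondeg : g != 0 \/
     ~ (forall A : set (measurableTypeR R), measurable A ->
          mu (A `&` @I01 R) = @leb R (A `&` @I01 R)))
  (Phi : (R -> R[i]) -> (R -> R[i]) * (R -> R[i]))
  (HPhi : is_Phi mu g Phi) :
  forall f : R -> R[i], L2 mu f ->
    {ae @leb R, forall t, @I01 R t ->
      (Num.sqrt (1 - complex.Re (`|g| ^+ 2)))%:C * (Phi f).1 t
        = (1 + g^* * thetab mu g t) / Tplus mu (@bb R) t * Tplus mu f t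
      /\
      (Num.sqrt (1 - complex.Re (`|g| ^+ 2)))%:C * (Phi f).2 t
        = (g^* - (g^* - 1) * Tplus mu (@bb R) t) * Delta mu g t * f t
          + (g^* - 1) * Delta mu g t * Tplus mu f t}.
Proof.
move=> f f2.
have g1 : csq g < 1.
  have : `|g| ^+ 2 < 1 by rewrite expr_lt1.
  by rewrite -add_Re2_Im2 -(rmorph1 (real_complex R)) ltcR.
have mu1 : mu (@I01 R) = 1%E.
  have mI := @measurable_I01 R.
  have E : (mu (@I01 R `|` ~` @I01 R) = mu (@I01 R) + mu (~` @I01 R))%E.
    by apply: measureU => //; [exact: measurableC|rewrite setICr].
  by rewrite mu_T adde0 setUv probability_setT in E.
apply: aeS2 (first_component mu1 g1 HPhi f2) (second_component mu1 g1 HPhi f2) => t e1 e2 Dt.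
rewrite !Re_sqr_norm !conjCE; split; [exact: e1|exact: e2].
Qed.
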